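(* Let $A$ be a finite dimensional algebra over an algebraically closed field $\mathbb{K}$, and assume that $A$ is $\tau$-tilting finite. Consider the following three collections: (S) equivalence classes of finite dimensional silting $A$-modules; (E) epiclasses of ring epimorphisms $A\to B$ with $\mathrm{Tor}_1^A(B,B)=0$; (W) bireflective extension-closed subcategories of $\mathrm{Mod}\text{-}A$. Let $\alpha:(S)\to(E)$ be the map sending a (finite dimensional, hence minimal) silting module $T$ to its associated silting ring epimorphism, let $\epsilon:(E)\to(W)$ be the map sending $A\to B$ to the essential image $\mathcal{X}_B$ of the restriction functor $\mathrm{Mod}\text{-}B\to\mathrm{Mod}\text{-}A$, and let $\mathfrak{a}:(S)\to(W)$ be the map $T\mapsto \mathfrak{a}(\mathrm{Gen}(T))$. Then $\alpha$, $\epsilon$ and $\mathfrak{a}$ are (well-defined) bijections and $\epsilon\circ\alpha=\mathfrak{a}$. Moreover, every ring epimorphism $A\to B$ with $\mathrm{Tor}_1^A(B,B)=0$ is a universal localisation, and $\dim_{\mathbb{K}} B<\infty$.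
   Context: Modules are right modules; $\mathrm{Mod}\text{-}A$ is the category of all right $A$-modules, $\mathrm{mod}\text{-}A$ that of finitely presented ones, $\mathsf{D}(A)$ the derived category of $\mathrm{Mod}\text{-}A$. $\mathrm{Add}(M)$ is the class of direct summands of direct sums of copies of $M$ (similarly for an object of $\mathsf{D}(A)$); $\mathrm{Gen}(M)$ is the class of quotients of direct sums $M^{(I)}$; $M^\circ=\{X\mid \mathrm{Hom}_A(M,X)=0\}$. $\tau$-tilting finiteness: a finite dimensional module $M$ is $\tau$-rigid if $\mathrm{Hom}_A(M,\tau M)=0$, with $\tau$ the Auslander-Reiten translate. $A$ is $\tau$-tilting finite if there are only finitely many isomorphism classes of indecomposable $\tau$-rigid $A$-modules; equivalently (Demonet-Iyama-Jasso) there are only finitely many torsion classes in $\mathrm{mod}\text{-}A$; equivalently every torsion class in $\mathrm{mod}\text{-}A$ is functorially finite. Silting modules: for a morphism $\sigma$ between projective modules, $\mathcal{D}_\sigma=\{X\mid \mathrm{Hom}_A(\sigma,X)\text{ surjective}\}$ and $\mathcal{X}_\sigma=\{X\mid\mathrm{Hom}_A(\sigma,X)\text{ bijective}\}$. $T$ is silting (with respect to $\sigma$) if it has a projective presentation $P\xrightarrow{\sigma}Q\to T\to0$ with $\mathcal{D}_\sigma=\mathrm{Gen}(T)$. $T_1$ is partial silting with respect to a projective presentation $\sigma_1$ if $\mathcal{D}_{\sigma_1}$ is a torsion class containing $T_1$. Silting modules $T,T'$ are equivalent if $\mathrm{Gen}(T)=\mathrm{Gen}(T')$. Identify $\sigma$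 with its cone in $\mathsf{D}(A)$ (the complex $P\to Q$ in degrees $-1,0$). If $T$ is silting with respect to $\sigma$, there is a triangle $A\xrightarrow{\phi}\sigma_0\to\sigma_1\to A[1]$ in $\mathsf{D}(A)$ with $\sigma_0,\sigma_1\in\mathrm{Add}(\sigma)$ and $\phi$ a left $\mathrm{Add}(\sigma)$-approximation. $T$ is minimal if $\phi$ can be chosen left-minimal, i.e. every $h\in\mathrm{End}_{\mathsf{D}(A)}(\sigma_0)$ with $h\phi=\phi$ is an isomorphism. Then, for such $\phi$, the associated partial silting module is $T_1=H^0(\sigma_1)$; it is partial silting with respect to $\sigma_1$ (viewed as a projective presentation) and $\mathcal{D}_{\sigma_1}=\mathrm{Gen}(T)$. Every finite dimensional silting module over a finite dimensional algebra is minimal. A full subcategory of $\mathrm{Mod}\text{-}A$ is bireflective if its inclusion functor has both a left and a right adjoint, equivalently if it is closed under products, coproducts, kernels and cokernels. A ring epimorphism is an epimorphism in the category of unital rings (the zero ring is allowed as target). Two ring epimorphisms $f_i:A\to B_i$ ($i=1,2$) lie in the same epiclass if $f_2=h f_1$ for a ring isomorphism $h:B_1\to B_2$. Known: $(A\to B)\mapsto\mathcal{X}_B$ is a bijection between epiclasses of ring epimorphisms with $\mathrm{Tor}_1^A(B,B)=0$ and bireflective extension-closed subcategories. For $T$ minimal silting with associated $T_1,\sigma_1$, the subcategory $\mathcal{X}_{\sigma_1}=\mathrm{Gen}(T)\cap T_1^\circ$ is bireflective and extension-closed, and the silting ring epimorphism associated with $T$ is the ring epimorphism $A\to B$ (up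 to equivalence) with $\mathcal{X}_B=\mathcal{X}_{\sigma_1}$. For a torsion class $\mathcal{T}$ in $\mathrm{Mod}\text{-}A$, $\mathfrak{a}(\mathcal{T})=\{X\in\mathcal{T}\mid \mathrm{Ker}(g)\in\mathcal{T}\text{ for every }Y\in\mathcal{T}\text{ and every morphism }g:Y\to X\}$. For a set $\Sigma$ of morphisms between finitely generated projective $A$-modules, the universal localisation $f_\Sigma:A\to A_\Sigma$ is the ring homomorphism such that $\sigma\otimes_A A_\Sigma$ is an isomorphism for all $\sigma\in\Sigma$ and every ring homomorphism $A\to B$ with this property factors uniquely through $f_\Sigma$. ''Is a universal localisation'' means equivalent to some $f_\Sigma$. *)

(* Defs.v *)
From HB Require Import structures.
From mathcomp Require Import all_boot all_order all_algebra all_field.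
From mathcomp Require Import boolp.

Set Implicit Arguments.
Unset Strict Implicit.
Unset Printing Implicit Defensive.

Import GRing.Theory.

Local Open Scope ring_scope.

(* A right module over A is an [lmodType A^c], where A^c is the opposite ring:
   (a : A^c) *: x stands for x a.  Everything that does not involve both sides
   is stated for [lmodType R] over an arbitrary unital ring R, possibly zero;
   a full subcategory of Mod-R is a predicate on its objects.  (The [set] of
   classical_sets is too small, by a universe constraint, to apply here.) *)

Notation subcat R := (lmodType R -> Prop) (only parsing).

Definition onto (X Y : Type) (f : X -> Y) := forall y, exists x, f x = y.

Definition exact (X Y : Type) (Z : zmodType) (f : X -> Y) (g : Y -> Z) :=
  forall y, g y = 0 <-> exists x, f x = y.

Section Modules.
Variable R : pzRingType.
Implicit Types (M N X Y Z P Q T : lmodType R) (C : subcat R).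

Definition lmod_iso M N := exists f : {linear M -> N}, bijective f.

Definition replete C := forall M N, lmod_iso M N -> C M -> C N.

Definition short_exact X Y Z (f : {linear X -> Y}) (g : {linear Y -> Z}) :=
  [/\ injective f, exact f g & onto g].

Definition extension_closed C :=
  forall X Y Z (f : {linear X -> Y}) (g : {linear Y -> Z}),
    short_exact f g -> C X -> C Z -> C Y.

(* The left adjoint of the inclusion, given on objects together with the unit
   of the adjunction. *)
Definition reflective C :=
  exists (L : lmodType R -> lmodType R) (eta : forall X, {linear X -> L X}),
    (forall X, C (L X)) /\
    forall X Y (f : {linear X -> Y}), C Y ->
      exists g : {linear L X -> Y}, (forall x, g (eta X x) = f x) /\
        forall g' : {linear L X -> Y}, (forall x, g' (eta X x) = f x) -> g' =1 g.

(* The right adjoint of the inclusion, together with the counit. *)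
Definition coreflective C :=
  exists (L : lmodType R -> lmodType R) (eps : forall X, {linear L X -> X}),
    (forall X, C (L X)) /\
    forall X Y (f : {linear Y -> X}), C Y ->
      exists g : {linear Y -> L X}, (forall y, eps X (g y) = f y) /\
        forall g' : {linear Y -> L X}, (forall y, eps X (g' y) = f y) -> g' =1 g.

Definition bireflective C := reflective C /\ coreflective C.

(* Subcategories are taken closed under isomorphism, so that two of them are
   the same exactly when they are equal as sets of modules. *)
Definition bireflective_ext_closed C :=
  [/\ replete C, bireflective C & extension_closed C].

Definition projective P :=
  forall M N (e : {linear M -> N}) (f : {linear P -> N}), onto e ->
    exists g : {linear P -> M}, forall p, e (g p) = f p.

Definition fin_gen P :=
  exists (n : nat) (v : 'I_n -> P),
    forall x, exists c : 'I_n -> R, x = \sum_i c i *: v i.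

Definition indecomposable M :=
  (exists x : M, x != 0) /\
  forall M1 M2, lmod_iso M (M1 * M2)%type ->
    (forall x : M1, x = 0) \/ (forall x : M2, x = 0).

(* Every K <= Y with embedding k and image Ker g counts as "the" kernel. *)
Definition is_kernel N Y X (k : {linear N -> Y}) (g : {linear Y -> X}) :=
  injective k /\ exact k g.

Definition afrak C : subcat R :=
  fun X => C X /\ forall Y (g : {linear Y -> X}), C Y ->
     forall N (k : {linear N -> Y}), is_kernel k g -> C N.

Definition Dclass P Q (s : {linear P -> Q}) : subcat R :=
  fun X => forall f : {linear P -> X},
     exists g : {linear Q -> X}, forall p, g (s p) = f p.

Definition Xclass P Q (s : {linear P -> Q}) : subcat R :=
  fun X => forall f : {linear P -> X},
     exists g : {linear Q -> X}, (forall p, g (s p) = f p) /\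
       forall g' : {linear Q -> X}, (forall p, g' (s p) = f p) -> g' =1 g.

Definition projective_presentation P Q T (s : {linear P -> Q})
    (p : {linear Q -> T}) :=
  [/\ projective P, projective Q, exact s p & onto p].

Definition projective_cover P M (p : {linear P -> M}) :=
  [/\ projective P, onto p &
    forall X (g : {linear X -> P}), onto (p \o g) -> onto g].

(* P1 -> P0 -> M -> 0 with P0 a projective cover of M and P1 one of the kernel
   N of P0 -> M, embedded by k. *)
Definition minimal_projective_presentation P1 P0 M (d : {linear P1 -> P0})
    (p : {linear P0 -> M}) :=
  projective_cover p /\
  exists N (k : {linear N -> P0}) (q : {linear P1 -> N}),
    [/\ is_kernel k p, projective_cover q & forall x, d x = k (q x)].

End Modules.

(* M^(I), the functions I -> M of finite support. *)
Record copower (R : pzRingType) (I : choiceType) (M : lmodType R) := Copower {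
  cop_fun :> I -> M;
  cop_supp : exists s : seq I, forall i, i \notin s -> cop_fun i = 0
}.

HB.instance Definition _ R I M := gen_eqMixin (@copower R I M).
HB.instance Definition _ R I M := gen_choiceMixin (@copower R I M).

Section Copower.
Variables (R : pzRingType) (I : choiceType).
Implicit Types (M N : lmodType R).

Lemma copowerP M (u v : copower I M) : cop_fun u =1 cop_fun v -> u = v.
Proof.
case: u v => [u hu] [v hv] /= /funext uv; move: hu hv; rewrite uv => hu hv.
by rewrite (Prop_irrelevance hu hv).
Qed.

Fact cop_zero_supp M :
  exists s : seq I, forall i, i \notin s -> (fun=> 0 : M) i = 0.
Proof. by exists [::]. Qed.

Fact cop_add_supp M (u v : copower I M) :
  exists s : seq I, forall i, i \notin s -> u i + v i = 0.
Proof.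
case: u v => [u [s hs]] [v [t ht]] /=; exists (s ++ t) => i.
by rewrite mem_cat negb_or => /andP[/hs -> /ht ->]; rewrite addr0.
Qed.

Fact cop_opp_supp M (u : copower I M) :
  exists s : seq I, forall i, i \notin s -> - u i = 0.
Proof. by case: u => [u [s hs]] /=; exists s => i /hs ->; rewrite oppr0. Qed.

Fact cop_scale_supp M (a : R) (u : copower I M) :
  exists s : seq I, forall i, i \notin s -> a *: u i = 0.
Proof. by case: u => [u [s hs]] /=; exists s => i /hs ->; rewrite scaler0. Qed.

Definition cop_zero M : copower I M := Copower (cop_zero_supp M).
Definition cop_add M (u v : copower I M) := Copower (cop_add_supp u v).
Definition cop_opp M (u : copower I M) := Copower (cop_opp_supp u).
Definition cop_scale M a (u : copower I M) := Copower (cop_scale_supp a u).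

Fact cop_addA M : associative (@cop_add M).
Proof. by move=> u v w; apply/copowerP => i /=; rewrite addrA. Qed.
Fact cop_addC M : commutative (@cop_add M).
Proof. by move=> u v; apply/copowerP => i /=; rewrite addrC. Qed.
Fact cop_add0 M : left_id (cop_zero M) (@cop_add M).
Proof. by move=> u; apply/copowerP => i /=; rewrite add0r. Qed.
Fact cop_addN M : left_inverse (cop_zero M) (@cop_opp M) (@cop_add M).
Proof. by move=> u; apply/copowerP => i /=; rewrite addNr. Qed.

HB.instance Definition _ M := GRing.isZmodule.Build (copower I M)
  (@cop_addA M) (@cop_addC M) (@cop_add0 M) (@cop_addN M).

Fact cop_scaleA M a b (u : copower I M) :
  cop_scale a (cop_scale b u) = cop_scale (a * b) u.
Proof. by apply/copowerP => i /=; rewrite scalerA. Qed.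
Fact cop_scale1 M : left_id 1 (@cop_scale M).
Proof. by move=> u; apply/copowerP => i /=; rewrite scale1r. Qed.
Fact cop_scaleDr M : right_distributive (@cop_scale M) +%R.
Proof. by move=> a u v; apply/copowerP => i /=; rewrite scalerDr. Qed.
Fact cop_scaleDl M (u : copower I M) :
  {morph (@cop_scale M)^~ u : a b / a + b}.
Proof. by move=> a b; apply/copowerP => i /=; rewrite scalerDl. Qed.

HB.instance Definition _ M := GRing.Zmodule_isLmodule.Build R (copower I M)
  (@cop_scaleA M) (@cop_scale1 M) (@cop_scaleDr M) (@cop_scaleDl M).

Section Map.
Variables (M N : lmodType R) (f : {linear M -> N}).

Fact cop_map_supp (u : copower I M) :
  exists s : seq I, forall i, i \notin s -> f (u i) = 0.
Proof. by case: u => [u [s hs]] /=; exists s => i /hs ->; rewrite linear0. Qed.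

Definition cop_map (u : copower I M) : copower I N := Copower (cop_map_supp u).

Fact cop_map_linear : linear cop_map.
Proof. by move=> a u v; apply/copowerP => i /=; rewrite linearP. Qed.

HB.instance Definition _ :=
  GRing.isLinear.Build R (copower I M) (copower I N) _ cop_map cop_map_linear.

End Map.
End Copower.

Definition Gen (R : pzRingType) (M : lmodType R) : subcat R :=
  fun X => exists (I : choiceType) (f : {linear copower I M -> X}), onto f.

(* Cochain complexes; in all the definitions below, [i + 1] ranges over all
   degrees, which avoids transporting along (i - 1) + 1 = i. *)
Record cpx (R : pzRingType) := Cpx {
  cob :> int -> lmodType R;
  cdiff : forall i, {linear cob i -> cob (i + 1)};
  cdiffK : forall i x, cdiff (i + 1) (cdiff i x) = 0
}.
Arguments cdiff {R} c i.

Record cmap (R : pzRingType) (X Y : cpx R) := Cmap {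
  cfun :> forall i, {linear X i -> Y i};
  cfunP : forall i x, cfun (i + 1) (cdiff X i x) = cdiff Y i (cfun i x)
}.
Arguments cfun {R X Y} c i.

Section Complexes.
Variable R : pzRingType.
Implicit Types X Y Z : cpx R.

Fact cid_proof X i (x : X i) : idfun (cdiff X i x) = cdiff X i (idfun x).
Proof. by []. Qed.

Definition cid X : cmap X X := @Cmap R X X (fun i => idfun) (@cid_proof X).

Fact ccomp_proof X Y Z (g : cmap Y Z) (f : cmap X Y) i (x : X i) :
  (g (i + 1) \o f (i + 1)) (cdiff X i x) = cdiff Z i ((g i \o f i) x).
Proof. by rewrite /= !cfunP. Qed.

Definition ccomp X Y Z (g : cmap Y Z) (f : cmap X Y) : cmap X Z :=
  @Cmap R X Z (fun i => g i \o f i) (@ccomp_proof X Y Z g f).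

Definition homotopic X Y (f g : cmap X Y) :=
  exists s : forall i, {linear X (i + 1) -> Y i},
    forall i (x : X (i + 1)),
      f (i + 1) x - g (i + 1) x =
        cdiff Y i (s i x) + s (i + 1) (cdiff X (i + 1) x).

(* The map induced by f on the cohomology in degree i + 1 is bijective. *)
Definition qis X Y (f : cmap X Y) := forall i,
  (forall x : X (i + 1), cdiff X (i + 1) x = 0 ->
     (exists y, f (i + 1) x = cdiff Y i y) -> exists z, x = cdiff X i z) /\
  (forall y : Y (i + 1), cdiff Y (i + 1) y = 0 ->
     exists x z, cdiff X (i + 1) x = 0 /\ f (i + 1) x + cdiff Y i z = y).

Fact qis_id X : qis (cid X).
Proof.
move=> i; split=> [x _ [y /= ->]|y dy]; first by exists y.
by exists y, 0; rewrite linear0 addr0.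
Qed.

Section Shift.
Variable X : cpx R.
Definition shift_d_fun i (x : X (i + 1)) := - cdiff X (i + 1) x.
Fact shift_d_linear i : linear (@shift_d_fun i).
Proof. by move=> a x y; rewrite /shift_d_fun linearP opprD scalerN. Qed.
HB.instance Definition _ i := GRing.isLinear.Build R (X (i + 1))
  (X (i + 1 + 1)) _ (@shift_d_fun i) (@shift_d_linear i).
Definition shift_d i : {linear X (i + 1) -> X (i + 1 + 1)} := @shift_d_fun i.
Fact shift_dK i x : shift_d (i + 1) (shift_d i x) = 0.
Proof. by rewrite /= /shift_d_fun linearN cdiffK !oppr0. Qed.
(* X[1] *)
Definition shift : cpx R := @Cpx R (fun i => X (i + 1)) shift_d shift_dK.
End Shift.

Fact shift_map_proof X Y (f : cmap X Y) i (x : shift X i) :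
  f (i + 1 + 1) (cdiff (shift X) i x) = cdiff (shift Y) i (f (i + 1) x).
Proof. by rewrite /= /shift_d_fun linearN cfunP. Qed.

Definition shift_map X Y (f : cmap X Y) : cmap (shift X) (shift Y) :=
  @Cmap R (shift X) (shift Y) (fun i => f (i + 1)) (@shift_map_proof X Y f).

Fact qis_shift X Y (f : cmap X Y) : qis f -> qis (shift_map f).
Proof.
move=> qf i; case: (qf (i + 1)) => inj sur; split=> /=.
  move=> x /eqP; rewrite oppr_eq0 => /eqP dx [y fx].
  have [|z ->] := inj x dx; first by exists (- y); rewrite linearN.
  by exists (- z); rewrite linearN opprK.
move=> y /eqP; rewrite oppr_eq0 => /eqP /sur[x [z [dx <-]]].
by exists x, (- z); rewrite /shift_d_fun dx oppr0 linearN opprK.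
Qed.

Section Cone.
Variables (X Y : cpx R) (f : cmap X Y).
Definition cone_ob i : lmodType R := (X (i + 1)%R * Y i)%type.
Definition cone_d_fun i (u : cone_ob i) : cone_ob (i + 1) :=
  (- cdiff X (i + 1) u.1, f (i + 1) u.1 + cdiff Y i u.2).
Fact cone_d_linear i : linear (@cone_d_fun i).
Proof.
move=> a [u u'] [v v']; rewrite /cone_d_fun /= !linearP; congr pair => /=.
by rewrite scalerDr addrACA.
Qed.
HB.instance Definition _ i := GRing.isLinear.Build R
  (cone_ob i) (cone_ob (i + 1)) _ (@cone_d_fun i) (@cone_d_linear i).
Definition cone_d i : {linear cone_ob i -> cone_ob (i + 1)} := @cone_d_fun i.
Fact cone_dK i x : cone_d (i + 1) (cone_d i x) = 0.
Proof.
rewrite /= /cone_d_fun /= linearN cdiffK !oppr0 linearN linearD cdiffK addr0.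
by rewrite cfunP addNr.
Qed.
Definition cone : cpx R := @Cpx R cone_ob cone_d cone_dK.

Definition cone_in_fun i (y : Y i) : cone_ob i := (0, y).
Fact cone_in_linear i : linear (@cone_in_fun i).
Proof.
move=> a u v; rewrite /cone_in_fun; congr pair.
by rewrite /= scaler0 addr0.
Qed.
HB.instance Definition _ i := GRing.isLinear.Build R
  (Y i) (cone_ob i) _ (@cone_in_fun i) (@cone_in_linear i).
Fact cone_in_proof i (y : Y i) :
  cone_in_fun (cdiff Y i y) = cdiff cone i (cone_in_fun y).
Proof. by rewrite /= /cone_d_fun /= !linear0 add0r. Qed.
Definition cone_in : cmap Y cone :=
  @Cmap R Y cone (fun i => @cone_in_fun i) cone_in_proof.

Fact cone_out_proof i (u : cone i) :
  fst (cdiff cone i u) = cdiff (shift X) i u.1.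
Proof. by []. Qed.
Definition cone_out : cmap cone (shift X) :=
  @Cmap R cone (shift X) (fun i => fst) cone_out_proof.
End Cone.

Section DirectSum.
Variables X Y : cpx R.
Definition csum_ob i : lmodType R := (X i * Y i)%type.
Definition csum_d_fun i (u : csum_ob i) : csum_ob (i + 1) :=
  (cdiff X i u.1, cdiff Y i u.2).
Fact csum_d_linear i : linear (@csum_d_fun i).
Proof. by move=> a u v; rewrite /csum_d_fun /= !linearP. Qed.
HB.instance Definition _ i := GRing.isLinear.Build R
  (csum_ob i) (csum_ob (i + 1)) _
  (@csum_d_fun i) (@csum_d_linear i).
Definition csum_d i : {linear csum_ob i -> csum_ob (i + 1)} := @csum_d_fun i.
Fact csum_dK i x : csum_d (i + 1) (csum_d i x) = 0.
Proof. by rewrite /= /csum_d_fun /= !cdiffK. Qed.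
Definition csum : cpx R := @Cpx R csum_ob csum_d csum_dK.
End DirectSum.

Section CopowerCpx.
Variables (I : choiceType) (X : cpx R).
Definition ccop_d i : {linear copower I (X i) -> copower I (X (i + 1))} :=
  cop_map (cdiff X i).
Fact ccop_dK i x : ccop_d (i + 1) (ccop_d i x) = 0.
Proof. by apply/copowerP => j /=; rewrite cdiffK. Qed.
Definition ccop : cpx R :=
  @Cpx R (fun i => copower I (X i)) ccop_d ccop_dK.
End CopowerCpx.

Definition zero_mod : lmodType R := 'rV[R]_0.

Definition zero_map (M N : lmodType R) : {linear M -> N} :=
  GRing.Linear.clone R M N _ \0 _.

(* The complex P -> Q concentrated in degrees -1 and 0. *)
Section TwoTerm.
Variables (P Q : lmodType R) (s : {linear P -> Q}).
Definition two_term_ob (i : int) : lmodType R :=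
  match i with Posz 0 => Q | Negz 0 => P | _ => zero_mod end.
Definition two_term_d i : {linear two_term_ob i -> two_term_ob (i + 1)} :=
  match i return {linear two_term_ob i -> two_term_ob (i + 1)} with
  | Negz 0 => s
  | j => zero_map (two_term_ob j) (two_term_ob (j + 1))
  end.
Fact two_term_dK i x : two_term_d (i + 1) (two_term_d i x) = 0.
Proof. by case: i x => [[|n]|[|n]] x //=; rewrite linear0. Qed.
Definition two_term : cpx R := @Cpx R two_term_ob two_term_d two_term_dK.
End TwoTerm.

Definition stalk (M : lmodType R) : cpx R := two_term (zero_map zero_mod M).

(* A morphism X -> Y of the derived category is a roof X <- Z -> Y whose
   backward leg is a quasi-isomorphism. *)
Record dhom X Y := Roof {
  apex : cpx R;
  dback : cmap apex X;
  dback_qis : qis dback;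
  dfwd : cmap apex Y
}.

Definition dmap X Y (f : cmap X Y) : dhom X Y := Roof (@qis_id X) f.

Definition dshift X Y (F : dhom X Y) : dhom (shift X) (shift Y) :=
  Roof (qis_shift (@dback_qis X Y F)) (shift_map (dfwd F)).

(* "G F = H in the derived category".  This relation is invariant under the
   equivalence of roofs in each argument, so equality of morphisms X -> Y is
   [dcomp G F H] with G or F the identity, and need not be defined apart. *)
Definition dcomp X Y Z (G : dhom Y Z) (F : dhom X Y) (H : dhom X Z) :=
  exists (V : cpx R) (u : cmap V (apex F)) (v : cmap V (apex G))
         (w : cmap V (apex H)),
    [/\ qis w, homotopic (ccomp (dback F) u) (ccomp (dback H) w),
        homotopic (ccomp (dfwd F) u) (ccomp (dback G) v) &
        homotopic (ccomp (dfwd G) v) (ccomp (dfwd H) w)].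

Definition d_iso X Y (F : dhom X Y) :=
  exists G : dhom Y X, dcomp G F (dmap (cid X)) /\ dcomp F G (dmap (cid Y)).

Definition d_isomorphic X Y := exists F : dhom X Y, d_iso F.

Definition dsquare X Y X' Y' (F : dhom X Y) (b : dhom Y Y') (a : dhom X X')
    (F' : dhom X' Y') :=
  exists H : dhom X Y', dcomp b F H /\ dcomp F' a H.

(* The triangle X -> Y -> Z -> X[1] is isomorphic in the derived category to
   the standard triangle of the cone of some chain map. *)
Definition distinguished X Y Z (phi : dhom X Y) (psi : dhom Y Z)
    (omega : dhom Z (shift X)) :=
  exists (X' Y' : cpx R) (f : cmap X' Y') (a : dhom X X') (b : dhom Y Y')
         (c : dhom Z (cone f)),
    [/\ d_iso a, d_iso b & d_iso c] /\
    [/\ dsquare phi b a (dmap f),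
        dsquare psi c b (dmap (cone_in f)) &
        dsquare omega (dshift a) c (dmap (cone_out f))].

Definition Add X : cpx R -> Prop :=
  fun Y => exists (I : choiceType) (Y' : cpx R),
     d_isomorphic (csum Y Y') (ccop I X).

Definition left_approximation (C : cpx R -> Prop) X Y (phi : dhom X Y) :=
  C Y /\ forall Z (psi : dhom X Z), C Z -> exists g, dcomp g phi psi.

Definition left_minimal X Y (phi : dhom X Y) :=
  forall h : dhom Y Y, dcomp h phi phi -> d_iso h.

End Complexes.

Definition silting_wrt (R : pzRingType) (P Q T : lmodType R)
    (s : {linear P -> Q}) :=
  (exists p : {linear Q -> T}, projective_presentation s p) /\
  Dclass s = Gen T.

Definition silting (R : pzRingType) (T : lmodType R) :=
  exists (P Q : lmodType R) (s : {linear P -> Q}), silting_wrt T s.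

(* T is minimal silting and s1 is the presentation of its associated partial
   silting module Coker s1; R^o is the regular module. *)
Definition minimal_silting_data (R : pzRingType) (T P1 Q1 : lmodType R)
    (s1 : {linear P1 -> Q1}) :=
  exists (P Q : lmodType R) (s : {linear P -> Q}) (s0 : cpx R)
         (phi : dhom (stalk R^o) s0) (psi : dhom s0 (two_term s1))
         (omega : dhom (two_term s1) (shift (stalk R^o))),
    [/\ silting_wrt T s, projective P1 & projective Q1] /\
    [/\ Add (two_term s) s0, Add (two_term s) (two_term s1),
        distinguished phi psi omega,
        left_approximation (Add (two_term s)) phi & left_minimal phi].

(* M (x)_A N, the abelian group generated by the pairs (m, n) subject to the
   usual relations; a sum of generators is represented by a sequence. *)
Section Tensor.
Variables (A : pzRingType) (M : lmodType A^c) (N : lmodType A).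

Inductive tens_rel : seq (M * N) -> seq (M * N) -> Prop :=
| tens_perm s t : perm_eq s t -> tens_rel s t
| tens_sym s t : tens_rel s t -> tens_rel t s
| tens_trans s t u : tens_rel s t -> tens_rel t u -> tens_rel s u
| tens_cat s t u : tens_rel s t -> tens_rel (s ++ u) (t ++ u)
| tens_0l n : tens_rel [:: (0, n)] [::]
| tens_Dl m m' n : tens_rel [:: (m + m', n)] [:: (m, n); (m', n)]
| tens_Dr m n n' : tens_rel [:: (m, n + n')] [:: (m, n); (m, n')]
| tens_mul (a : A) m n : tens_rel [:: ((a : A^c) *: m, n)] [:: (m, a *: n)].

Definition tens_eqv : rel (seq (M * N)) := fun s t => `[< tens_rel s t >].

Fact tens_eqv_refl : reflexive tens_eqv.
Proof. by move=> s; apply/asboolP/tens_perm. Qed.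
Fact tens_eqv_sym : symmetric tens_eqv.
Proof.
by move=> s t; apply/asboolP/asboolP => /tens_sym.
Qed.
Fact tens_eqv_trans : transitive tens_eqv.
Proof.
by move=> t s u /asboolP st /asboolP tu; apply/asboolP/(tens_trans st).
Qed.

Canonical tens_equiv := EquivRel tens_eqv
  tens_eqv_refl tens_eqv_sym tens_eqv_trans.

Definition tensor : Type := {eq_quot tens_equiv}%qT.
HB.instance Definition _ := Choice.on tensor.
HB.instance Definition _ := EqQuotient.on tensor.

Local Open Scope quotient_scope.

Definition tens_class (s : seq (M * N)) : tensor := \pi s.

Lemma tens_classP s t : tens_class s = tens_class t <-> tens_rel s t.
Proof.
split=> [/eqP|h].
  by rewrite /tens_class; move=> /eqP/eqquotP /asboolP.
by apply/eqquotP/asboolP.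
Qed.

Lemma tens_catl s t u : tens_rel s t -> tens_rel (u ++ s) (u ++ t).
Proof.
move=> /(@tens_cat _ _ u) st.
apply: (tens_trans (tens_perm (permEl (perm_catC u s)))).
by apply: (tens_trans st); apply/tens_perm/permEl/perm_catC.
Qed.

Definition tens_opp_seq (s : seq (M * N)) := [seq (- p.1, p.2) | p <- s].

Lemma tens_cat_opp s : tens_rel (tens_opp_seq s ++ s) [::].
Proof.
elim: s => [|[m n] s IHs]; first exact: tens_perm.
have e : perm_eq (tens_opp_seq ((m, n) :: s) ++ (m, n) :: s)
   ([:: (- m, n); (m, n)] ++ (tens_opp_seq s ++ s)).
  by rewrite /= perm_cons -cat_rcons -cats1 -catA perm_catCA.
apply: (tens_trans (tens_perm e)).
apply: (tens_trans (tens_catl _ IHs)); rewrite cats0.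
apply: (tens_trans (tens_sym (tens_Dl _ _ _))); rewrite addNr.
exact: tens_0l.
Qed.

Definition tens_zero : tensor := tens_class [::].
Definition tens_add (x y : tensor) : tensor := tens_class (repr x ++ repr y).
Definition tens_opp (x : tensor) : tensor := tens_class (tens_opp_seq (repr x)).

Lemma repr_class s : tens_rel (repr (tens_class s)) s.
Proof. by apply/tens_classP; rewrite /tens_class reprK. Qed.

Lemma tens_classK (x : tensor) : tens_class (repr x) = x.
Proof. exact: reprK. Qed.

Lemma tens_class_cat s t :
  tens_add (tens_class s) (tens_class t) = tens_class (s ++ t).
Proof.
apply/tens_classP; apply: (tens_trans (tens_cat _ (repr_class s))).
exact: tens_catl (repr_class t).
Qed.

Fact tens_addA : associative tens_add.
Proof.
move=> x y z; rewrite -(tens_classK x) -(tens_classK y) -(tens_classK z).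
by rewrite !tens_class_cat catA.
Qed.
Fact tens_addC : commutative tens_add.
Proof. by move=> x y; apply/tens_classP/tens_perm/permEl/perm_catC. Qed.
Fact tens_add0 : left_id tens_zero tens_add.
Proof.
by move=> x; rewrite -(tens_classK x) /tens_zero tens_class_cat.
Qed.
Fact tens_addN : left_inverse tens_zero tens_opp tens_add.
Proof.
move=> x; rewrite /tens_opp -{2}(tens_classK x) tens_class_cat.
exact/tens_classP/tens_cat_opp.
Qed.

HB.instance Definition _ := GRing.isZmodule.Build tensor
  tens_addA tens_addC tens_add0 tens_addN.

End Tensor.

Section TensorMap.
Variables (A : pzRingType) (M M' : lmodType A^c) (N : lmodType A).
Variable f : {linear M -> M'}.

Definition tens_map_seq (s : seq (M * N)) := [seq (f p.1, p.2) | p <- s].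

(* f (x) id_N *)
Definition tens_map (x : tensor M N) : tensor M' N :=
  tens_class (tens_map_seq (repr x)).

Lemma tens_map_class s :
  tens_map (tens_class s) = tens_class (tens_map_seq s).
Proof.
apply/tens_classP; have := repr_class s; move: (repr _) => t.
elim=> {s t} [s t /(perm_map (fun p => (f p.1, p.2))) st|s t _|s t u _ st _ tu
  |s t u _ st|n|m m' n|m n n'|a m n] /=.
- exact: tens_perm.
- exact: tens_sym.
- exact: tens_trans st tu.
- by rewrite /tens_map_seq !map_cat; apply: tens_cat.
- by rewrite linear0; apply: tens_0l.
- by rewrite linearD; apply: tens_Dl.
- exact: tens_Dr.
- by rewrite linearZ; apply: tens_mul.
Qed.

End TensorMap.
Arguments tens_map {A M M'} N f.

(* Tor_1^A(M, N) = 0: the beginning of a projective resolution of M stays exact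
   in degree 1 after tensoring with N. *)
Definition Tor1_zero (A : pzRingType) (M : lmodType A^c) (N : lmodType A) :=
  forall (P2 P1 P0 : lmodType A^c) (d2 : {linear P2 -> P1})
         (d1 : {linear P1 -> P0}) (d0 : {linear P0 -> M}),
    projective P2 -> projective P1 -> projective P0 ->
    exact d2 d1 -> exact d1 d0 -> onto d0 ->
    exact (tens_map N d2) (tens_map N d1).

Definition restr (A B : pzRingType) (f : {rmorphism A -> B})
  (Y : lmodType B) : Type := Y.

Section Restriction.
Variables (A B : pzRingType) (f : {rmorphism A -> B}) (Y : lmodType B).
HB.instance Definition _ := GRing.Zmodule.on (restr f Y).
Definition restr_scale (a : A) (y : restr f Y) : restr f Y := f a *: (y : Y).
Fact restr_scaleA a b y :
  restr_scale a (restr_scale b y) = restr_scale (a * b) y.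
Proof. by rewrite /restr_scale scalerA rmorphM. Qed.
Fact restr_scale1 : left_id 1 restr_scale.
Proof. by move=> y; rewrite /restr_scale rmorph1 scale1r. Qed.
Fact restr_scaleDr : right_distributive restr_scale +%R.
Proof. by move=> a y z; rewrite /restr_scale scalerDr. Qed.
Fact restr_scaleDl y : {morph restr_scale^~ y : a b / a + b}.
Proof. by move=> a b; rewrite /restr_scale rmorphD scalerDl. Qed.
HB.instance Definition _ := GRing.Zmodule_isLmodule.Build A (restr f Y)
  restr_scaleA restr_scale1 restr_scaleDr restr_scaleDl.
End Restriction.

(* The ring morphism A^c -> B^c with the same underlying function as f. *)
Definition opfun (A B : pzRingType) (f : {rmorphism A -> B}) : A^c -> B^c := f.

Section Opmap.
Variables (A B : pzRingType) (f : {rmorphism A -> B}).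
Fact opfun_zmod : zmod_morphism (opfun f).
Proof. exact: (rmorphB f). Qed.
Fact opfun_monoid : monoid_morphism (opfun f).
Proof. by split=> [|x y]; [exact: (rmorph1 f) | exact: (rmorphM f)]. Qed.
HB.instance Definition _ :=
  GRing.isZmodMorphism.Build A^c B^c (opfun f) opfun_zmod.
HB.instance Definition _ :=
  GRing.isMonoidMorphism.Build A^c B^c (opfun f) opfun_monoid.
Definition opmap : {rmorphism A^c -> B^c} := opfun f.
End Opmap.

(* A ring morphism from A to some unital ring, possibly zero. *)
Record ring_from (A : pzRingType) := RingFrom {
  rf_cod : pzRingType;
  rf_map :> {rmorphism A -> rf_cod}
}.

Section RingFrom.
Variable A : pzRingType.
Implicit Types f g : ring_from A.

Definition rightreg f : lmodType A^c :=
  restr (opmap (rf_map f)) (rf_cod f)^c^o.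

Definition leftreg f : lmodType A := restr (rf_map f) (rf_cod f)^o.

Definition ring_epi f :=
  forall (C : pzRingType) (g h : {rmorphism rf_cod f -> C}),
    (forall a, g (f a) = h (f a)) -> g =1 h.

Definition tor_ring_epi : ring_from A -> Prop :=
  fun f => ring_epi f /\ Tor1_zero (rightreg f) (leftreg f).

Definition same_epiclass f g :=
  exists h : {rmorphism rf_cod f -> rf_cod g},
    bijective h /\ forall a, g a = h (f a).

(* Essential image of the restriction functor. *)
Definition Xring f : subcat A^c :=
  fun X => exists Y : lmodType (rf_cod f)^c,
     lmod_iso X (restr (opmap (rf_map f)) Y).

Record morphism := Morphism {
  msrc : lmodType A^c;
  mtgt : lmodType A^c;
  mfun :> {linear msrc -> mtgt}
}.

(* s (x)_A B is an isomorphism for all s in Sigma. *)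
Definition inverts f (Sigma : morphism -> Prop) :=
  forall s, Sigma s -> bijective (tens_map (leftreg f) s).

Definition fg_projective_morphisms (Sigma : morphism -> Prop) :=
  forall s, Sigma s ->
    [/\ fin_gen (msrc s), projective (msrc s),
        fin_gen (mtgt s) & projective (mtgt s)].

Definition universal_localisation f :=
  exists Sigma : morphism -> Prop,
    [/\ fg_projective_morphisms Sigma, inverts f Sigma &
      forall g, inverts g Sigma ->
        exists h : {rmorphism rf_cod f -> rf_cod g},
          (forall a, h (f a) = g a) /\
          forall h' : {rmorphism rf_cod f -> rf_cod g},
            (forall a, h' (f a) = g a) -> h' =1 h].

(* f is (up to equivalence) the silting ring epimorphism associated with T. *)
Definition silting_ring_epi (T : lmodType A^c) f :=
  ring_epi f /\
  exists (P1 Q1 : lmodType A^c) (s1 : {linear P1 -> Q1}),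
    minimal_silting_data T s1 /\ Xring f = Xclass s1.

End RingFrom.

(* Hom_A(M, A) for a right module M, as a left A-module. *)
Section Star.
Variables (A : pzRingType) (M : lmodType A^c).

Record star := Star {
  star_fun :> M -> A;
  star_linear : forall (a : A) x y,
    star_fun ((a : A^c) *: x + y) = star_fun x * a + star_fun y
}.

HB.instance Definition _ := gen_eqMixin star.
HB.instance Definition _ := gen_choiceMixin star.

Lemma starP (u v : star) : star_fun u =1 star_fun v -> u = v.
Proof.
case: u v => [u hu] [v hv] /= /funext uv; move: hu hv; rewrite uv => hu hv.
by rewrite (Prop_irrelevance hu hv).
Qed.

Fact star_zero_proof (a : A) (x y : M) : 0 = 0 * a + 0 :> A.
Proof. by rewrite mul0r addr0. Qed.
Fact star_add_proof (u v : star) (a : A) x y :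
  u ((a : A^c) *: x + y) + v ((a : A^c) *: x + y)
    = (u x + v x) * a + (u y + v y).
Proof. by rewrite !star_linear mulrDl addrACA. Qed.
Fact star_opp_proof (u : star) (a : A) x y :
  - u ((a : A^c) *: x + y) = - u x * a + - u y.
Proof. by rewrite !star_linear opprD mulNr. Qed.
Fact star_scale_proof (b : A) (u : star) (a : A) x y :
  b * u ((a : A^c) *: x + y) = b * u x * a + b * u y.
Proof. by rewrite !star_linear mulrDr mulrA. Qed.

Definition star_zero := @Star (fun=> 0) star_zero_proof.
Definition star_add u v := Star (star_add_proof u v).
Definition star_opp u := Star (star_opp_proof u).
Definition star_scale b u := Star (star_scale_proof b u).

Fact star_addA : associative star_add.
Proof. by move=> u v w; apply/starP => x /=; rewrite addrA. Qed.
Fact star_addC : commutative star_add.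
Proof. by move=> u v; apply/starP => x /=; rewrite addrC. Qed.
Fact star_add0 : left_id star_zero star_add.
Proof. by move=> u; apply/starP => x /=; rewrite add0r. Qed.
Fact star_addN : left_inverse star_zero star_opp star_add.
Proof. by move=> u; apply/starP => x /=; rewrite addNr. Qed.

HB.instance Definition _ := GRing.isZmodule.Build star
  star_addA star_addC star_add0 star_addN.

Fact star_scaleA a b u : star_scale a (star_scale b u) = star_scale (a * b) u.
Proof. by apply/starP => x /=; rewrite mulrA. Qed.
Fact star_scale1 : left_id 1 star_scale.
Proof. by move=> u; apply/starP => x /=; rewrite mul1r. Qed.
Fact star_scaleDr : right_distributive star_scale +%R.
Proof. by move=> a u v; apply/starP => x /=; rewrite mulrDr. Qed.
Fact star_scaleDl u : {morph star_scale^~ u : a b / a + b}.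
Proof. by move=> a b; apply/starP => x /=; rewrite mulrDl. Qed.

HB.instance Definition _ := GRing.Zmodule_isLmodule.Build A star
  star_scaleA star_scale1 star_scaleDr star_scaleDl.

End Star.

(* D X = Hom_K(X, K) for a left module X, as a right A-module. *)
Section Dual.
Variables (K : fieldType) (A : algType K) (X : lmodType A).

Record dual := Dual {
  dual_fun :> X -> K;
  dual_linear : forall (c : K) x y,
    dual_fun (c%:A *: x + y) = c * dual_fun x + dual_fun y
}.

HB.instance Definition _ := gen_eqMixin dual.
HB.instance Definition _ := gen_choiceMixin dual.

Lemma dualP (u v : dual) : dual_fun u =1 dual_fun v -> u = v.
Proof.
case: u v => [u hu] [v hv] /= /funext uv; move: hu hv; rewrite uv => hu hv.
by rewrite (Prop_irrelevance hu hv).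
Qed.

Fact dual_zero_proof (c : K) (x y : X) : 0 = c * 0 + 0.
Proof. by rewrite mulr0 addr0. Qed.
Fact dual_add_proof (u v : dual) (c : K) x y :
  u (c%:A *: x + y) + v (c%:A *: x + y) = c * (u x + v x) + (u y + v y).
Proof. by rewrite !dual_linear mulrDr addrACA. Qed.
Fact dual_opp_proof (u : dual) (c : K) x y :
  - u (c%:A *: x + y) = c * - u x + - u y.
Proof. by rewrite !dual_linear opprD mulrN. Qed.
Fact dual_scale_proof (a : A) (u : dual) (c : K) x y :
  u (a *: (c%:A *: x + y)) = c * u (a *: x) + u (a *: y).
Proof.
by rewrite -dual_linear scalerDr !scalerA -scalerAl -scalerAr mul1r mulr1.
Qed.

Definition dual_zero := @Dual (fun=> 0) dual_zero_proof.
Definition dual_add u v := Dual (dual_add_proof u v).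
Definition dual_opp u := Dual (dual_opp_proof u).
Definition dual_scale (a : A^c) u := Dual (dual_scale_proof a u).

Fact dual_addA : associative dual_add.
Proof. by move=> u v w; apply/dualP => x /=; rewrite addrA. Qed.
Fact dual_addC : commutative dual_add.
Proof. by move=> u v; apply/dualP => x /=; rewrite addrC. Qed.
Fact dual_add0 : left_id dual_zero dual_add.
Proof. by move=> u; apply/dualP => x /=; rewrite add0r. Qed.
Fact dual_addN : left_inverse dual_zero dual_opp dual_add.
Proof. by move=> u; apply/dualP => x /=; rewrite addNr. Qed.

HB.instance Definition _ := GRing.isZmodule.Build dual
  dual_addA dual_addC dual_add0 dual_addN.

Fact dual_scaleA (a b : A^c) u :
  dual_scale a (dual_scale b u) = dual_scale (a * b) u.
Proof. by apply/dualP => x /=; rewrite scalerA. Qed.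
Fact dual_scale1 : left_id 1 dual_scale.
Proof. by move=> u; apply/dualP => x /=; rewrite scale1r. Qed.
Fact dual_scaleDr : right_distributive dual_scale +%R.
Proof. by move=> a u v; apply/dualP. Qed.
Fact dualD (u : dual) x y : u (x + y) = u x + u y.
Proof.
by have := dual_linear u 1 x y; rewrite scale1r [1 *: x]scale1r mul1r.
Qed.
Fact dual_scaleDl u : {morph dual_scale^~ u : a b / a + b}.
Proof. by move=> a b; apply/dualP => x /=; rewrite scalerDl dualD. Qed.

HB.instance Definition _ := GRing.Zmodule_isLmodule.Build A^c dual
  dual_scaleA dual_scale1 dual_scaleDr dual_scaleDl.

End Dual.

Section FinDimAlgebra.
Variables (K : fieldType) (A : algType K).
Implicit Types M N T : lmodType A^c.

(* K acts on a right A-module through K -> A. *)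
Definition fin_dim M :=
  exists (n : nat) (v : 'I_n -> M),
    forall x, exists c : 'I_n -> K, x = \sum_i ((c i)%:A : A^c) *: v i.

(* Tr M is the cokernel of Hom(P0, A) -> Hom(P1, A) for a minimal projective
   presentation P1 -> P0 -> M -> 0; it is given by its projection q. *)
Definition is_transpose M (X : lmodType A) :=
  exists (P1 P0 : lmodType A^c) (d : {linear P1 -> P0}) (p : {linear P0 -> M})
         (q : {linear star P1 -> X}),
    [/\ minimal_projective_presentation d p, onto q &
      forall u : star P1,
        q u = 0 <-> exists v : star P0, forall x, u x = v (d x)].

(* tau M = D Tr M *)
Definition is_AR_translate M N :=
  exists2 X, is_transpose M X & lmod_iso N (dual X).

Definition tau_rigid M :=
  fin_dim M /\
  exists2 N, is_AR_translate M N & forall f : {linear M -> N}, f =1 \0.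

Definition tau_tilting_finite :=
  exists (n : nat) (F : 'I_n -> lmodType A^c),
    forall M, tau_rigid M -> indecomposable M -> exists i, lmod_iso M (F i).

Definition fd_silting : subcat A^c :=
  fun T => fin_dim T /\ silting T.

Definition silting_equiv T T' := Gen T = Gen T'.

End FinDimAlgebra.

(* Collections of classes are given by representatives: S inside the type U up
   to eqU, and S' inside V up to eqV.  The relation F between representatives
   induces a well-defined map from classes to classes, and it is a bijection. *)
Definition class_bijection (U V : Type) (S : U -> Prop) (eqU : U -> U -> Prop)
    (S' : V -> Prop) (eqV : V -> V -> Prop) (F : U -> V -> Prop) :=
  [/\ forall x y, S x -> F x y -> S' y,
      forall x, S x -> exists y, F x y,
      forall x x' y y', S x -> S x' -> F x y -> F x' y' -> eqU x x' -> eqV y y',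
      forall x x' y y', S x -> S x' -> F x y -> F x' y' -> eqV y y' -> eqU x x' &
      forall y, S' y -> exists x y', [/\ S x, F x y' & eqV y' y]].

(* Main.v *)
(* Let T be a finite dimensional silting module and x0 : A -> T0 a left minimal
   Gen T-approximation with cokernel T1, presented by s1.  Minimality gives
   a(Gen T) = Gen T /\ T1^o = X_{s1}, and T0 modulo the trace of T1 is a finite
   dimensional reflection of A in this subcategory.  Conversely, in any minimal
   silting data the complex s0 is, in the derived category, the two-term complex
   P1 -> A + Q1, so that H^0 (s0) and Coker s1 play the parts of T0 and T1 and
   X_{s1} is again a(Gen T).

   If W is bireflective and extension-closed, the reflection of A generates W
   and W = a(t(W)) for t(W) the smallest torsion class containing W.  In the
   other direction Gen T = t(a(Gen T)): dividing each indecomposable summand of T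
   by the images of the non-invertible maps from summands of T yields modules in
   a(Gen T), and by nilpotence of the radical these generate Gen T.

   Every torsion class C is some Gen T.  If C is strictly contained in Gen T,
   one of the modules above, say for the summand X, is not in C, and then C is
   contained in the class generated by the indecomposable summands other than X
   (this uses End X = K + rad); completing these to a silting module U with
   Gen U in place of Gen T loses X, and as the summands are tau-rigid there are
   only finitely many steps.

   A subcategory with a reflection L of A, closed under cokernels and copowers,
   is X_B for B = L with the product induced by L = End L; Tor_1^A(B, B) = 0 says
   that it is extension-closed, and X_B = X_{s1} that B is A localised at s1. *)

Require Import Defs.
From HB Require Import structures.
From mathcomp Require Import all_boot all_order all_algebra all_field.
From mathcomp Require Import boolp.
From mathcomp Require classical_sets.

Set Implicit Arguments.
Unset Strict Implicit.
Unset Printing Implicit Defensive.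

Import GRing.Theory.

Local Open Scope ring_scope.

(** * Linear maps, copowers and torsion classes *)

(** Modules of arbitrary size occur throughout, while tau-tilting finiteness only counts finite
    dimensional ones. Two devices bridge the gap. The class t(W) is an intersection of torsion
    classes, with no filtration of its members at hand; it is controlled by Hom alone: a map from a
    member of t(W) to X is zero as soon as all maps from W to X are. And an arbitrary torsion class
    C of Mod-A is compared with Gen T directly, starting from a silting module that generates
    everything. There End X = K + rad serves to map a module of C onto the top B of X: the
    construction needs a functional on Hom(X, W) that sees endomorphisms of X only through their
    scalar part. The condition Ext^1(T, N) = 0 is expressed as N in D_s, which lets maps from T lift
    along epimorphisms with kernel N. In the derived category morphisms are roofs and composition is
    a relation; everything is read off from homotopy classes of chain maps out of two-term complexes
    of projectives. *)

Section MakeLinear.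
Variables (R : pzRingType) (X Y : lmodType R) (f : X -> Y) (hf : linear f).
Definition mkl_fun of linear f := f.
HB.instance Definition _ :=
  GRing.isLinear.Build R X Y _ (mkl_fun hf) hf.
(* Sealed, so that [/=] does not unfold the maps built with it. *)
Lemma mkl_sig : {g : {linear X -> Y} | g =1 f}.
Proof. by exists (mkl_fun hf). Qed.
Definition mkl : {linear X -> Y} := sval mkl_sig.
Lemma mklE x : mkl x = f x. Proof. exact: (svalP mkl_sig). Qed.
End MakeLinear.

Definition submod (R : pzRingType) (M : lmodType R) (S : M -> Prop) :=
  S 0 /\ forall a x y, S x -> S y -> S (a *: x + y).

Section SubmodTheory.
Variables (R : pzRingType) (M : lmodType R) (S : M -> Prop) (hS : submod S).

Lemma sm0 : S 0. Proof. by case: hS. Qed.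
Lemma smD x y : S x -> S y -> S (x + y).
Proof. by move=> sx sy; rewrite -(scale1r x); apply: hS.2. Qed.
Lemma smZ a x : S x -> S (a *: x).
Proof. by move=> sx; rewrite -[_ *: _]addr0; apply: hS.2 => //; apply: sm0. Qed.
Lemma smN x : S x -> S (- x).
Proof. by rewrite -scaleN1r; apply: smZ. Qed.
Lemma smB x y : S x -> S y -> S (x - y).
Proof. by move=> sx sy; apply: smD => //; apply: smN. Qed.
Lemma sm_sum I (r : seq I) (F : I -> M) :
  (forall i, S (F i)) -> S (\sum_(i <- r) F i).
Proof.
by move=> h; apply: big_ind => //; [apply: sm0 | apply: smD].
Qed.

Record subm := Subm { sm_val : M; sm_valP : S sm_val }.
HB.instance Definition _ := gen_eqMixin subm.
HB.instance Definition _ := gen_choiceMixin subm.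

Lemma sm_val_inj : injective sm_val.
Proof.
case=> x hx [y hy] /= e; move: hx hy; rewrite e => hx hy.
by rewrite (Prop_irrelevance hx hy).
Qed.

Definition sm_zero := Subm sm0.
Definition sm_add u v := Subm (smD (sm_valP u) (sm_valP v)).
Definition sm_opp u := Subm (smN (sm_valP u)).
Definition sm_scale a u := Subm (smZ a (sm_valP u)).
Fact sm_addA : associative sm_add.
Proof. by move=> u v w; apply: sm_val_inj; rewrite /= addrA. Qed.
Fact sm_addC : commutative sm_add.
Proof. by move=> u v; apply: sm_val_inj; rewrite /= addrC. Qed.
Fact sm_add0 : left_id sm_zero sm_add.
Proof. by move=> u; apply: sm_val_inj; rewrite /= add0r. Qed.
Fact sm_addN : left_inverse sm_zero sm_opp sm_add.
Proof. by move=> u; apply: sm_val_inj; rewrite /= addNr. Qed.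
HB.instance Definition _ := GRing.isZmodule.Build subm
  sm_addA sm_addC sm_add0 sm_addN.
Fact sm_scaleA a b u : sm_scale a (sm_scale b u) = sm_scale (a * b) u.
Proof. by apply: sm_val_inj; rewrite /= scalerA. Qed.
Fact sm_scale1 : left_id 1 sm_scale.
Proof. by move=> u; apply: sm_val_inj; rewrite /= scale1r. Qed.
Fact sm_scaleDr : right_distributive sm_scale +%R.
Proof. by move=> a u v; apply: sm_val_inj; rewrite /= scalerDr. Qed.
Fact sm_scaleDl u : {morph sm_scale^~ u : a b / a + b}.
Proof. by move=> a b; apply: sm_val_inj; rewrite /= scalerDl. Qed.
HB.instance Definition _ := GRing.Zmodule_isLmodule.Build R subm
  sm_scaleA sm_scale1 sm_scaleDr sm_scaleDl.
Fact sm_val_linear : linear sm_val. Proof. by []. Qed.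

(** Beyond this section submodules and quotients occur only through [sub_ex] and [quo_ex]: an
    injection with prescribed image, a surjection with prescribed kernel. *)
Lemma sub_ex : exists (N : lmodType R) (k : {linear N -> M}),
  injective k /\ forall x, S x <-> exists n, k n = x.
Proof.
exists subm, (mkl sm_val_linear); split.
  by move=> x y; rewrite !mklE; apply: sm_val_inj.
move=> x; split=> [sx|[n <-]]; first by exists (Subm sx); rewrite mklE.
by rewrite mklE; apply: sm_valP.
Qed.

Definition qm_eqv : rel M := fun x y => `[< S (x - y) >].
Fact qm_refl : reflexive qm_eqv.
Proof. by move=> x; apply/asboolP; rewrite subrr; apply: sm0. Qed.
Fact qm_sym : symmetric qm_eqv.
Proof.
by move=> x y; apply/asboolP/asboolP => /smN; rewrite opprB.
Qed.
Fact qm_trans : transitive qm_eqv.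
Proof.
move=> y x z /asboolP xy /asboolP yz; apply/asboolP.
by rewrite -(subrKA y); apply: smD.
Qed.
Canonical qm_equiv := EquivRel qm_eqv qm_refl qm_sym qm_trans.
Definition quom : Type := {eq_quot qm_equiv}%qT.
HB.instance Definition _ := Choice.on quom.
HB.instance Definition _ := EqQuotient.on quom.
Local Open Scope quotient_scope.
Definition qm_pi (x : M) : quom := \pi x.
Lemma qm_piP x y : qm_pi x = qm_pi y <-> S (x - y).
Proof.
split=> [/eqP|h]; first by move=> /eqP/eqquotP/asboolP.
by apply/eqquotP/asboolP.
Qed.
Lemma qm_reprK x : qm_pi (repr x) = x. Proof. exact: reprK. Qed.
Lemma qm_repr x : S (repr (qm_pi x) - x).
Proof. by apply/qm_piP; rewrite qm_reprK. Qed.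
Definition qm_add (u v : quom) := qm_pi (repr u + repr v).
Definition qm_opp (u : quom) := qm_pi (- repr u).
Definition qm_scale a (u : quom) := qm_pi (a *: repr u).
Lemma qm_addE x y : qm_add (qm_pi x) (qm_pi y) = qm_pi (x + y).
Proof. by apply/qm_piP; rewrite opprD addrACA; apply: smD; apply: qm_repr. Qed.
Lemma qm_scaleE a x : qm_scale a (qm_pi x) = qm_pi (a *: x).
Proof. by apply/qm_piP; rewrite -scalerBr; apply: smZ; apply: qm_repr. Qed.
Fact qm_addA : associative qm_add.
Proof.
move=> u v w; rewrite -(qm_reprK u) -(qm_reprK v) -(qm_reprK w) !qm_addE.
by rewrite addrA.
Qed.
Fact qm_addC : commutative qm_add.
Proof. by move=> u v; rewrite /qm_add addrC. Qed.
Fact qm_add0 : left_id (qm_pi 0) qm_add.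
Proof. by move=> u; rewrite -(qm_reprK u) qm_addE add0r. Qed.
Fact qm_addN : left_inverse (qm_pi 0) qm_opp qm_add.
Proof. by move=> u; rewrite -{2}(qm_reprK u) qm_addE addNr. Qed.
HB.instance Definition _ := GRing.isZmodule.Build quom
  qm_addA qm_addC qm_add0 qm_addN.
Fact qm_scaleA a b u : qm_scale a (qm_scale b u) = qm_scale (a * b) u.
Proof. by rewrite -(qm_reprK u) !qm_scaleE scalerA. Qed.
Fact qm_scale1 : left_id 1 qm_scale.
Proof. by move=> u; rewrite -(qm_reprK u) qm_scaleE scale1r. Qed.
Fact qm_scaleDr : right_distributive qm_scale +%R.
Proof.
move=> a u v; rewrite -(qm_reprK u) -(qm_reprK v) [_ + _]qm_addE !qm_scaleE.
by rewrite [RHS]qm_addE scalerDr.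
Qed.
Fact qm_scaleDl u : {morph qm_scale^~ u : a b / a + b}.
Proof.
move=> a b; rewrite -(qm_reprK u) !qm_scaleE.
by rewrite [RHS]qm_addE scalerDl.
Qed.
HB.instance Definition _ := GRing.Zmodule_isLmodule.Build R quom
  qm_scaleA qm_scale1 qm_scaleDr qm_scaleDl.
Fact qm_pi_linear : linear qm_pi.
Proof. by move=> a x y; rewrite -qm_addE -qm_scaleE. Qed.

Lemma quo_ex : exists (Q : lmodType R) (p : {linear M -> Q}),
  onto p /\ forall x, p x = 0 <-> S x.
Proof.
exists quom, (mkl qm_pi_linear); split.
  by move=> y; exists (repr y); rewrite mklE; apply: qm_reprK.
by move=> x; rewrite mklE -[X in _ = X]/(qm_pi 0) -{2}(subr0 x); apply: qm_piP.
Qed.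
End SubmodTheory.

Section Factor.
Variable R : pzRingType.
Implicit Types M N X Y Z Q : lmodType R.

Lemma inj0 M N (f : {linear M -> N}) :
  (forall x, f x = 0 -> x = 0) -> injective f.
Proof.
by move=> h x y e; apply/eqP; rewrite -subr_eq0; apply/eqP/h; rewrite linearB e subrr.
Qed.

Lemma fact_quo M Q X (p : {linear M -> Q}) (f : {linear M -> X}) :
  onto p -> (forall x, p x = 0 -> f x = 0) ->
  exists f' : {linear Q -> X}, forall x, f' (p x) = f x.
Proof.
move=> op hk; pose g q := sval (cid (op q)).
have pg q : p (g q) = q by rewrite /g; case: cid.
have fe x y : p x = p y -> f x = f y.
  by move=> e; apply/eqP; rewrite -subr_eq0 -linearB; apply/eqP/hk; rewrite linearB e subrr.
have lf : linear (fun q => f (g q)).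
  by move=> a u v; rewrite -linearP; apply: fe; rewrite linearP !pg.
by exists (mkl lf) => x; rewrite mklE; apply: fe; rewrite pg.
Qed.

Lemma fact_sub M N X (k : {linear N -> M}) (f : {linear X -> M}) :
  injective k -> (forall x, exists n, k n = f x) ->
  exists f' : {linear X -> N}, forall x, k (f' x) = f x.
Proof.
move=> ik h; pose g x := sval (cid (h x)).
have kg x : k (g x) = f x by rewrite /g; case: cid.
have lf : linear g by move=> a u v; apply: ik; rewrite linearP !kg linearP.
by exists (mkl lf) => x; rewrite mklE.
Qed.

Lemma lin_inv M N (f : {linear M -> N}) : injective f -> onto f ->
  exists g : {linear N -> M}, (forall x, g (f x) = x) /\ forall y, f (g y) = y.
Proof.
move=> fi fo; have [g hg] := @fact_sub N M N f idfun fi fo.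
by exists g; split=> // x; apply: fi; rewrite hg.
Qed.

Lemma bijP X Y (f : X -> Y) : bijective f <-> injective f /\ onto f.
Proof.
split=> [[g fg gf]|[fi fo]]; first by split; [apply: can_inj fg|move=> y; exists (g y)].
exists (fun y => sval (cid (fo y))) => [x|y]; last by case: cid.
by apply: fi; case: cid.
Qed.

Lemma lmod_iso_of M N (f : {linear M -> N}) : injective f -> onto f -> lmod_iso M N.
Proof. by exists f; apply/bijP. Qed.

Lemma ker_submod M N (f : {linear M -> N}) : submod (fun x => f x = 0).
Proof. by split=> [|a x y fx fy]; rewrite ?linear0 // linearP fx fy scaler0 addr0. Qed.

Lemma im_submod M N (f : {linear M -> N}) : submod (fun y => exists x, f x = y).
Proof.
split; first by exists 0; rewrite linear0.
by move=> a x y [u <-] [v <-]; exists (a *: u + v); rewrite linearP.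
Qed.

Lemma ker_ex M N (f : {linear M -> N}) :
  exists (K : lmodType R) (k : {linear K -> M}), is_kernel k f.
Proof.
have [K [k [ki kp]]] := sub_ex (ker_submod f); exists K, k; split=> //.
Qed.

Lemma im_ex M N (f : {linear M -> N}) :
  exists (I : lmodType R) (e : {linear M -> I}) (k : {linear I -> N}),
    [/\ onto e, injective k & forall x, k (e x) = f x].
Proof.
have [I [k [ki kp]]] := sub_ex (im_submod f).
have [|e ek] := @fact_sub _ _ _ k f ki; first by move=> x; apply/kp; exists x.
exists I, e, k; split=> // y.
have /kp [x fx] : exists n, k n = k y by exists y.
by exists x; apply: ki; rewrite ek.
Qed.

Lemma zero_mod0 (x : zero_mod R) : x = 0.
Proof. exact: thinmx0. Qed.

Lemma pair_lin M N X (f : {linear X -> M}) (g : {linear X -> N}) :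
  linear (fun x => (f x, g x) : (M * N)%type).
Proof. by move=> a x y; rewrite !linearP. Qed.
Definition lpair M N X f g : {linear X -> (M * N)%type} := mkl (@pair_lin M N X f g).
Definition lfst M N : {linear (M * N)%type -> M} := fst.
Definition lsnd M N : {linear (M * N)%type -> N} := snd.
Definition linl M N : {linear M -> (M * N)%type} := lpair idfun (zero_map M N).
Definition linr M N : {linear N -> (M * N)%type} := lpair (zero_map N M) idfun.
Lemma copair_lin M N X (f : {linear M -> X}) (g : {linear N -> X}) :
  linear (fun u : (M * N)%type => f u.1 + g u.2).
Proof. by move=> a [x x'] [y y'] /=; rewrite !linearP scalerDr addrACA. Qed.
Definition lcopair M N X f g : {linear (M * N)%type -> X} := mkl (@copair_lin M N X f g).

Lemma lpairE M N X (f : {linear X -> M}) (g : {linear X -> N}) x :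
  lpair f g x = (f x, g x).
Proof. exact: mklE. Qed.
Lemma lcopairE M N X (f : {linear M -> X}) (g : {linear N -> X}) u :
  lcopair f g u = f u.1 + g u.2.
Proof. exact: mklE. Qed.
Lemma linlE M N x : linl M N x = (x, 0). Proof. exact: lpairE. Qed.
Lemma linrE M N x : linr M N x = (0, x). Proof. exact: lpairE. Qed.
Lemma pair_sum M N (x : M) (y : N) : (x, y) = linl M N x + linr M N y.
Proof. by rewrite linlE linrE; congr pair; rewrite /= ?addr0 ?add0r. Qed.
Definition lprE := (lpairE, lcopairE, linlE, linrE).

Lemma elt_lin M (m : M) : linear (fun r : R^o => (r : R) *: m).
Proof. by move=> a x y; rewrite scalerDl -scalerA. Qed.
Definition elt M (m : M) : {linear R^o -> M} := mkl (elt_lin m).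
Lemma elt1 M (m : M) : elt m 1 = m. Proof. by rewrite mklE scale1r. Qed.
Lemma eltE M (f : {linear R^o -> M}) r : f r = (r : R) *: f 1.
Proof. by rewrite -linearZ; congr (f _); apply/esym/mulr1. Qed.
Lemma reg_ext M (f g : {linear R^o -> M}) : f 1 = g 1 -> f =1 g.
Proof. by move=> e r; rewrite eltE e -eltE. Qed.
End Factor.

Section CopowerElim.
Variables (R : pzRingType) (I : choiceType).
Implicit Types M X : lmodType R.

Fact cop_in_supp M i (x : M) :
  exists s : seq I, forall k, k \notin s -> (if k == i then x else 0) = 0.
Proof. by exists [:: i] => k; rewrite inE => /negbTE ->. Qed.
Definition cop_in_fun M i x : copower I M := Copower (cop_in_supp i x).
Fact cop_in_linear M i : linear (@cop_in_fun M i).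
Proof.
move=> a x y; apply/copowerP => k /=.
by case: eqP => // _; rewrite scaler0 addr0.
Qed.
Definition cop_in M i : {linear M -> copower I M} := mkl (@cop_in_linear M i).
Lemma cop_inE M i k (x : M) : cop_in M i x k = if k == i then x else 0.
Proof. by rewrite mklE. Qed.
Lemma cop_at_lin M i : linear (fun u : copower I M => u i).
Proof. by []. Qed.
Definition cop_at M i : {linear copower I M -> M} := mkl (@cop_at_lin M i).

Lemma cop_atE M i (u : copower I M) : cop_at M i u = u i. Proof. exact: mklE. Qed.

Lemma cop_sumE M J (r : seq J) (F : J -> copower I M) k :
  (\sum_(j <- r) F j) k = \sum_(j <- r) F j k.
Proof.
by rewrite -cop_atE linear_sum; apply: eq_bigr => j _; rewrite cop_atE.
Qed.

Lemma copE M (u : copower I M) :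
  exists s : seq I, u = \sum_(i <- s) cop_in M i (u i).
Proof.
have [s hs] := cop_supp u; exists (undup s); apply/copowerP => k.
rewrite cop_sumE; have [ks|ks] := boolP (k \in undup s).
  rewrite (bigD1_seq k) ?undup_uniq //= cop_inE eqxx big1 ?addr0 // => i.
  by rewrite cop_inE eq_sym => /negbTE ->.
rewrite hs; last by rewrite -mem_undup.
rewrite big_seq big1 // => i si.
by rewrite cop_inE; case: eqP => // e; rewrite e si in ks.
Qed.

Lemma cop_ext M X (f g : {linear copower I M -> X}) :
  (forall i x, f (cop_in M i x) = g (cop_in M i x)) -> f =1 g.
Proof.
by move=> h u; have [s ->] := copE u; rewrite !linear_sum; apply: eq_bigr => i _.
Qed.

Variables (M X : lmodType R) (h : I -> {linear M -> X}).
(** The support list is chosen, and [undup] keeps an index from being counted twice; by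
    [cop_elim_funE] any duplicate-free list covering the support gives the same sum. *)
Definition cop_elim_fun (u : copower I M) : X :=
  \sum_(i <- undup (sval (cid (cop_supp u)))) h i (u i).

Lemma cop_elim_funE (u : copower I M) (s : seq I) : uniq s -> (forall i, i \notin s -> u i = 0) ->
  cop_elim_fun u = \sum_(i <- s) h i (u i).
Proof.
rewrite /cop_elim_fun; case: cid => t /= ht us hs.
have red r : \sum_(i <- r) h i (u i) = \sum_(i <- [seq i <- r | u i != 0]) h i (u i).
  rewrite big_filter (bigID (fun i => u i != 0)) /= [X in _ + X]big1 ?addr0 //.
  by move=> i /negPn /eqP ->; rewrite linear0.
rewrite red [RHS]red; apply: perm_big; apply: uniq_perm.
- by rewrite filter_uniq ?undup_uniq.
- by rewrite filter_uniq.
move=> i; rewrite !mem_filter mem_undup; have [//|/= u0] := eqVneq (u i) 0.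
have [it|/ht e] := boolP (i \in t); last by rewrite e eqxx in u0.
have [//|/hs e] := boolP (i \in s); by rewrite e eqxx in u0.
Qed.

Fact cop_elim_linear : linear cop_elim_fun.
Proof.
move=> a u v; have [s hs] := cop_supp u; have [t ht] := cop_supp v.
pose r := undup (s ++ t).
have ru i : i \notin r -> u i = 0.
  by rewrite mem_undup mem_cat negb_or => /andP[/hs].
have rv i : i \notin r -> v i = 0.
  by rewrite mem_undup mem_cat negb_or => /andP[_ /ht].
rewrite !(@cop_elim_funE _ r) ?undup_uniq //.
  rewrite scaler_sumr -big_split /=; apply: eq_bigr => i _.
  by rewrite linearP.
by move=> i ir /=; rewrite ru // rv // scaler0 addr0.
Qed.
Definition cop_elim : {linear copower I M -> X} := mkl cop_elim_linear.

Lemma cop_elimE i x : cop_elim (cop_in M i x) = h i x.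
Proof.
rewrite mklE (@cop_elim_funE _ [:: i]) //.
  by rewrite big_seq1 cop_inE eqxx.
by move=> k; rewrite inE cop_inE => /negbTE ->.
Qed.
End CopowerElim.
Arguments cop_in {R I} M i.
Arguments cop_at {R I} M i.

Lemma cop_map_in (R : pzRingType) (I : choiceType) (M N : lmodType R)
  (f : {linear M -> N}) (i : I) x : cop_map f (cop_in M i x) = cop_in N i (f x).
Proof.
by apply/copowerP => k /=; rewrite !cop_inE; case: eqP => // _; rewrite linear0.
Qed.

Section Trace.
Variable R : pzRingType.
Implicit Types (M N X Y Z V Q E I K L P T U W : lmodType R) (C D : subcat R).

(** The trace of C in X. As C is a class of modules, an inductive predicate avoids indexing a direct
    sum by it, and gives induction over finite sums of values. *)
Inductive tr C X : X -> Prop :=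
| tr_0 : tr C 0
| tr_D M (h : {linear M -> X}) m x : C M -> tr C x -> tr C (h m + x).

Lemma tr_in C X M (h : {linear M -> X}) m : C M -> tr C (h m).
Proof. by move=> CM; rewrite -[h m]addr0; apply: tr_D => //; apply: tr_0. Qed.

Lemma tr_submod C X : submod (@tr C X).
Proof.
split; first exact: tr_0.
have trA x y : tr C x -> tr C y -> tr C (x + y).
  by elim=> [|M h m z CM _ IH] ty; rewrite ?add0r // -addrA; apply: tr_D => //; apply: IH.
move=> a x y tx ty; apply: trA => //.
elim: tx => [|M h m z CM _ IH]; first by rewrite scaler0; apply: tr_0.
by rewrite scalerDr -linearZ; apply: tr_D.
Qed.

Lemma tr_map C X Y (f : {linear X -> Y}) (x : X) : tr C x -> tr C (f x).
Proof.
elim=> [|M h m z CM _ IH]; first by rewrite linear0; apply: tr_0.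
by rewrite linearD; apply: (@tr_D C _ M (f \o h)).
Qed.

Definition gen C : subcat R := fun X => forall x : X, tr C x.

Lemma tr_trans C D X (x : X) : (forall M, C M -> gen D M) -> tr C x -> @tr D X x.
Proof.
move=> CD; elim=> [|M h m z /CD gM _ IH]; first exact: tr_0.
by apply: (smD (tr_submod _ _)) => //; apply: tr_map.
Qed.

Lemma gen_self C M : C M -> gen C M.
Proof. by move=> CM x; apply: (@tr_in _ _ M idfun). Qed.

Lemma gen_gen C D X : (forall M, C M -> gen D M) -> gen C X -> gen D X.
Proof. by move=> CD g x; apply: tr_trans (g x). Qed.

Lemma gen_onto C X Y (f : {linear X -> Y}) : onto f -> gen C X -> gen C Y.
Proof. by move=> fo g y; have [x <-] := fo y; apply: tr_map. Qed.

Lemma tr_sub C X N (k : {linear N -> X}) (n : N) : injective k ->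
  (forall x : X, tr C x <-> exists n, k n = x) -> tr C n.
Proof.
move=> ki kp; suff H (y : X) : tr C y -> forall n, k n = y -> tr C n.
  by apply: (H (k n)) => //; apply/kp; exists n.
elim=> [|M h m z CM tz IH] {}n e.
  by have ->: n = 0 by [apply: ki; rewrite e linear0]; apply: tr_0.
have /kp [n2 e2] := tz; have [|h' hh] := @fact_sub _ _ _ _ k h ki.
  by move=> x; apply/kp; apply: tr_in.
have -> : n = h' m + n2 by apply: ki; rewrite e linearD hh e2.
by apply: tr_D => //; apply: IH.
Qed.

Lemma tr_ex C X : exists (N : lmodType R) (k : {linear N -> X}),
  [/\ injective k, gen C N & forall x : X, tr C x <-> exists n, k n = x].
Proof.
have [N [k [ki kp]]] := sub_ex (tr_submod C X); exists N, k; split=> // n.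
exact: tr_sub ki kp.
Qed.

Lemma gen_copower C (I : choiceType) M : C M -> gen C (copower I M).
Proof.
move=> CM u; have [s ->] := copE u.
by apply: (sm_sum (tr_submod _ _)) => i; apply: tr_in.
Qed.

(** The copower is indexed by all maps M -> X, so that the universal map has the whole trace as its
    image. *)
Lemma GenP M X : Gen M X <-> gen (eq M) X.
Proof.
split=> [[I [f fo]]|g]; first by apply: gen_onto fo _; apply: gen_copower.
pose I : choiceType := {classic {linear M -> X}}.
exists I, (cop_elim (fun h : I => (h : {linear M -> X}))) => x.
elim: {x}(g x) => [|N h m z e _ [u <-]]; first by exists 0; rewrite linear0.
case: _ / e h m => h m; exists (cop_in M (h : I) m + u).
by rewrite linearD cop_elimE.
Qed.

Definition tors C := (forall X, gen C X -> C X) /\ extension_closed C.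

Definition tgen D : subcat R := fun X =>
  forall C, tors C -> (forall Y, D Y -> C Y) -> C X.

Lemma tgen_tors D : tors (tgen D).
Proof.
split=> [X g C tC DC|X Y Z f g e tX tZ C tC DC].
  by apply: tC.1; apply: gen_gen g => M /(_ C tC DC); apply: gen_self.
by apply: (tC.2 _ _ _ _ _ e); [apply: tX | apply: tZ].
Qed.

Lemma tgen_self D X : D X -> tgen D X.
Proof. by move=> DX C _; apply. Qed.

Lemma tors_onto C X Y (f : {linear X -> Y}) : tors C -> onto f -> C X -> C Y.
Proof. by move=> tC fo CX; apply: tC.1; apply: gen_onto fo _; apply: gen_self. Qed.

(** Feeding this class to the universal property of [tgen] gives [tgen_perp], the main way to
    exploit membership in [tgen D]. *)
Lemma perp_tors X : tors (fun Y => forall f : {linear Y -> X}, f =1 \0).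
Proof.
split=> [Y g f y|Y1 Y2 Y3 f g [fi fg go] h1 h3 h y2].
  elim: {y}(g y) => [|M h m z h0 _ IH]; first by rewrite linear0.
  by rewrite linearD IH /= addr0; apply: (h0 (f \o h)).
have [|h' hh] := @fact_quo _ _ _ _ g h go.
  by move=> x /fg [y <-]; apply: (h1 (h \o f)).
by rewrite -hh; apply: h3.
Qed.

Lemma tgen_perp D X Y (f : {linear Y -> X}) : tgen D Y ->
  (forall Z, D Z -> forall g : {linear Z -> X}, g =1 \0) -> f =1 \0.
Proof. by move=> tY h; apply: (tY _ (perp_tors X)). Qed.

(** E is the preimage of V <= Z under g, an extension of V by Ker g. Through it extension-closure
    acts on submodules of a quotient. *)
Lemma preim_ex Y Z V (g : {linear Y -> Z}) (v : {linear V -> Z}) N (k : {linear N -> Y}) :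
  onto g -> injective v -> is_kernel k g ->
  exists (E : lmodType R) (e : {linear E -> Y}) (k' : {linear N -> E}) (g' : {linear E -> V}),
    [/\ short_exact k' g', injective e, forall x, v (g' x) = g (e x),
        forall n, e (k' n) = k n & forall y w, g y = v w -> exists x, e x = y].
Proof.
move=> go vi [ki kg].
have hS : submod (fun y => exists w, v w = g y).
  split; first by exists 0; rewrite !linear0.
  by move=> a x y [u eu] [w ew]; exists (a *: u + w); rewrite !linearP eu ew.
have [E [e [ei ep]]] := sub_ex hS; exists E, e.
have [|k' hk'] := @fact_sub _ _ _ _ e k ei.
  by move=> n; apply/ep; exists 0; rewrite linear0; apply/esym/kg; exists n.
have [|g' hg'] := @fact_sub _ _ _ _ v (g \o e) vi.
  by move=> x; apply/(ep (e x)); exists x.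
exists k', g'; split=> //; last first.
  by move=> y w gy; apply/ep; exists w.
split.
- by move=> x y exy; apply: ki; rewrite -!hk' exy.
- move=> x; split=> [gx|[n <-]].
    have /kg [n en] : g (e x) = 0 by rewrite -[g _]hg' gx linear0.
    by exists n; apply: ei; rewrite hk'.
  by apply: vi; rewrite hg' /= hk' linear0; apply/kg; exists n.
- move=> w; have [y gy] := go (v w).
  have /ep [x ex] : exists w, v w = g y by exists w.
  by exists x; apply: vi; rewrite hg' /= ex.
Qed.

(** N is the trace of C. The preimage in X of the image of some Y in C in X/N is an extension of
    members of C, so it lies in C and hence inside N. *)
Lemma tors_rad C X : tors C ->
  exists (N : lmodType R) (k : {linear N -> X}) (Q : lmodType R) (p : {linear X -> Q}),
    [/\ short_exact k p, C N & forall Y, C Y -> forall f : {linear Y -> Q}, f =1 \0].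
Proof.
move=> tC; have [N [k [ki gN kp]]] := tr_ex C X.
have [Q [p [po pp]]] := quo_ex (tr_submod C X).
have kk : is_kernel k p by split=> // x; rewrite pp kp.
exists N, k, Q, p; split; [by split=> // x; apply: kk.2|exact: tC.1|].
move=> Y CY f y; have [I [e [j [eo ji je]]]] := im_ex f.
have CI : C I by apply: tors_onto eo CY.
have [E [e' [k' [g' [se ei hg hk he]]]]] := preim_ex po ji kk.
have CE : C E by apply: tC.2 se _ CI; apply: tC.1.
have [x px] := po (f y); rewrite -px; apply/pp.
have [z <-] : exists z, e' z = x by apply: (he x (e y)); rewrite je.
exact: tr_in.
Qed.
End Trace.

(** * Wide subcategories *)

Section Wide.
Variable R : pzRingType.
Implicit Types (M N X Y Z V Q E I J G K L P T U W F : lmodType R) (C D : subcat R).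

Lemma pull_ex X Y Q (p : {linear X -> Q}) (g : {linear Y -> Q}) :
  exists (E : lmodType R) (a : {linear E -> X}) (b : {linear E -> Y}),
    [/\ forall z, p (a z) = g (b z),
        forall z, a z = 0 -> b z = 0 -> z = 0 &
        forall x y, p x = g y -> exists z, a z = x /\ b z = y].
Proof.
have [E [k [ki kg]]] := ker_ex ((p \o lfst X Y) \- (g \o lsnd X Y)).
exists E, (lfst X Y \o k), (lsnd X Y \o k); split=> /=.
- move=> z; apply/eqP; rewrite -subr_eq0; apply/eqP.
  by apply/(kg (k z)); exists z.
- by move=> z h1 h2; apply: ki; rewrite linear0 [k z]surjective_pairing; congr pair.
- move=> x y e; have /kg [z kz] : ((p \o lfst X Y) \- (g \o lsnd X Y)) (x, y) = 0.
    by rewrite /= e subrr.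
  by exists z; rewrite kz.
Qed.

Lemma pull_exact N X Y Q (k : {linear N -> X}) (p : {linear X -> Q}) (g : {linear Y -> Q}) :
  short_exact k p ->
  exists (E : lmodType R) (k' : {linear N -> E}) (a : {linear E -> X}) (b : {linear E -> Y}),
    [/\ short_exact k' b, forall n, a (k' n) = k n, forall z, p (a z) = g (b z) &
        forall x y, p x = g y -> exists z, a z = x /\ b z = y].
Proof.
case=> ki kp po; have [E [a [b [ab inj ex]]]] := pull_ex p g.
have kerab : injective (lpair a b).
  by apply: inj0 => z; rewrite lprE => -[az bz]; apply: inj.
have [|k' hk'] := @fact_sub _ _ _ _ (lpair a b) (linl X Y \o k) kerab.
  move=> n; have [|z [az bz]] := ex (k n) 0.
    by rewrite linear0; apply/kp; exists n.
  by exists z; rewrite /= !lprE az bz.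
have ak n : a (k' n) = k n by have := hk' n; rewrite /= !lprE => -[].
have bk n : b (k' n) = 0 by have := hk' n; rewrite /= !lprE => -[].
exists E, k', a, b; split=> //; split.
- by apply: inj0 => n e; apply: ki; rewrite -ak e !linear0.
- move=> z; split=> [bz|[n <-] //].
  have /kp [n kn] : p (a z) = 0 by rewrite ab bz linear0.
  exists n; apply: kerab; rewrite hk' /= !lprE kn bz //.
- move=> y; have [x px] := po (g y); have [z [_ <-]] := ex _ _ px.
  by exists z.
Qed.

(** For g : Y -> Q, the pullback E of p and g is an extension of Y by N, hence in C, and Ker g is
    isomorphic to the kernel of E -> X. *)
Lemma afrak_quo C X N Q (k : {linear N -> X}) (p : {linear X -> Q}) :
  tors C -> short_exact k p -> C N -> afrak C X -> afrak C Q.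
Proof.
move=> tC se CN [CX aX]; have [ki kp po] := se; split; first exact: tors_onto po CX.
move=> Y g CY K j [ji jg].
have [E [k' [a [b [[k'i k'b bo] ak ab ex]]]]] := pull_exact g se.
have CE : C E by apply: (tC.2 _ _ _ k' b).
have [||j' hj'] := @fact_sub _ _ _ _ (lpair a b) (linr X Y \o j).
- apply: inj0 => z; rewrite lprE => -[az /k'b [n zn]].
  by rewrite -zn (_ : n = 0) ?linear0 //; apply: ki; rewrite -ak zn az linear0.
- move=> x; have [|z [az bz]] := ex 0 (j x).
    by rewrite linear0; apply/esym/jg; exists x.
  by exists z; rewrite /= !lprE az bz.
have aj x : a (j' x) = 0 by have := hj' x; rewrite /= !lprE => -[].
have bj x : b (j' x) = j x by have := hj' x; rewrite /= !lprE => -[].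
apply: (aX E a CE K j'); split.
  by move=> x y e; apply: ji; rewrite -!bj e.
move=> z; split=> [az|[x <-] //].
have /jg [x jx] : g (b z) = 0 by rewrite -ab az linear0.
exists x; apply/eqP; rewrite -subr_eq0; apply/eqP.
have /k'b [n kn] : b (j' x - z) = 0 by rewrite linearB bj jx subrr.
rewrite -kn (_ : n = 0) ?linear0 //; apply: ki.
by rewrite -ak kn linearB aj az subr0 linear0.
Qed.

(** Given h : V -> Y, the kernel of g h lies in C because Z is in [afrak C]; h restricts to a map
    from it to X, whose kernel is Ker h. *)
Lemma afrak_ext C : tors C -> extension_closed (afrak C).
Proof.
move=> tC X Y Z f g [fi fg go] [CX aX] [CZ aZ].
have CY : C Y by apply: (tC.2 _ _ _ f g).
split=> // V h CV N k [ki kh].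
have [K [j [ji jk]]] := ker_ex (g \o h).
have CK : C K := aZ _ (g \o h) CV K j (conj ji jk).
have [|h' hh'] := @fact_sub _ _ _ _ f (h \o j) fi.
  by move=> x; apply/fg/(jk (j x)); exists x.
have [|k' hk'] := @fact_sub _ _ _ _ j k ji.
  by move=> n; apply/jk => /=; rewrite (_ : h (k n) = 0) ?linear0 //; apply/kh; exists n.
apply: (aX K h' CK N k'); split=> [x y e|x].
  by apply: ki; rewrite -!hk' e.
split=> [hx|[n <-]].
  have /kh [n kn] : h (j x) = 0 by rewrite -[h _]hh' hx linear0.
  by exists n; apply: ji; rewrite hk'.
by apply: fi; rewrite hh' /= hk' linear0; apply/kh; exists n.
Qed.

Lemma afrak_repl C : tors C -> replete (afrak C).
Proof.
move=> tC M N [f /bijP[fi fo]] [CM aM]; have [g [gf fg]] := lin_inv fi fo.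
split=> [|Y h CY K k [ki kh]]; first exact: tors_onto fo CM.
apply: (aM Y (g \o h) CY K k); split=> // y; rewrite -(kh y) /=; split=> [e|->].
  by rewrite -[h y]fg e linear0.
by rewrite linear0.
Qed.

Definition wide D := [/\
  forall X Y N (f : {linear X -> Y}) (k : {linear N -> X}),
    is_kernel k f -> D X -> D Y -> D N,
  forall X Y Q (f : {linear X -> Y}) (p : {linear Y -> Q}),
    onto p -> exact f p -> D X -> D Y -> D Q,
  extension_closed D &
  forall (I : choiceType) X, D X -> D (copower I X)].

Section WideTheory.
Variables (D : subcat R) (wD : wide D).

Lemma wide_image X Y I (e : {linear X -> I}) (j : {linear I -> Y}) :
  onto e -> injective j -> D X -> D Y -> D I.
Proof.
case: wD => wk wc _ _ eo ji DX DY.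
have [Q [p [po pp]]] := quo_ex (im_submod (j \o e)).
have DQ : D Q by apply: (wc X Y Q (j \o e) p).
apply: (wk Y Q I p j) => //; split=> // y; rewrite pp; split=> [[x <-]|[i <-]].
  by exists (e x).
by have [x <-] := eo i; exists x.
Qed.

Lemma wide_repl M N (f : {linear M -> N}) : injective f -> onto f -> D M -> D N.
Proof.
case: wD => wk _ _ _ fi fo DM; have [g [gf fg]] := lin_inv fi fo.
apply: (wk M M N (zero_map M M) g) => //; split=> [x y e|x].
  by rewrite -[x]fg e fg.
by split=> // _; exists (f x).
Qed.

Variables (L : lmodType R) (DL : D L) (Lgen : forall V, D V -> gen (eq L) V).

(** The quotient by the trace J of L has no nonzero submodule in D: the preimage of G is an
    extension of members of D, hence generated by L, hence contained in J. *)
Lemma trace_max X J Q G (k : {linear J -> X}) (p : {linear X -> Q}) (j : {linear G -> Q}) :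
  (forall x : X, tr (eq L) x <-> exists n, k n = x) ->
  short_exact k p -> D J -> injective j -> D G -> forall x, j x = 0.
Proof.
move=> kt [ki kp po] DJ ji DG.
have [E [e [k' [g' [se ei hg hk he]]]]] := preim_ex po ji (conj ki kp).
have DE : D E by case: wD => _ _ we _; apply: we se DJ DG.
move=> x; have [_ _ g'o] := se; have [y <-] := g'o x; rewrite hg; apply/kp/kt.
by apply: tr_map; apply: Lgen.
Qed.

Lemma trace_copower X J (k : {linear J -> X}) :
  injective k -> (forall x : X, tr (eq L) x <-> exists n, k n = x) ->
  exists (S : choiceType) (f : {linear copower S L -> J}), onto f.
Proof.
by move=> ki kt; have /GenP // : gen (eq L) J by move=> n; apply: tr_sub ki kt.
Qed.

(** The trace J of L in I is the image of a map from a copower of L to W, so J and W/J are in D. The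
    image in I/J of a map from D is also the image of a map into W/J, so it is in D and vanishes by
    [trace_max]; hence I -> I/J is zero by [tgen_perp]. *)
Lemma tgen_sub I W (j : {linear I -> W}) :
  injective j -> D W -> tgen D I -> D I.
Proof.
move=> ji DW tI; have [_ wc _ wp] := wD.
have [J [k [ki _ kt]]] := tr_ex (eq L) I.
have [S [f fo]] := trace_copower ki kt.
have DJ : D J.
  apply: (@wide_image _ W J f (j \o k)) => //; last exact: wp.
  by move=> x y /ji /ki.
have [Q [p [po pp]]] := quo_ex (im_submod k).
have [Z [q [qo qq]]] := quo_ex (im_submod (j \o k)).
have DZ : D Z by apply: (wc J W Z (j \o k) q).
have kp : exact k p by move=> x; rewrite pp.
have [|i hi] := @fact_quo _ _ _ _ p (q \o j) po.
  by move=> x /pp [n <-]; apply/(qq (j (k n))); exists n.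
have ii : injective i.
  apply: inj0 => y; have [x <-] := po y; rewrite hi => /= /qq [n] /= e.
  by apply/pp; exists n; apply: ji.
have p0 : p =1 \0.
  apply: (@tgen_perp _ D _ _ p) => // V DV g x.
  have [G [e [v [eo vi ve]]]] := im_ex g.
  have DG : D G.
    apply: (@wide_image V Z G e (i \o v)) => //.
    by move=> a b /ii /vi.
  rewrite -ve; exact: (trace_max kt (And3 ki kp po) DJ vi DG).
apply: (wide_repl ki) => // x; have /kp [n <-] := p0 x; by exists n.
Qed.

(** The torsion-free quotient F = N/T of the kernel has to vanish. In Y' = Y/T, an extension of I by
    F, take the trace J of L. As F receives no nonzero map from D, J meets F in 0 and embeds into I,
    so J is in D; a similar argument shows that Y'/J receives no nonzero map from D. So Y' = J and F
    = 0. *)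
Lemma wide_in_afrak X : D X -> afrak (tgen D) X.
Proof.
have [wk wc _ wp] := wD; have tD := tgen_tors D.
move=> DX; split=> [|Y g tY N k [ki kg]]; first exact: tgen_self.
have [I [e [j [eo ji je]]]] := im_ex g.
have DI : D I by apply: (tgen_sub ji DX); apply: tors_onto eo tY.
have ke : exact k e.
  move=> y; rewrite -(kg y) -je; split=> [->|h]; first by rewrite linear0.
  by apply: ji; rewrite linear0.
have [T [k0 [F [p0 [[k0i k0p p0o] tT perp]]]]] := tors_rad N tD.
suff F0 x : p0 x = 0.
  by apply: tors_onto tT => // x; apply/k0p; apply: F0.
have [Y' [q [qo qq]]] := quo_ex (im_submod (k \o k0)).
have tY' : tgen D Y' by apply: tors_onto qo tY.
have [|phi hphi] := @fact_quo _ _ _ _ p0 (q \o k) p0o.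
  by move=> y /k0p [t <-]; apply/(qq (k (k0 t))); exists t.
have phii : injective phi.
  apply: inj0 => z; have [y <-] := p0o z; rewrite hphi => /= /qq [t /= /ki <-].
  by apply/k0p; exists t.
have [|e' he'] := @fact_quo _ _ _ _ q e qo.
  by move=> y /qq [t <-]; apply/ke; exists (k0 t).
have phie : exact phi e'.
  move=> z; have [y <-] := qo z; rewrite he' (ke y); split=> [[n <-]|[f pf]].
    by exists (p0 n); rewrite hphi.
  have [n pn] := p0o f; rewrite -pn hphi in pf.
  have /qq [t] : q (y - k n) = 0 by rewrite linearB -pf subrr.
  by move=> h; exists (k0 t + n); rewrite linearD [k (k0 t)]h subrK.
have [J [kJ [kJi _ kJt]]] := tr_ex (eq L) Y'.
have [S [f fo]] := trace_copower kJi kJt.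
have DS : D (copower S L) by apply: wp.
(* A map from D to Y' that dies in I factors through the torsion-free F. *)
have kill V (h : {linear V -> Y'}) (DV : D V) : (forall v, e' (h v) = 0) -> h =1 \0.
  move=> h0; have [|h' hh'] := @fact_sub _ _ _ _ phi h phii.
    by move=> v; apply/phie.
  by move=> v; rewrite -hh' (perp V) ?linear0 //; apply: tgen_self.
(* The kernel K of the map from the copower to I is in D, and its image in J falls into F. *)
have ei : injective (e' \o kJ).
  apply: inj0 => u; have [l <-] := fo u; move=> h.
  have [K [kK [kKi kKe]]] := ker_ex (e' \o kJ \o f).
  have DK : D K by apply: (wk _ _ _ _ kK (conj kKi kKe)).
  have /(kKe l) [z zl] := h; apply: kJi; rewrite -zl linear0.
  apply: (kill K (kJ \o f \o kK) DK) => v /=.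
  by apply/(kKe (kK v)); exists v.
have DJ : D J by apply: (@wide_image _ I J f (e' \o kJ)).
have [Q [p [po pp]]] := quo_ex (im_submod kJ).
have [Z [r [ro rr]]] := quo_ex (im_submod (e' \o kJ)).
have DZ : D Z by apply: (wc J I Z (e' \o kJ) r).
have kp : exact kJ p by move=> u; rewrite pp.
have [|i hi] := @fact_quo _ _ _ _ p (r \o e') po.
  by move=> u /pp [n <-]; apply/(rr (e' (kJ n))); exists n.
have pphii : injective (p \o phi).
  apply: inj0 => u /= /pp [n kn].
  have n0 : n = 0 by apply: ei; rewrite linear0 /= kn; apply/phie; exists u.
  by apply: phii; rewrite -kn n0 !linear0.
have p00 : p =1 \0.
  apply: (@tgen_perp _ D _ _ p) => // V DV v x'.
  have [G [a [b [ao bi ba]]]] := im_ex v.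
  (* The kernel K of V -> I/J is in D and maps into F, embedded in Y'/J by [p \o phi], so it maps to
     zero; hence the image G of v embeds into I/J. *)
  have ib : injective (i \o b).
    apply: inj0 => y; have [w <-] := ao y; rewrite /= ba; move=> iv.
    have [K [kK [kKi kKe]]] := ker_ex (i \o v).
    have DK : D K by apply: (wk _ _ _ _ kK (conj kKi kKe)).
    have /(kKe w) [z zw] := iv.
    have [|h' hh'] := @fact_sub _ _ _ _ (p \o phi) (v \o kK) pphii.
      move=> u; have [y' py'] := po (v (kK u)).
      have /rr [n hn] : r (e' y') = 0.
        by rewrite -[r _]hi py'; apply/(kKe (kK u)); exists u.
      have /phie [m hm] : e' (y' - kJ n) = 0 by rewrite linearB [e' (kJ n)]hn subrr.
      exists m; rewrite /= hm linearB py' (_ : p (kJ n) = 0) ?subr0 //.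
      by apply/kp; exists n.
    apply: bi; rewrite ba linear0 -zw -[v _]hh' (perp K) ?linear0 //.
    exact: tgen_self.
  have DG : D G by apply: (@wide_image V Z G a (i \o b)).
  by rewrite -ba; apply: (trace_max kJt (And3 kJi kp po) DJ bi DG).
apply: phii; rewrite linear0; have /kp [n kn] := p00 (phi (p0 x)).
rewrite -kn (_ : n = 0) ?linear0 //; apply: ei; rewrite linear0 /= kn.
by apply/phie; exists (p0 x).
Qed.

(** With I the trace of L in X, the kernel of a surjection from a copower of L onto I is torsion
    because X is in [afrak], hence in D by [tgen_sub]; so I, a cokernel, is in D. By [afrak_quo] the
    same reasoning puts images in X/I of maps from D into D, and these vanish by [trace_max]. *)
Lemma afrak_in_wide X : afrak (tgen D) X -> D X.
Proof.
have [wk wc _ wp] := wD; have tD := tgen_tors D.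
move=> aX; have [tX kX] := aX.
have [I [j [ji _ jt]]] := tr_ex (eq L) X.
have [S [f fo]] := trace_copower ji jt.
have DS : D (copower S L) by apply: wp.
have ker_D V Y (g : {linear V -> Y}) N (k : {linear N -> V}) : D V -> afrak (tgen D) Y ->
    is_kernel k g -> D N.
  move=> DV [_ aY] kk; apply: (tgen_sub kk.1 DV).
  by apply: aY kk; apply: tgen_self.
have [K [k [ki kf]]] := ker_ex f.
have DK : D K.
  apply: (ker_D _ _ (j \o f) _ k DS aX); split=> // y; rewrite -(kf y).
  by split=> [/= e|/= ->]; [apply: ji; rewrite e linear0 | rewrite linear0].
have DI : D I by apply: (wc _ _ _ k f).
have [Q [p [po pp]]] := quo_ex (im_submod j).
have se : short_exact j p by split=> // x; rewrite pp.
have aQ : afrak (tgen D) Q by apply: afrak_quo se _ aX => //; apply: tgen_self.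
have p0 : p =1 \0.
  apply: (@tgen_perp _ D _ _ p) => // V DV g x.
  have [G [a [b [ao bi ba]]]] := im_ex g.
  have [K' [k' [k'i k'g]]] := ker_ex g.
  have DK' : D K' by apply: (ker_D _ _ g _ k').
  have DG : D G.
    apply: (wc _ _ _ k' a) => // y; rewrite -(k'g y) -ba.
    by split=> [->|e]; [rewrite linear0 | apply: bi; rewrite linear0].
  by rewrite -ba; apply: (trace_max jt se DI bi DG).
by apply: (wide_repl ji) => // x; apply/pp; apply: p0.
Qed.

Lemma afrak_tgen : afrak (tgen D) = D.
Proof.
apply/funext => X; apply/propext; split; first exact: afrak_in_wide.
exact: wide_in_afrak.
Qed.
End WideTheory.
End Wide.

(** * Presentations and the classes D *)

Section Presentations.
Variable R : pzRingType.
Implicit Types (M N X Y Z P Q T K L : lmodType R).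

Lemma proj_exact_lift P X Y Z (s : {linear X -> Y}) (p : {linear Y -> Z})
  (f : {linear P -> Y}) : projective P -> exact s p -> (forall x, p (f x) = 0) ->
  exists g : {linear P -> X}, forall x, s (g x) = f x.
Proof.
move=> pP sp pf; have [I [e [j [eo ji je]]]] := im_ex s.
have [|f' hf'] := @fact_sub _ _ _ _ j f ji.
  by move=> x; have /sp [y <-] := pf x; exists (e y).
have [g hg] := pP _ _ e f' eo; exists g => x.
by rewrite -je hg hf'.
Qed.

Lemma proj_retract P M (i : {linear M -> P}) (r : {linear P -> M}) :
  (forall x, r (i x) = x) -> projective P -> projective M.
Proof.
move=> ri pP X Y e f eo; have [g hg] := pP _ _ e (f \o r) eo.
by exists (g \o i) => x /=; rewrite hg /= ri.
Qed.

Lemma proj_pair P Q : projective P -> projective Q -> projective (P * Q)%type.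
Proof.
move=> pP pQ X Y e f eo; have [g hg] := pP _ _ e (f \o linl P Q) eo.
have [g' hg'] := pQ _ _ e (f \o linr P Q) eo.
exists (lcopair g g') => -[x y]; rewrite lprE linearD hg hg' /= -linearD !lprE.
by congr (f _); congr pair; rewrite /= ?addr0 ?add0r.
Qed.

Lemma proj_cop (I : choiceType) P : projective P -> projective (copower I P).
Proof.
move=> pP X Y e f eo.
have H i := pP _ _ e (f \o cop_in P i) eo.
pose g i := sval (cid (H i)); have hg i x : e (g i x) = f (cop_in P i x).
  by rewrite /g; case: cid.
exists (cop_elim g); apply: (@cop_ext _ _ _ _ (e \o cop_elim g)) => i x.
by rewrite /= cop_elimE hg.
Qed.

Lemma proj_reg : projective (R^o : lmodType R).
Proof.
move=> X Y e f eo; have [x ex] := eo (f 1).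
by exists (elt x); apply: (@reg_ext _ _ (e \o elt x)); rewrite /= elt1.
Qed.

Lemma proj_zero : projective (zero_mod R).
Proof.
move=> X Y e f _; exists (zero_map _ _) => x.
by rewrite (_ : x = 0) ?linear0 //; apply: thinmx0.
Qed.

Lemma cop_map_exact (I : choiceType) X Y Z (s : {linear X -> Y}) (p : {linear Y -> Z}) :
  exact s p -> exact (cop_map s : {linear copower I X -> copower I Y}) (cop_map p : {linear copower I Y -> copower I Z}).
Proof.
move=> sp u; split=> [pu|[v <-]]; last first.
  by apply/copowerP => i /=; apply/sp; exists (v i).
have [r ->] := copE u; elim: r => [|i r [v hv]].
  by exists 0; rewrite linear0 big_nil.
have /sp [x sx] : p (u i) = 0 by rewrite -[LHS]/(cop_map p u i) pu.
exists (cop_in X i x + v); rewrite linearD hv big_cons -sx; congr (_ + _).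
exact: cop_map_in.
Qed.

Lemma cop_map_onto (I : choiceType) X Y (p : {linear X -> Y}) :
  onto p -> onto (cop_map p : {linear copower I X -> copower I Y}).
Proof.
move=> po u; have [r ->] := copE u; elim: r => [|i r [v hv]].
  by exists 0; rewrite linear0 big_nil.
have [x px] := po (u i).
exists (cop_in X i x + v); rewrite linearD hv big_cons -px; congr (_ + _).
exact: cop_map_in.
Qed.

Section OnePresentation.
Variables (P Q T : lmodType R) (s : {linear P -> Q}) (p : {linear Q -> T}).
Hypothesis ps : projective_presentation s p.

(** This plays the part of Ext^1(T, N) = 0. Lift f p to a : Q -> Y; a s falls into N, so it extends
    along s to c : Q -> N, and a - c vanishes on the image of s. *)
Lemma D_lift Y Z N (g : {linear Y -> Z}) (k : {linear N -> Y}) :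
  onto g -> is_kernel k g -> Dclass s N ->
  forall f : {linear T -> Z}, exists f' : {linear T -> Y}, forall t, g (f' t) = f t.
Proof.
case: ps => pP pQ sp po go [ki kg] DN f.
have [a ga] := pQ _ _ g (f \o p) go.
have [|b kb] := @fact_sub _ _ _ _ k (a \o s) ki.
  move=> x; apply/kg; rewrite ga /= (_ : p (s x) = 0) ?linear0 //.
  by apply/sp; exists x.
have [c hc] := DN b.
have [|f' hf'] := @fact_quo _ _ _ _ p (a \- (k \o c)) po.
  by move=> x /sp [y <-] /=; rewrite hc kb subrr.
exists f' => t; have [x <-] := po t; rewrite hf' /= linearB ga.
by rewrite (_ : g (k _) = 0) ?subr0 //; apply/kg; exists (c x).
Qed.

(** A converse of [D_lift], which puts kernels into Gen T when D_s = Gen T: extend the map to Q with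
    values in Y, then subtract a map factoring through T so as to land in N. *)
Lemma D_ker Y Z N (g : {linear Y -> Z}) (k : {linear N -> Y}) :
  is_kernel k g -> Dclass s Y ->
  (forall f : {linear T -> Z}, exists f' : {linear T -> Y}, forall t, g (f' t) = f t) ->
  Dclass s N.
Proof.
case: ps => pP pQ sp po [ki kg] DY lif a.
have [b hb] := DY (k \o a).
have [|f hf] := @fact_quo _ _ _ _ p (g \o b) po.
  by move=> x /sp [y <-] /=; rewrite hb; apply/kg; exists (a y).
have [f' hf'] := lif f.
have [|c kc] := @fact_sub _ _ _ _ k (b \- (f' \o p)) ki.
  by move=> x; apply/kg; rewrite /= linearB hf' hf subrr.
exists c => x; apply: ki; rewrite kc /= hb (_ : p (s x) = 0) ?linear0 ?addr0 //.
by apply/sp; exists x.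
Qed.

(** For extensions: an element of Z is a sum of values of maps from T, and these lift to Y because X
    is in D_s. *)
Lemma Gen_tors : (forall X, Gen T X -> Dclass s X) -> tors (Gen T).
Proof.
move=> GD; split=> [X gX|X Y Z f g [fi fg go] GX GZ].
  by apply/GenP; apply: gen_gen gX => M /GenP.
apply/GenP => y; have lif := D_lift go (conj fi fg) (GD _ GX).
have tX : forall y', g y' = 0 -> tr (eq T) y'.
  by move=> y' /fg [x <-]; apply: tr_map; move/GenP: GX; apply.
suff H z : tr (eq T) z -> forall y', g y' = z -> tr (eq T) y'.
  by apply: (H (g y)) => //; move/GenP: GZ; apply.
elim=> [|M h m z' e _ IH] y' gy; first exact: tX.
case: _ / e h m gy => h m gy; have [h' hh'] := lif h.
rewrite -(subrK (h' m) y') addrC; apply: (tr_D h' m (erefl _)).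
by apply: IH; rewrite linearB hh' gy addrC addKr.
Qed.

Lemma D_cop (I : choiceType) X : Dclass s X ->
  Dclass (cop_map s : {linear copower I P -> copower I Q}) X.
Proof.
move=> DX f; have H i := DX (f \o cop_in P i).
pose g i := sval (cid (H i)); have hg i x : g i (s x) = f (cop_in P i x).
  by rewrite /g; case: cid.
exists (cop_elim g).
apply: (@cop_ext _ _ _ _ (cop_elim g \o cop_map s)) => i x.
by rewrite -hg -(cop_elimE g i) /= cop_map_in.
Qed.

Lemma cop_pres (I : choiceType) : projective_presentation
  (cop_map s : {linear copower I P -> copower I Q}) (cop_map p : {linear copower I Q -> copower I T}).
Proof.
case: ps => pP pQ sp po.
by split; [exact: proj_cop|exact: proj_cop|exact: cop_map_exact|exact: cop_map_onto].
Qed.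

Lemma minpres_exact P1 P0 M (d : {linear P1 -> P0}) (p1 : {linear P0 -> M}) :
  minimal_projective_presentation d p1 -> projective_presentation d p1.
Proof.
case=> [[pP0 p1o _] [N [k [q [[ki kp] [pP1 qo _] dE]]]]]; split=> // y.
rewrite kp; split=> [[n <-]|[x <-]]; last by exists (q x).
by have [x <-] := qo n; exists x.
Qed.

(* A minimal presentation of a retract of T is a retract, up to automorphisms,
   of any presentation of T. *)
Lemma D_retract P1 P0 M (d : {linear P1 -> P0}) (p1 : {linear P0 -> M})
    (i : {linear M -> T}) (r : {linear T -> M}) :
  (forall x, r (i x) = x) -> minimal_projective_presentation d p1 ->
  (forall e : {linear P0 -> P0}, onto e -> injective e) ->
  (forall e : {linear P1 -> P1}, onto e -> injective e) ->
  forall X, Dclass s X -> Dclass d X.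
Proof.
move=> ri md hopf0 hopf1 X DX f; have [_ _ dp1 _] := minpres_exact md.
case: md => [[pP0 p1o sup0] [N [k [q [[ki kp] [pP1 qo sup1] dE]]]]].
case: ps => pP pQ sp po.
have [a0 ha0] := pP0 _ _ p (i \o p1) po.
have [b0 hb0] := pQ _ _ p1 (r \o p) p1o.
have [|a1 ha1] := @proj_exact_lift _ _ _ _ s p (a0 \o d) pP1 sp.
  move=> x /=; rewrite ha0 /= (_ : p1 (d x) = 0) ?linear0 //.
  by apply/dp1; exists x.
have [|b1 hb1] := @proj_exact_lift _ _ _ _ d p1 (b0 \o s) pP dp1.
  move=> x /=; rewrite hb0 /= (_ : p (s x) = 0) ?linear0 //.
  by apply/sp; exists x.
have pe x : p1 (b0 (a0 x)) = p1 x by rewrite hb0 /= ha0 /= ri.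
(* The map [b0 \o a0] covers the identity of M, so it is onto because P0 is a projective cover;
   likewise for P1 over the kernel N below. *)
have e0o : onto (b0 \o a0).
  apply: sup0 => y; have [x <-] := p1o y; exists x; exact: pe.
have e0i := hopf0 (b0 \o a0) e0o.
have e1o : onto (b1 \o a1).
  apply: sup1 => n; have [x hx] := e0o (k n).
  have /kp [n' kn'] : p1 x = 0 by rewrite -pe [b0 _]hx; apply/kp; exists n.
  have [u qu] := qo n'; exists u; apply: ki.
  by rewrite /= -dE hb1 /= ha1 /= dE qu kn'.
have e1i := hopf1 (b1 \o a1) e1o.
have [g [_ hg]] := lin_inv e1i e1o.
have [g' hg' ] := lin_inv e1i e1o.
(* Composing with the inverse g' of [b1 \o a1] makes h a0 d equal to f itself. *)
have [h hh] := DX (f \o g' \o b1).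
exists (h \o a0) => x /=; rewrite -[a0 (d x)]ha1 hh /=.
by rewrite (hg'.1 x).
Qed.

(* Add(s) consists of the rho with Gen T <= D_rho and Coker rho in Gen T, up to
   homotopy. *)
Lemma D_add : Dclass s = Gen T ->
  forall (P' Q' C : lmodType R) (t : {linear P' -> Q'}) (c : {linear Q' -> C}),
  projective_presentation t c -> Gen T C -> (forall X, Gen T X -> Dclass t X) ->
  exists (I : choiceType) (w : {linear P' -> copower I P})
    (i0 : {linear Q' -> copower I Q}) (r1 : {linear copower I P -> P'})
    (r0 : {linear copower I Q -> Q'}) (h : {linear Q' -> P'}),
    [/\ forall x, cop_map s (w x) = i0 (t x), forall x, r0 (cop_map s x) = t (r1 x),
        forall x, x - r1 (w x) = h (t x) & forall y, y - r0 (i0 y) = t (h y)].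
Proof.
move=> sG P' Q' C t c [pP' pQ' tc co] GC GD; case: ps => pP pQ sp po.
(* The index set consists of all commutative squares from s to t, so that [r1] and [r0] form the
   universal map from copies of s to t. *)
pose I : choiceType := {classic {ab : {linear P -> P'} * {linear Q -> Q'} |
   forall x, t (ab.1 x) = ab.2 (s x)}}.
have mkI (a : {linear P -> P'}) (b : {linear Q -> Q'}) :
    (forall x, t (a x) = b (s x)) -> exists i : I, sval i = (a, b).
  by move=> ab; exists (exist _ (a, b) ab).
have sI i x : cop_map s (cop_in P i x) = cop_in Q i (s x) :> copower I Q := cop_map_in s i x.
pose r1 : {linear copower I P -> P'} := cop_elim (fun i : I => (sval i).1).
pose r0 : {linear copower I Q -> Q'} := cop_elim (fun i : I => (sval i).2).
have r1E (i : I) x : r1 (cop_in P i x) = (sval i).1 x by rewrite cop_elimE.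
have r0E (i : I) x : r0 (cop_in Q i x) = (sval i).2 x by rewrite cop_elimE.
have r01 x : r0 (cop_map s x) = t (r1 x).
  apply: (@cop_ext _ _ _ _ (r0 \o cop_map s) (t \o r1)) => i y.
  by rewrite /= sI r0E r1E (svalP i).
clearbody r0 r1.
(* Coker t is generated by T, and every map from T to it lifts to a square. *)
have lo : onto (lcopair r0 t).
  move=> y.
  suff [u hu] : exists u, c (r0 u) = c y.
    have /tc [z hz] : c (y - r0 u) = 0 by rewrite linearB hu subrr.
    by exists (u, z); rewrite lprE /= hz addrC subrK.
  move/GenP: GC => /(_ (c y)); elim=> [|M h m z e _ [u hu]].
    by exists 0; rewrite !linear0.
  case: _ / e h m => h m; have [b hb] := pQ _ _ c (h \o p) co.
  have [|a ha] := @proj_exact_lift _ _ _ _ t c (b \o s) pP tc.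
    move=> x /=; rewrite hb /= (_ : p (s x) = 0) ?linear0 //.
    by apply/sp; exists x.
  have [i ei] := mkI a b ha; have [q pq] := po m.
  exists (cop_in Q i q + u); rewrite !linearD hu r0E ei /=; congr (_ + _).
  by rewrite hb /= pq.
have [u hu] := pQ' _ _ (lcopair r0 t) idfun lo.
have [K [k [ki kk]]] := ker_ex (lcopair r0 t).
have [|j hj] := @fact_sub _ _ _ _ k (lpair (cop_map s) (\- r1)) ki.
  by move=> x; apply/kk; rewrite lprE lprE /= linearN r01 subrr.
(* X is the middle cohomology of P^(I) -> Q^(I) + P' -> Q', the obstruction to a section of r up to
   homotopy. It turns out to be in D_s, hence in Gen T. *)
have [X [pi [pio pij]]] := quo_ex (im_submod j).
have DX : Dclass s X.
  move=> a; have [a' ha'] := pP _ _ pi a pio.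
  pose a1 := lfst _ _ \o k \o a'; pose a2 := lsnd _ _ \o k \o a'.
  have ka x : k (a' x) = (a1 x, a2 x) by rewrite [LHS]surjective_pairing.
  have a12 x : r0 (a1 x) + t (a2 x) = 0.
    by have /kk := ex_intro (fun z => k z = k (a' x)) (a' x) erefl; rewrite ka lprE.
  have DT : Dclass s (copower I T).
    by rewrite sG; apply/GenP; apply: gen_copower.
  have [h' hh'] := DT (cop_map p \o a1).
  have [h1 hh1] := pQ _ _ (cop_map p) h' (cop_map_onto (I := I) po).
  have [|k1 hk1] := @proj_exact_lift _ _ _ _ (cop_map s) (cop_map p) (a1 \- (h1 \o s)) pP
    (cop_map_exact (I := I) sp).
    by move=> x; rewrite linearB /= hh1 hh' subrr.
  (* The square needed to correct the lift of a is itself an index i, so subtracting the inclusion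
     at i from h1 brings it into K. *)
  have [|i ei] := mkI ((\- a2) \- (r1 \o k1)) (r0 \o h1).
    move=> x /=; rewrite linearB -r01 hk1 /= linearB opprB addrC -addrA.
    by rewrite linearN -opprD a12 subr0.
  have [|g hg] := @fact_sub _ _ _ _ k (linl _ _ \o (h1 \- cop_in Q i)) ki.
    by move=> x; apply/kk; rewrite /= linlE lprE /= linear0 addr0 linearB r0E ei subrr.
  exists (pi \o g) => x /=; rewrite -ha'; apply/eqP; rewrite eq_sym -subr_eq0 -linearB.
  apply/eqP/pij; exists (k1 x + cop_in P i x); apply: ki; rewrite linearB hj hg ka /= !lprE.
  congr pair; first by rewrite linearD hk1 /= sI opprB addrA addrAC.
  by rewrite /= linearD r1E ei /= oppr0 addr0 addrCA subrr addr0 opprK.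
(* The map x |-> (0, x) - u (t x) measures how far u is from being part of a chain map; modulo the
   image of j it extends along t because X is in Gen T, and this corrects u. *)
have [|v0 hv0] := @fact_sub _ _ _ _ k (linr _ _ \- (u \o t)) ki.
  move=> x; apply/kk; rewrite linearB hu /= linrE lprE /=.
  by rewrite linear0 add0r subrr.
rewrite sG in DX; have [v hv] := GD _ DX (pi \o v0).
have [v' hv'] := pQ' _ _ pi v pio.
have [||w' hw'] := @proj_exact_lift _ _ _ _ j pi (v0 \- (v' \o t)) pP'.
- by move=> y; rewrite pij.
- by move=> x; rewrite linearB /= hv' hv subrr.
pose uv := u \+ (k \o v').
have wE x : (cop_map s (w' x), - r1 (w' x)) = (0, x) - uv (t x) :> (_ * _)%type.
  rewrite -[LHS](lpairE (cop_map s) (\- r1) (w' x)) -hj hw' linearB hv0 /= linrE.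
  by rewrite opprD addrA.
exists I, (\- w'), (lfst _ _ \o uv), r1, r0, (lsnd _ _ \o uv); split=> // x.
- rewrite linearN; have := congr1 fst (wE x) => /= ->.
  by rewrite sub0r opprK.
- have := congr1 snd (wE x) => /= e; rewrite linearN e.
  by rewrite opprB addrC subrK.
- have e1 := hu x; have /kk : exists z, k z = k (v' x) by exists (v' x).
  rewrite lprE => e2; rewrite lprE in e1; have e3 : r0 (uv x).1 + t (uv x).2 = x.
    by rewrite /= !linearD addrACA [X in X + _]e1 e2 addr0.
  by rewrite -{1}e3 addrC addKr.
Qed.
End OnePresentation.
End Presentations.

(** * Finite dimensional modules *)

Section LinearAlgebra.
Variables (K : fieldType) (V : lmodType K).
Implicit Types S : V -> Prop.

Definition spans n (v : 'I_n -> V) S :=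
  forall x, S x -> exists c : 'I_n -> K, x = \sum_i c i *: v i.

Lemma steinitz n m (v : 'I_n -> V) (w : 'I_m -> V) S :
  spans v S -> (forall i, S (w i)) -> (n < m)%N ->
  exists c : 'I_m -> K, (exists i, c i != 0) /\ \sum_i c i *: w i = 0.
Proof.
move=> sv Sw nm; pose C i := sval (cid (sv _ (Sw i))).
have hC i : w i = \sum_j C i j *: v j by rewrite /C; case: cid.
pose MC : 'M[K]_(m, n) := \matrix_(i, j) C i j.
have /rowV0Pn [u uk u0] : kermx MC != 0.
  rewrite -mxrank_eq0 mxrank_ker -lt0n subn_gt0.
  exact: leq_ltn_trans (rank_leq_col _) nm.
have /sub_kermxP uC := uk; exists (u 0); split; first exact/rV0Pn.
under eq_bigr => i _ do rewrite hC scaler_sumr.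
rewrite exchange_big big1 //= => j _.
under eq_bigr => i _ do rewrite scalerA.
rewrite -scaler_suml; have := congr1 (fun X => fun_of_matrix X 0 j) uC.
rewrite !mxE => e; rewrite (eq_bigr (fun i => u 0 i * MC i j)) ?e ?scale0r //.
by move=> i _; rewrite mxE.
Qed.

Definition indep m S := exists w : 'I_m -> V, (forall i, S (w i)) /\
  forall c : 'I_m -> K, \sum_i c i *: w i = 0 -> forall i, c i = 0.

Lemma indep_max n (v : 'I_n -> V) S : spans v S -> submod S ->
  exists2 m, (m <= n)%N & indep m S /\ forall m', indep m' S -> (m' <= m)%N.
Proof.
move=> sv sS; have bnd m : indep m S -> (m <= n)%N.
  case=> w [Sw iw]; rewrite leqNgt; apply/negP => /(steinitz sv Sw) [c [[i ci] /iw c0]].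
  by rewrite c0 eqxx in ci.
have ex0 : exists m, `[< indep m S >].
  by exists 0%N; apply/asboolP; exists (fun=> 0); split=> [i|c _ []//]; apply: (sm0 sS).
have bnd' m : `[< indep m S >] -> (m <= n)%N by move/asboolP; apply: bnd.
have [m /asboolP im mm] := ex_maxnP ex0 bnd'.
by exists m; [exact: bnd | split=> // m' h; apply: mm; apply/asboolP].
Qed.

Lemma indep_span m S (w : 'I_m -> V) x :
  (forall c : 'I_m -> K, \sum_i c i *: w i = 0 -> forall i, c i = 0) ->
  (forall i, S (w i)) -> S x -> ~ indep m.+1 S ->
  exists c : 'I_m -> K, x = \sum_i c i *: w i.
Proof.
move=> iw Sw Sx nin; apply: contrapT => nx; apply: nin.
exists (fun i => if unlift ord_max i is Some j then w j else x); split.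
  by move=> i; case: unliftP.
move=> c; rewrite big_ord_recr /=.
have -> : unlift ord_max (ord_max : 'I_m.+1) = None by rewrite unlift_none.
have liftE (i : 'I_m) : widen_ord (leqnSn m) i = lift ord_max i.
  by apply: val_inj; rewrite /= /bump leqNgt ltn_ord.
under eq_bigr => i _ do rewrite liftE liftK.
move=> e; have c0 : c ord_max = 0.
  apply/eqP; apply/negPn/negP => cn; apply: nx.
  exists (fun i => - ((c ord_max)^-1 * c (lift ord_max i))).
  under eq_bigr => i _ do rewrite scaleNr -scalerA.
  rewrite sumrN -scaler_sumr; move/eqP: e; rewrite addr_eq0 => /eqP ->.
  by rewrite scalerN opprK scalerA mulVf // scale1r.
move: e; rewrite c0 scale0r addr0 => /iw h i.
by case: (unliftP ord_max i) => [j ->|->].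
Qed.

Lemma sub_basis n (v : 'I_n -> V) S : spans v S -> submod S ->
  exists m (w : 'I_m -> V), [/\ (m <= n)%N, forall i, S (w i) & spans w S].
Proof.
move=> sv sS; have [m mn [[w [Sw iw]] mm]] := indep_max sv sS.
exists m, w; split=> // x Sx; apply: (indep_span iw Sw Sx).
by move/mm; rewrite ltnn.
Qed.

Lemma sub_basis_lt n (v : 'I_n -> V) S S' : spans v S' -> submod S -> submod S' ->
  (forall x, S x -> S' x) -> (exists2 x, S' x & ~ S x) ->
  exists m (w : 'I_m -> V), [/\ (m < n)%N, forall i, S (w i) & spans w S].
Proof.
move=> sv sS sS' SS' [x S'x nSx].
have [|m mn [[w [Sw iw]] mm]] := @indep_max _ v S _ sS.
  by move=> y /SS'; apply: sv.
exists m, w; split=> //; last first.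
  by move=> y Sy; apply: (indep_span iw Sw Sy) => /mm; rewrite ltnn.
have [m' m'n [_ mm']] := indep_max sv sS'.
have /mm' := (ex_intro _ w (conj (fun i => SS' _ (Sw i)) iw) : indep m S').
rewrite leq_eqVlt => /orP[/eqP e|h]; last exact: leq_trans h m'n.
exfalso; apply: nSx; have [|c ->] := indep_span iw (fun i => SS' _ (Sw i)) S'x.
  by move/mm'; rewrite e ltnn.
by apply: (sm_sum sS) => i; apply: (smZ sS).
Qed.

(** A member needing the fewest spanning vectors is minimal, by [sub_basis_lt]. *)
Lemma submod_min n (v : 'I_n -> V) (F : (V -> Prop) -> Prop) :
  (forall S, F S -> submod S /\ spans v S) -> (exists S, F S) ->
  exists2 S, F S & forall S', F S' -> (forall x, S' x -> S x) -> forall x, S x -> S' x.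
Proof.
move=> FS [S0 FS0].
have ex : exists m, `[< exists2 S, F S & exists w : 'I_m -> V, spans w S >].
  by exists n; apply/asboolP; exists S0 => //; exists v; case: (FS _ FS0).
have [m /asboolP[S FSS [w sw]] mm] := ex_minnP ex; exists S => // S' FS' S'S x Sx.
apply: contrapT => nx; have [sS _] := FS _ FSS; have [sS' _] := FS _ FS'.
have [|m' [w' [lt _ sw']]] := sub_basis_lt sw sS' sS S'S; first by exists x.
have /mm : `[< exists2 S, F S & exists w : 'I_m' -> V, spans w S >].
  by apply/asboolP; exists S' => //; exists w'.
by rewrite leqNgt lt.
Qed.

(** A member containing the longest independent family is maximal: that family spans every larger
    member. *)
Lemma submod_max n (v : 'I_n -> V) (F : (V -> Prop) -> Prop) :
  (forall S, F S -> submod S /\ spans v S) -> (exists S, F S) ->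
  exists2 S, F S & forall S', F S' -> (forall x, S x -> S' x) -> forall x, S' x -> S x.
Proof.
move=> FS [S0 FS0].
pose P m := `[< exists2 S, F S & indep m S >].
have bnd m : P m -> (m <= n)%N.
  move/asboolP=> [S /FS[sS sv] im]; have [m' m'n [_ mm]] := indep_max sv sS.
  exact: leq_trans (mm _ im) m'n.
have ex : exists m, P m.
  exists 0%N; apply/asboolP; exists S0 => //; exists (fun=> 0).
  by split=> [i|c _ []//]; have [sS _] := FS _ FS0; apply: (sm0 sS).
have [m /asboolP[S FSS [w [Sw iw]]] mm] := ex_maxnP ex bnd; exists S => // S' FS' SS' x Sx'.
have [|c ->] := indep_span iw (fun i => SS' _ (Sw i)) Sx'.
  move=> h; have /mm : P m.+1 by apply/asboolP; exists S'.
  by rewrite ltnn.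
by have [sS _] := FS _ FSS; apply: (sm_sum sS) => i; apply: (smZ sS).
Qed.
End LinearAlgebra.

Section KModule.
Variables (K : fieldType) (A : algType K).

Definition kalg : K -> A^c := fun c => c%:A.
Fact kalg_zmod : zmod_morphism kalg.
Proof. by move=> a b; rewrite /kalg scalerBl. Qed.
Fact kalg_monoid : monoid_morphism kalg.
Proof.
split=> [|a b]; first by rewrite /kalg scale1r.
by rewrite /kalg [RHS]/GRing.mul /= -scalerAr mulr1 scalerA.
Qed.
HB.instance Definition _ := GRing.isZmodMorphism.Build K A^c kalg kalg_zmod.
HB.instance Definition _ := GRing.isMonoidMorphism.Build K A^c kalg kalg_monoid.
Definition kmap : {rmorphism K -> A^c} := kalg.

Implicit Types M N X Y P Q T I L E U : lmodType A^c.

Definition kmod M : lmodType K := restr kmap M.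
Definition ks M (c : K) (x : M) : M := kalg c *: x.

Lemma ksE M c (x : M) : ks c x = ((c : K) *: (x : kmod M) : kmod M).
Proof. by []. Qed.

Lemma ks_comm M c (a : A^c) (x : M) : a *: ks c x = ks c (a *: x).
Proof.
rewrite /ks !scalerA; congr (_ *: _).
by rewrite /kalg /GRing.mul /= -scalerAl -scalerAr mul1r mulr1.
Qed.

Lemma ks_lin M c : linear (@ks M c).
Proof. by move=> a x y; rewrite ks_comm /ks scalerDr. Qed.
Definition kscale M c : {linear M -> M} := mkl (@ks_lin M c).

Lemma ks_map M N (f : {linear M -> N}) c x : f (ks c x) = ks c (f x).
Proof. exact: linearZ. Qed.

Lemma submodK M (S : M -> Prop) : submod S -> submod (S : kmod M -> Prop).
Proof. by move=> sS; split=> [|a x y Sx Sy]; [apply: (sm0 sS)|apply: sS.2]. Qed.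

(** Says dim M <= n; in arguments by minimality the least such n takes the place of the
    dimension. *)
Definition fdn n M := exists v : 'I_n -> kmod M, spans v (fun=> True).

Lemma fin_dimP M : fin_dim M <-> exists n, fdn n M.
Proof.
split=> -[n [v sv]]; exists n, v; first by move=> x _; exact: sv.
by move=> x; exact: (sv x I).
Qed.

Lemma fin_dimI (J : finType) M (v : J -> kmod M) :
  (forall x, exists c : J -> K, x = \sum_j c j *: v j) -> fin_dim M.
Proof.
move=> sv; exists #|J|, (fun i => v (enum_val i)) => x; have [c ->] := sv x.
by exists (fun i => c (enum_val i)); rewrite (reindex _ (onW_bij _ (enum_val_bij J))).
Qed.

Lemma fdn_onto n M N (f : {linear M -> N}) : onto f -> fdn n M -> fdn n N.
Proof.
move=> fo [v sv]; exists (fun i => f (v i)) => y _; have [x <-] := fo y.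
have [c ->] := sv x I; exists c; rewrite linear_sum; apply: eq_bigr => i _.
exact: ks_map.
Qed.

Lemma fdn_sub n M N (k : {linear N -> M}) : injective k -> fdn n M ->
  exists2 m, (m <= n)%N & fdn m N /\ (~ onto k -> (m < n)%N).
Proof.
move=> ki [v sv]; pose S x := exists y, k y = x.
have sS : submod (S : kmod M -> Prop) by apply/submodK/im_submod.
have sT : submod (fun _ : kmod M => True) by split.
have lift m (w : 'I_m -> kmod M) : (forall i, S (w i)) -> spans w S -> fdn m N.
  move=> Sw sw; exists (fun i => sval (cid (Sw i))) => y _.
  have [|c e] := sw (k y); first by exists y.
  exists c; apply: ki; rewrite e linear_sum; apply: eq_bigr => i _.
  by rewrite [RHS]ks_map; case: cid => z /= ->.
have [ko|nko] := pselect (onto k).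
  have [|m [w [mn Sw sw]]] := @sub_basis _ _ _ v S _ sS; first by move=> x _; apply: sv.
  by exists m => //; split=> //; apply: lift sw.
have [//||m [w [mn Sw sw]]] := @sub_basis_lt _ _ _ v S _ sv sS sT.
  by apply: contrapT => h; apply: nko => x; apply: contrapT => nx; apply: h; exists x.
by exists m; [exact: ltnW | split=> //; apply: lift sw].
Qed.

Lemma fd_onto M N (f : {linear M -> N}) : onto f -> fin_dim M -> fin_dim N.
Proof. by move=> fo /fin_dimP[n h]; apply/fin_dimP; exists n; apply: fdn_onto h. Qed.

Lemma fd_sub M N (k : {linear N -> M}) : injective k -> fin_dim M -> fin_dim N.
Proof.
by move=> ki /fin_dimP[n /(fdn_sub ki)[m _ [h _]]]; apply/fin_dimP; exists m.
Qed.

Lemma fd_pair M N : fin_dim M -> fin_dim N -> fin_dim (M * N)%type.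
Proof.
move=> [m [v sv]] [n [w sw]].
apply: (@fin_dimI ('I_m + 'I_n)%type (M * N)%type
  (fun j => match j with inl i => linl M N (v i) | inr i => linr M N (w i) end)).
case=> x y; have [c ->] := sv x; have [d ->] := sw y.
exists (fun j => match j with inl i => c i | inr i => d i end).
rewrite big_sumType /=.
rewrite (eq_bigr (fun i => linl M N (ks (c i) (v i)))); last by move=> i _; rewrite ks_map.
rewrite [X in _ = _ + X](eq_bigr (fun i => linr M N (ks (d i) (w i)))); last by move=> i _; rewrite ks_map.
by rewrite -!linear_sum linlE linrE; congr pair; rewrite /= ?addr0 ?add0r.
Qed.

Lemma copE_fin (I : finType) M (u : copower I M) : u = \sum_i cop_in M i (u i).
Proof.
apply/copowerP => k; rewrite cop_sumE (bigD1 k) //= cop_inE eqxx big1 ?addr0 // => i.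
by rewrite cop_inE eq_sym => /negbTE ->.
Qed.

Lemma fd_cop (I : finType) M : fin_dim M -> fin_dim (copower I M).
Proof.
move=> [m [v sv]].
apply: (@fin_dimI (I * 'I_m)%type (copower I M) (fun j => cop_in M j.1 (v j.2))) => u.
pose c i := sval (cid (sv (u i))).
have hc i : u i = \sum_j ((c i j)%:A : A^c) *: v j by rewrite /c; case: cid.
exists (fun j => c j.1 j.2); rewrite {1}[u]copE_fin.
rewrite (eq_bigr (fun i => \sum_j ks (c i j) (cop_in M i (v j)))).
  by rewrite pair_big.
by move=> i _; rewrite {1}hc linear_sum; apply: eq_bigr => j _; rewrite -ks_map.
Qed.

Fixpoint epow M (e : {linear M -> M}) n : {linear M -> M} :=
  if n is n'.+1 then e \o epow e n' else idfun.

Lemma epowD M (e : {linear M -> M}) m n x : epow e (m + n) x = epow e m (epow e n x).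
Proof. by elim: m => //= m ->. Qed.
Lemma epowSr M (e : {linear M -> M}) m x : epow e m.+1 x = epow e m (e x).
Proof. by rewrite -addn1 epowD. Qed.
Lemma epow_onto M (e : {linear M -> M}) m : onto e -> onto (epow e m).
Proof.
move=> eo; elim: m => [|m IH] y; first by exists y.
by have [z <-] := eo y; have [x <-] := IH z; exists x.
Qed.
Lemma epow_inj M (e : {linear M -> M}) m : injective e -> injective (epow e m).
Proof. by move=> ei; elim: m => [|m IH] x y //= /ei /IH. Qed.
Lemma epow0 M (e : {linear M -> M}) m k x : epow e m x = 0 -> epow e (k + m) x = 0.
Proof. by move=> h; rewrite epowD h linear0. Qed.

(** The kernels of the powers of e stabilise, say at e^k. Writing x in Ker e as e^k y gives e^(k+1)
    y = 0, so already e^k y = 0. *)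
Lemma hopf M (e : {linear M -> M}) : fin_dim M -> onto e -> injective e.
Proof.
move=> /fin_dimP[n [v sv]] eo.
have [||S [k Sk] mx] := @submod_max _ (kmod M) n v (fun S => exists k, S = fun x => epow e k x = 0).
- move=> S [k ->]; split; first exact/submodK/ker_submod.
  by move=> x _; apply: sv.
- by exists (fun x => epow e 0 x = 0), 0%N.
apply: inj0 => x ex; have [y yx] := epow_onto k eo x.
have : S y.
  apply: (mx (fun x => epow e k.+1 x = 0)); first by exists k.+1.
    by move=> z; rewrite Sk /= => ->; rewrite linear0.
  by rewrite /= yx.
by rewrite Sk yx.
Qed.

(** Dually the images of the powers stabilise: e^k x = e^(k+1) y for some y, and e^k can be
    cancelled. *)
Lemma cohopf M (e : {linear M -> M}) : fin_dim M -> injective e -> onto e.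
Proof.
move=> /fin_dimP[n [v sv]] ei.
have [||S [k Sk] mx] := @submod_min _ (kmod M) n v (fun S => exists k, S = fun x => exists y, epow e k y = x).
- move=> S [k ->]; split; first exact/submodK/im_submod.
  by move=> x _; apply: sv.
- by exists (fun x => exists y, epow e 0 y = x), 0%N.
move=> x; have [|||y h] := mx (fun x => exists y, epow e k.+1 y = x) _ _ (epow e k x).
- by exists k.+1.
- by move=> z [y <-]; rewrite Sk; exists (e y); rewrite epowSr.
- by rewrite Sk; exists x.
by exists y; apply: (@epow_inj _ e k ei); rewrite -epowSr.
Qed.

Definition zerom M := forall x : M, x = 0.

(* Fitting's lemma: M is the direct sum of I and Ker (e^k). *)
Lemma fitting M (e : {linear M -> M}) : fin_dim M ->
  exists k (I : lmodType A^c) (a : {linear M -> I}) (j : {linear I -> M}),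
    [/\ onto a, injective j, forall x, j (a x) = epow e k.+1 x &
        exists r : {linear M -> I}, [/\ forall i, r (j i) = i,
          forall x, r x = 0 <-> epow e k.+1 x = 0 & forall x, epow e k.+1 (j (r x)) = epow e k.+1 x]].
Proof.
move=> fM; have /fin_dimP[n [v sv]] := fM.
(* The exponent is kept positive so that the kernel contains Ker e and I lies in the image of e. *)
have [||S [k Sk] mx] := @submod_max _ (kmod M) n v (fun S => exists k, S = fun x => epow e k.+1 x = 0).
- move=> S [k ->]; split; first exact/submodK/ker_submod.
  by move=> x _; apply: sv.
- by exists (fun x => epow e 1 x = 0), 0%N.
have ker2 x : epow e k.+1 (epow e k.+1 x) = 0 -> epow e k.+1 x = 0.
  rewrite -epowD addSn => h.
  have : S x; last by rewrite Sk.
  apply: (mx (fun x => epow e (k + k.+1).+1 x = 0)) => //; first by exists (k + k.+1)%N.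
  by move=> z; rewrite Sk => h'; rewrite -addSn epow0.
have [I [a [j [ao ji ja]]]] := im_ex (epow e k.+1).
have aji : injective (a \o j).
  apply: inj0 => i /= h; have [x xi] := ao i; apply: ji; rewrite linear0 -xi ja.
  by apply: ker2; rewrite -[epow e _ x]ja xi -ja h linear0.
have fI : fin_dim I by apply: fd_sub ji fM.
have [g [gl gr]] := lin_inv aji (cohopf fI aji).
exists k, I, a, j; split=> //; exists (g \o a); split=> [i|x|x]; first exact: gl.
  rewrite -ja; split=> [h|h].
    by rewrite -[a x]gr [g _]h !linear0.
  have a0 : a x = 0 by apply: ji; rewrite h linear0.
  by rewrite /= a0 linear0.
by rewrite -[LHS]ja -[RHS]ja; congr (j _); rewrite -[RHS]gr.
Qed.

Lemma retract_split M I (j : {linear I -> M}) (r : {linear M -> I}) :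
  (forall i, r (j i) = i) ->
  exists (N : lmodType A^c) (k : {linear N -> M}), is_kernel k r /\ lmod_iso M (I * N)%type.
Proof.
move=> rj; have [N [k [ki kr]]] := ker_ex r; exists N, k; split=> //.
have [|q hq] := @fact_sub _ _ _ _ k (idfun \- (j \o r)) ki.
  by move=> x; apply/kr; rewrite linearB /= rj subrr.
apply: (@lmod_iso_of _ _ _ (lpair r q)).
  apply: inj0 => x; rewrite lpairE => -[rx qx].
  by have := hq x; rewrite qx linear0 /= rx linear0 subr0.
case=> i n; exists (j i + k n); rewrite lpairE !linearD rj.
have rk : r (k n) = 0 by apply/kr; exists n.
by rewrite rk addr0; congr pair; apply: ki; rewrite linearD !hq /= rj rk linear0 subrr subr0 add0r.
Qed.

Lemma indec_endo M (e : {linear M -> M}) : fin_dim M -> indecomposable M ->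
  (injective e /\ onto e) \/ exists k, forall x, epow e k x = 0.
Proof.
move=> fM [_ ind]; have [k [I [a [j [ao ji ja [r [rj rk _]]]]]]] := fitting e fM.
have [N [kN [[kNi kNe] iso]]] := retract_split rj.
case: {ind iso}(ind I N iso) => [zI|zN]; last first.
  left; have ei : injective e.
    apply: inj0 => x ex; have [n <-] : exists n, kN n = x by apply/kNe/rk; rewrite epowSr ex linear0.
    by rewrite (zN n) linear0.
  by split=> //; apply: cohopf.
by right; exists k.+1 => x; rewrite -ja (zI (a x)) linear0.
Qed.

Lemma nilp_1sub M (e : {linear M -> M}) k : (forall x, epow e k x = 0) ->
  exists g : {linear M -> M}, (forall x, g (x - e x) = x) /\ forall x, g x - e (g x) = x.
Proof.
move=> ek; have ge n : exists g : {linear M -> M}, (forall x, g (x - e x) = x - epow e n x) /\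
    forall x, g x - e (g x) = x - epow e n x.
  elim: n => [|n [g [g1 g2]]].
    by exists (zero_map M M); split=> x; rewrite /= subrr // [e _]linear0 subr0.
  exists (g \+ epow e n); split=> x.
    by rewrite /= g1 linearB -epowSr addrA subrK.
  by rewrite /= linearD opprD addrACA g2 addrA subrK.
have [g [g1 g2]] := ge k.
by exists g; split=> x; rewrite (g1, g2) ek subr0.
Qed.

Definition retract N M := exists (i : {linear N -> M}) (r : {linear M -> N}), forall x, r (i x) = x.

Lemma retract_refl M : retract M M. Proof. by exists idfun, idfun. Qed.
Lemma retract_trans L M N : retract L M -> retract M N -> retract L N.
Proof.
by move=> [i [r ri]] [j [s sj]]; exists (j \o i), (r \o s) => x /=; rewrite sj ri.
Qed.
Lemma iso_retract M N : lmod_iso M N -> retract M N /\ retract N M.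
Proof.
case=> f /bijP[fi fo]; have [g [gf fg]] := lin_inv fi fo.
by split; [exists f, g | exists g, f].
Qed.

Lemma retract_inl M N : retract M (M * N)%type.
Proof. by exists (linl M N), (lfst M N) => x; rewrite linlE. Qed.
Lemma retract_inr M N : retract N (M * N)%type.
Proof. by exists (linr M N), (lsnd M N) => x; rewrite linrE. Qed.

Inductive fadd (C : lmodType A^c -> Prop) : lmodType A^c -> Prop :=
| fadd0 (M : lmodType A^c) : zerom M -> fadd C M
| fadd1 (M : lmodType A^c) : C M -> fadd C M
| faddD (M N E : lmodType A^c) : fadd C M -> fadd C N -> lmod_iso E (M * N)%type -> fadd C E.

Lemma krull_schmidt M : fin_dim M ->
  fadd (fun N => [/\ indecomposable N, fin_dim N & retract N M]) M.
Proof.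
move=> fM; have /fin_dimP[n fn] := fM.
suff H n' N : fdn n' N -> retract N M ->
    fadd (fun N => [/\ indecomposable N, fin_dim N & retract N M]) N.
  exact: H fn (retract_refl M).
elim/ltn_ind: n' N => m IH N fN rN.
have [zN|nzN] := pselect (zerom N); first exact: fadd0.
have [iN|nN] := pselect (indecomposable N).
  by apply: fadd1; split=> //; apply/fin_dimP; exists m.
have [M1 [M2 [iso [n1 n2]]]] : exists M1 M2 : lmodType A^c, lmod_iso N (M1 * M2)%type /\ ~ zerom M1 /\ ~ zerom M2.
  apply: contrapT => h; apply: nN; split.
    apply: contrapT => h'; apply: nzN => x; apply/eqP/negPn/negP => x0.
    by apply: h'; exists x.
  move=> M1 M2 iso; apply: contrapT => /not_orP[n1 n2]; apply: h.
  by exists M1, M2.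
have [r1 r2] := iso_retract iso.
have fE : fdn m (M1 * M2)%type.
  by case: iso => f /bijP[_ fo]; apply: fdn_onto fo fN.
have q1 := retract_inl M1 M2.
have q2 := retract_inr M1 M2.
apply: (faddD _ _ iso).
  have [|m1 _ [f1 l1]] := @fdn_sub _ _ _ (linl M1 M2) _ fE.
    by move=> x y; rewrite !linlE => -[].
  apply: (IH m1) => //; last by apply: retract_trans rN; apply: retract_trans r2.
  apply: l1 => o; apply: n2 => y; have [x] := o (0, y).
  by rewrite linlE => -[].
have [|m1 _ [f1 l1]] := @fdn_sub _ _ _ (linr M1 M2) _ fE.
  by move=> x y; rewrite !linrE => -[].
apply: (IH m1) => //; last by apply: retract_trans rN; apply: retract_trans r2.
apply: l1 => o; apply: n1 => y; have [x] := o (y, 0).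
by rewrite linrE => -[].
Qed.
End KModule.

(** * Projective covers, minimal presentations and tau-rigidity *)

Section Covers.
Variables (K : fieldType) (A : falgType K).
Implicit Types M N X Y P Q T I L E U : lmodType A^c.

Notation Areg := ((A^c)^o : lmodType A^c).

Lemma fd_reg : fin_dim Areg.
Proof.
apply: (@fin_dimI K A 'I_(\dim {:A}) Areg (fun i => (vbasis {:A})`_i)) => x.
exists (fun i => coord (vbasis {:A}) i x); rewrite {1}(coord_vbasis (memvf (x : A))).
apply: eq_bigr => i _; rewrite -[RHS]/((_ : A) * (_%:A : A)).
by rewrite -scalerAr mulr1.
Qed.

Lemma free_cover M : fin_dim M ->
  exists n (p : {linear copower 'I_n Areg -> M}), onto p.
Proof.
case=> n [v sv]; exists n, (cop_elim (fun i => elt (v i))) => x.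
have [c ->] := sv x.
exists (\sum_i cop_in Areg i ((c i)%:A : A)).
rewrite linear_sum; apply: eq_bigr => i _.
by rewrite cop_elimE eltE elt1.
Qed.

(** P has least dimension among the projective modules mapping onto M. If p g is onto, lifting p
    through the image of g gives an endomorphism e of P with p e = p; its Fitting image is
    projective and still maps onto M, so it is all of P, and g is onto. *)
Lemma proj_cover_ex M : fin_dim M ->
  exists P (p : {linear P -> M}), projective_cover p /\ fin_dim P.
Proof.
move=> fM; have [n0 [p0 p0o]] := free_cover fM.
pose F n := `[< exists P (p : {linear P -> M}), [/\ projective P, onto p & fdn n P] >].
have exF : exists n, F n.
  have /fin_dimP[n fn] := fd_cop 'I_n0 fd_reg.
  by exists n; apply/asboolP; exists (copower 'I_n0 Areg), p0; split=> //; apply/proj_cop/proj_reg.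
have [n /asboolP[P [p [pP po fn]]] mn] := ex_minnP exF.
have fP : fin_dim P by apply/fin_dimP; exists n.
exists P, p; split=> //; split=> // X g pgo.
have [G [a [j [ao ji ja]]]] := im_ex g.
have pjo : onto (p \o j).
  by move=> y; have [x <-] := pgo y; exists (a x); rewrite /= ja.
have [l hl] := pP _ _ (p \o j) p pjo.
have pe x : p (j (l x)) = p x := hl x.
have [k [I [b [i [bo ii ib [r [ri _ _]]]]]]] := fitting (j \o l) fP.
have pI : projective I by apply: proj_retract ri pP.
have pk m x : p (epow (j \o l) m x) = p x.
  by elim: m => //= m <-; rewrite pe.
have pio : onto (p \o i).
  by move=> y; have [x <-] := po y; exists (b x); rewrite /= ib pk.
have [m mn' [fI lt]] := fdn_sub ii fn.
have io : onto i.
  apply: contrapT => /lt; rewrite ltnNge => /negP; apply; apply: mn.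
  by apply/asboolP; exists I, (p \o i).
move=> y; have [z <-] := io y; have [x <-] := bo z; rewrite ib /=.
by have [w hw] := ao (l (epow (j \o l) k x)); exists w; rewrite -ja hw.
Qed.

Lemma min_pres_ex M : fin_dim M ->
  exists P1 P0 (d : {linear P1 -> P0}) (p : {linear P0 -> M}),
    [/\ minimal_projective_presentation d p, fin_dim P1 & fin_dim P0].
Proof.
move=> fM; have [P0 [p [cp fP0]]] := proj_cover_ex fM.
have [N [k kk]] := ker_ex p.
have [P1 [q [cq fP1]]] := proj_cover_ex (fd_sub kk.1 fP0).
by exists P1, P0, (k \o q), p; split=> //; split=> //; exists N, k, q.
Qed.

Lemma fin_gen_fd M : fin_dim M -> fin_gen M.
Proof.
case=> n [v sv]; exists n, v => x; have [c e] := sv x.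
by exists (fun i => (c i)%:A : A^c).
Qed.

Lemma dual_basis P : projective P -> fin_dim P ->
  exists n (e : 'I_n -> P) (f : 'I_n -> star P),
    forall x, x = \sum_i (f i x : A^c) *: e i.
Proof.
move=> pP fP; have [n [p po]] := free_cover fP.
have [s ps] := pP _ _ p idfun po.
have lin i (a : A) x y : s ((a : A^c) *: x + y) i = (s x i : A) * a + s y i :> A.
  by rewrite linearP.
exists n, (fun i => p (cop_in Areg i 1)), (fun i => Star (lin i)) => x.
rewrite -{1}[x]ps {1}[s x]copE_fin linear_sum; apply: eq_bigr => i _ /=.
by rewrite -linearZ -linearZ; congr (p (cop_in _ _ _)); apply/esym/mulr1.
Qed.

Lemma star_sumE P n (F : 'I_n -> star P) x : (\sum_i F i) x = \sum_i F i x.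
Proof. by elim/big_ind2: _ => // u a v b <- <-. Qed.

Lemma starZ P (f : star P) (a : A^c) x : f (a *: x) = f x * (a : A).
Proof.
have f0 : f 0 = 0.
  have := star_linear f 1 0 0; rewrite scaler0 addr0 mulr1 => /eqP.
  by rewrite -subr_eq0 opprD addrA subrr sub0r oppr_eq0 => /eqP.
by have := star_linear f a x 0; rewrite !addr0 f0 addr0.
Qed.

Lemma starD P (f : star P) x y : f (x + y) = f x + f y.
Proof. by have := star_linear f 1 x y; rewrite scale1r mulr1. Qed.

Lemma star_lin P (f : star P) M (m : M) : linear (fun x => (f x : A^c) *: m).
Proof. by move=> a x y; rewrite starD starZ scalerDl -scalerA. Qed.

Lemma dual_0 (X : lmodType A) (u : dual X) : u 0 = 0.
Proof.
by apply/eqP; rewrite -(inj_eq (addrI (u 0))) -dualD !addr0.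
Qed.

Lemma dual_lin_sum (X : lmodType A) (u : dual X) n (F : 'I_n -> X) :
  u (\sum_i F i) = \sum_i u (F i).
Proof.
elim: n F => [|n IH] F; first by rewrite !big_ord0 dual_0.
by rewrite !big_ord_recr /= dualD IH.
Qed.

(* f(m)(q u), for f : M -> D X and q : P1^* -> X = Tr M, only depends on the map
   x |-> m u(x) of Hom(P1, M), and vanishes on those that extend to P0. *)
Lemma tau_rigid_of M P1 P0 (d : {linear P1 -> P0}) (p : {linear P0 -> M}) :
  fin_dim M -> fin_dim P1 -> fin_dim P0 -> minimal_projective_presentation d p ->
  Dclass d M -> tau_rigid M.
Proof.
move=> fM f1 f0 mp DM; split=> //.
have [[pP0 _ _] [N [k [q0 [_ [pP1 _ _] _]]]]] := mp.
have sS : submod (fun u : star P1 => exists v : star P0, forall x, u x = v (d x)).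
  split; first by exists 0.
  by move=> a u v [u' hu] [v' hv]; exists (a *: u' + v') => x /=; rewrite hu hv.
have [X [q [qo qq]]] := quo_ex sS.
exists (dual X); first by exists X; [exists P1, P0, d, p, q | exists idfun; exists idfun].
move=> f m; apply/dualP => x; have [u <-] := qo x => {x}.
have [n [x1 [c1 b1]]] := dual_basis pP1 f1.
have [n0 [e [c0 b0]]] := dual_basis pP0 f0.
have uE : u = \sum_j (u (x1 j) : A) *: c1 j.
  apply/starP => x; rewrite star_sumE {1}(b1 x).
  have -> : u (\sum_i (c1 i x : A^c) *: x1 i) = \sum_i u ((c1 i x : A^c) *: x1 i).
    elim: (index_enum _) => [|i r IH]; rewrite ?big_nil ?big_cons ?starD ?IH //.
    by have := starZ u 0 0; rewrite scale0r mulr0.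
  by apply: eq_bigr => i _; rewrite starZ.
(* As M is in D_d, x |-> m u(x) extends to g on P0. Expanding in the dual basis of P0 leaves, for
   each i, the element [c0 i] restricted along d, which q kills. *)
have [g hg] := DM (mkl (star_lin u m)).
have hg1 x : (u x : A^c) *: m = \sum_i (c0 i (d x) : A^c) *: g (e i).
  rewrite -[LHS](mklE (star_lin u m)) -hg {1}(b0 (d x)) linear_sum.
  by apply: eq_bigr => i _; rewrite linearZ.
have fZ (a : A) (m' : M) y : f ((a : A^c) *: m') y = f m' (a *: y) by rewrite linearZ.
rewrite {1}uE linear_sum dual_lin_sum.
under eq_bigr => j _ do rewrite linearZ -fZ hg1 linear_sum.
have sumE l (F : 'I_l -> dual X) y : (\sum_i F i) y = \sum_i F i y.
  by elim/big_ind2: _ => // ? ? ? ? <- <-.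
under eq_bigr => j _ do rewrite sumE.
rewrite exchange_big big1 //= => i _.
under eq_bigr => j _ do rewrite linearZ /=.
have fs l (F : 'I_l -> X) (w : dual X) : \sum_j w (F j) = w (\sum_j F j).
  by rewrite dual_lin_sum.
rewrite fs (_ : \sum_j _ = 0); first exact: dual_0.
under eq_bigr => j _ do rewrite -linearZ.
rewrite -linear_sum; apply/qq; exists (c0 i) => x; rewrite star_sumE /= {2}(b1 x) linear_sum.
have -> : c0 i (\sum_j d ((c1 j x : A^c) *: x1 j)) = \sum_j c0 i (d ((c1 j x : A^c) *: x1 j)).
  elim: (index_enum _) => [|j r IH]; rewrite ?big_nil ?big_cons ?starD ?IH //.
  by have := starZ (c0 i) 0 0; rewrite scale0r mulr0.
by apply: eq_bigr => j _; rewrite linearZ starZ.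
Qed.
End Covers.

Section SpanIm.
Variable R : pzRingType.
Implicit Types (L M N X Y Z : lmodType R) (C : subcat R).

(** A variant of [tr] for a prescribed family H of maps: a class of modules alone cannot single out
    the non-invertible maps. *)
Inductive spim X (H : forall N, {linear N -> X} -> Prop) : X -> Prop :=
| spim_0 : spim H 0
| spim_D N (h : {linear N -> X}) m x : H N h -> spim H x -> spim H (h m + x).

Lemma spim_in X (H : forall N, {linear N -> X} -> Prop) N (h : {linear N -> X}) m :
  H N h -> spim H (h m).
Proof. by move=> Hh; rewrite -[h m]addr0; apply: spim_D => //; apply: spim_0. Qed.

Lemma spim_min X (H : forall N, {linear N -> X} -> Prop) (S : X -> Prop) : submod S ->
  (forall N (h : {linear N -> X}), H N h -> forall m, S (h m)) -> forall x, spim H x -> S x.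
Proof.
by move=> sS HS x; elim=> [|N h m y Hh _ IH]; [apply: (sm0 sS)|apply: (smD sS) => //; apply: HS].
Qed.

Lemma spim_submod X (H : forall N, {linear N -> X} -> Prop) : submod (spim H).
Proof.
split; first exact: spim_0.
have add x y : spim H x -> spim H y -> spim H (x + y).
  by elim=> [|N h m z Hh _ IH] hy; rewrite ?add0r // -addrA; apply: spim_D => //; apply: IH.
move=> a x y hx hy; apply: add => //.
elim: hx => [|N h m z Hh _ IH]; first by rewrite scaler0; apply: spim_0.
by rewrite scalerDr -linearZ; apply: spim_D.
Qed.

Lemma spim_gen X C (H : forall N, {linear N -> X} -> Prop) Y (k : {linear Y -> X}) :
  (forall N (h : {linear N -> X}), H N h -> C N) -> injective k ->
  (forall x, spim H x <-> exists y, k y = x) -> gen C Y.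
Proof.
move=> HC ki kp y; suff HH (x : X) : spim H x -> forall y, k y = x -> tr C y.
  by apply: (HH (k y)) => //; apply/kp; exists y.
elim=> [|N h m z Hh hz IH] {}y e.
  by have ->: y = 0 by [apply: ki; rewrite e linear0]; apply: tr_0.
have /kp [y2 e2] := hz; have [|h' hh] := @fact_sub _ _ _ _ k h ki.
  by move=> w; apply/kp; apply: spim_in.
have -> : y = h' m + y2 by apply: ki; rewrite e linearD hh e2.
by apply: tr_D; [apply: HC Hh|apply: IH].
Qed.

Definition isob X Y (f : X -> Y) := injective f /\ onto f.

Lemma isob_comp X Y Z (f : X -> Y) (g : Y -> Z) : isob f -> isob g -> isob (g \o f).
Proof.
move=> [fi fo] [gi go]; split=> [x y /gi /fi //|z].
by have [y <-] := go z; have [x <-] := fo y; exists x.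
Qed.

Lemma isoP M N : lmod_iso M N <-> exists f : {linear M -> N}, isob f.
Proof. by split=> -[f fb]; exists f; apply/bijP. Qed.

Lemma iso_sym M N : lmod_iso M N -> lmod_iso N M.
Proof.
move=> /isoP[f [fi fo]]; have [g [gf fg]] := lin_inv fi fo; apply/isoP; exists g.
by split=> [x y e|x]; [rewrite -[x]fg e fg | exists (f x)].
Qed.

Lemma iso_trans L M N : lmod_iso L M -> lmod_iso M N -> lmod_iso L N.
Proof. by move=> /isoP[f fb] /isoP[g gb]; apply/isoP; exists (g \o f); exact: (isob_comp fb gb). Qed.
End SpanIm.

Section Functional.
Variable (K : fieldType).

(** V may have infinite dimension. By Zorn there is a subspace S maximal among those avoiding x0;
    maximality gives V = S + K x0, and d is the coefficient of x0. *)
Lemma functional_ex (V : lmodType K) (x0 : V) : x0 != 0 ->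
  exists d : V -> K, (forall c x y, d (c *: x + y) = c * d x + d y) /\ d x0 = 1.
Proof.
move=> x00.
pose good (S : V -> Prop) := submod S /\ ~ S x0.
pose T := {S : V -> Prop | good S}.
pose le (s t : T) := `[< forall x, sval s x -> sval t x >].
have gz : good (fun x => x = 0).
  split; last by move/eqP; rewrite (negbTE x00).
  by split=> // a x y -> ->; rewrite scaler0 addr0.
have [||||[S [sS nS]] mx] := @classical_sets.Zorn T le.
- by move=> t; apply/asboolP.
- by move=> r s t /asboolP rs /asboolP st; apply/asboolP => x /rs /st.
- move=> [s ps] [t pt] /asboolP st /asboolP ts; apply: eq_exist => /=.
  by apply/funext => x; apply/propext; split; [apply: st|apply: ts].
- move=> F tot; have [[t0 Ft0]|nF] := pselect (exists t, F t); last first.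
    by exists (exist _ _ gz) => s Fs; case: nF; exists s.
  pose W x := exists2 t, F t & sval t x.
  have gW : good W.
    split; last by case=> -[t [st nt]] _ /nt.
    split; first by exists t0 => //; apply: (sm0 (svalP t0).1).
    move=> a x y [s Fs sx] [t Ft ty]; case: (tot _ _ Fs Ft) => /asboolP le'.
      by exists t => //; apply: (svalP t).1.2 => //; apply: le'.
    by exists s => //; apply: (svalP s).1.2 => //; apply: le'.
  by exists (exist _ _ gW) => s Fs; apply/asboolP => x sx; exists s.
have dec x : exists c, S (x - c *: x0).
  apply: contrapT => nx.
  pose W y := exists c s, S s /\ y = s + c *: x.
  have sW : submod W.
    split; first by exists 0, 0; rewrite scale0r addr0; split=> //; apply: (sm0 sS).
    move=> a _ _ [c [s [Ss ->]]] [c' [s' [Ss' ->]]].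
    exists (a * c + c'), (a *: s + s'); split; first exact: sS.2.
    by rewrite scalerDr scalerDl scalerA addrACA.
  have SW y : S y -> W y by exists 0, y; rewrite scale0r addr0.
  have Wx : W x by exists 1, 0; rewrite scale1r add0r; split=> //; apply: (sm0 sS).
  have nSx : ~ S x by move=> Sx; apply: nx; exists 0; rewrite scale0r subr0.
  have [[c [s [Ss e]]]|nW] := pselect (W x0).
    have c0 : c != 0 by apply/eqP => c0; apply: (nS); rewrite e c0 scale0r addr0.
    apply: nx; exists c^-1; rewrite {1}e scalerDr scalerA mulVf // scale1r.
    by rewrite opprD addrCA subrr addr0; apply: (smN sS); apply: (smZ sS).
  have : sval (exist _ W (conj sW nW) : T) = S.
    by rewrite (mx (exist _ W (conj sW nW))) //; apply/asboolP.
  by move=> /= e; apply: nSx; rewrite -e.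
pose d x := sval (cid (dec x)); have hd x : S (x - d x *: x0) by rewrite /d; case: cid.
have du x c : S (x - c *: x0) -> d x = c.
  move=> h; apply/eqP; rewrite -subr_eq0; apply/negPn/negP => n0; apply: (nS).
  have := smB sS h (hd x); rewrite opprB addrC subrKA -scalerBl.
  by move/(smZ sS (d x - c)^-1); rewrite scalerA mulVf // scale1r.
exists d; split=> [c x y|]; last by apply: du; rewrite scale1r subrr; apply: (sm0 sS).
apply: du; rewrite scalerDl -scalerA opprD addrACA -scalerBr.
exact: sS.2.
Qed.

Lemma functional_sep (V : lmodType K) (S : V -> Prop) (x0 : V) : submod S -> ~ S x0 ->
  exists d : V -> K, [/\ forall c x y, d (c *: x + y) = c * d x + d y,
    forall x, S x -> d x = 0 & d x0 = 1].
Proof.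
move=> sS nS; have [Q [p [po pp]]] := quo_ex sS.
have [|d [dl d1]] := @functional_ex Q (p x0).
  by apply/eqP => /pp.
exists (fun x => d (p x)); split=> // [c x y|x Sx]; first by rewrite linearP dl.
have d0 : d 0 = 0.
  by have := dl (- 1) 0 0; rewrite scaler0 addr0 mulN1r addNr.
by have /pp -> := Sx.
Qed.
End Functional.

(** * Endomorphism rings of finite dimensional indecomposable modules *)

Section LocalEndo.
Variables (K : closedFieldType) (A : falgType K).
Implicit Types M N X Y : lmodType A^c.

Section OneModule.
Variables (X : lmodType A^c) (fX : fin_dim X) (iX : indecomposable X).
Implicit Types f g : {linear X -> X}.

Lemma nb_1sub f : ~ isob f ->
  exists g : {linear X -> X}, (forall x, g (x - f x) = x) /\ forall x, g x - f (g x) = x.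
Proof. by move=> nf; case: (indec_endo f fX iX) => [//|[k /nilp_1sub]]. Qed.

Lemma nb_compl f g : ~ isob f -> ~ isob (g \o f).
Proof.
move=> nf [gfi gfo]; apply: nf; have fi : injective f by move=> x y e; apply: gfi; rewrite /= e.
by split=> //; apply: cohopf.
Qed.

(** If v inverts f + g, then v g = 1 - v f, where v f is nilpotent by Fitting, so v g would be
    invertible. Thus End X is local. *)
Lemma nb_add f g : ~ isob f -> ~ isob g -> ~ isob (f \+ g).
Proof.
move=> nf ng [ui uo]; have [v [vu uv]] := lin_inv ui uo.
have [w [w1 w2]] := nb_1sub (@nb_compl f v nf).
have vg x : v (g x) = x - v (f x) by rewrite -{2}(vu x) /= linearD addrAC subrr add0r.
apply: (@nb_compl g v ng); split=> [x y /= e|x].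
  by rewrite -(w1 x) -(w1 y) /= -!vg e.
by exists (w x); rewrite /= vg; apply: w2.
Qed.

Lemma nb_zero f : (forall x, f x = 0) -> ~ isob f.
Proof.
move=> f0 [fi _]; have [[x x0] _] := iX.
by move: x0; rewrite (fi x 0) ?eqxx // !f0.
Qed.

Lemma nb_scale c f : ~ isob f -> ~ isob (kscale X c \o f).
Proof. exact: nb_compl. Qed.

(** The vector p(f) v. The number N of terms is separate from [size p] so that q and (X - r) q can
    be compared over one range. *)
Definition peval f (v : X) (N : nat) (p : {poly K}) : kmod X :=
  \sum_(i < N) p`_i *: (epow f i v : kmod X).

Lemma pevalE f v (N : nat) (p : {poly K}) : (size p <= N)%N -> peval f v N p = peval f v (size p) p.
Proof.
move=> sN; rewrite /peval -!(big_mkord xpredT (fun i => p`_i *: (epow f i v : kmod X))).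
rewrite (big_cat_nat _ (n := size p)) //= [X in _ + X]big_nat_cond [X in _ + X]big1 ?addr0 //.
by move=> i /andP[/andP[h _] _]; rewrite nth_default // scale0r.
Qed.

Lemma peval_root f v (N : nat) r (q : {poly K}) : (size q < N)%N ->
  peval f v N (('X - r%:P) * q) = f (peval f v N q) - ks r (peval f v N q).
Proof.
case: N => // N; rewrite ltnS => qN.
have -> : peval f v N.+1 q = peval f v N q.
  by rewrite pevalE ?leqW // [RHS]pevalE.
have h x y : peval f v N.+1 (x - y) = peval f v N.+1 x - peval f v N.+1 y.
  by rewrite /peval -sumrB; apply: eq_bigr => i _; rewrite coefB scalerBl.
rewrite mulrBl h; congr (_ - _).
  rewrite /peval big_ord_recl coefXM /= scale0r add0r [RHS]linear_sum.
  by apply: eq_bigr => i _; rewrite coefXM /= ks_map.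
rewrite -[peval f v N q](_ : peval f v N.+1 q = _); last by rewrite pevalE ?leqW // [RHS]pevalE.
rewrite /peval ksE scaler_sumr; apply: eq_bigr => i _.
by rewrite coefCM scalerA.
Qed.

(* This is where K algebraically closed is used: End X = K + rad. *)
Lemma eigen f : exists c, ~ isob (f \- kscale X c).
Proof.
have [[v v0] _] := iX.
apply: contrapT => nc; have inj c : injective (f \- kscale X c).
  by have [] : isob (f \- kscale X c) by apply: contrapT => h; apply: nc; exists c.
have /fin_dimP[n [w sw]] := fX.
(* The n + 1 vectors v, f v, ..., f^n v lie in a space spanned by n vectors; a dependence is a
   nonzero polynomial p with p(f) v = 0. *)
have [c [[i ci] e]] := steinitz (v := w) (w := fun i : 'I_n.+1 => epow f i v : kmod X) sw (fun=> I) (ltnSn n).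
pose P (p : {poly K}) := (p != 0) && (peval f v (size p) p == 0).
have [p Pp] : exists p, P p.
  exists (\poly_(i < n.+1) c (inord i)); apply/andP; split.
    apply/eqP => /polyP /(_ i); rewrite coef_poly ltn_ord coef0 inord_val => h.
    by rewrite h eqxx in ci.
  rewrite -(@pevalE f v n.+1) ?size_poly //; apply/eqP; rewrite -[RHS]e.
  by apply: eq_bigr => j _; rewrite coef_poly ltn_ord inord_val.
have [m sm] : exists m, (size p <= m)%N by exists (size p).
(* All f - c being injective, linear factors can be removed from p one by one, until a nonzero
   constant would kill v. *)
elim: m p sm Pp => [|m IH] p; first by rewrite leqn0 size_poly_eq0 /P => ->.
move=> sm /andP[p0 /eqP pe].
have /closed_rootP [r /factor_theorem [q pq]] : size p != 1%N.
  apply/eqP => /eqP/size_poly1P [a a0 pa]; move: pe.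
  rewrite pa size_polyC a0 /peval big_ord1 coefC /= => /eqP; rewrite scaler_eq0 (negbTE a0) /=.
  by move=> h; rewrite (eqP h) eqxx in v0.
have q0 : q != 0 by apply: contraNneq p0 => q0; rewrite pq q0 mul0r.
have sq : size p = (size q).+1 by rewrite pq size_Mmonic ?monicXsubC // size_XsubC addn2.
apply: (IH q); first by rewrite -ltnS -sq.
apply/andP; split=> //; apply/eqP.
apply: (inj r); rewrite linear0.
rewrite -[RHS]pe /= mklE -(@pevalE f v (size p) q) ?sq //.
by rewrite -peval_root ?sq // mulrC -sq -pq.
Qed.

(** g = f_1 ... f_m g_0 with all f_i non-invertible; sums of such g form the m-th power of the
    radical of End X. *)
Fixpoint nbprod m g : Prop :=
  if m is m'.+1 then exists f g', [/\ ~ isob f, nbprod m' g' & forall x, g x = f (g' x)]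
  else True.

Lemma nbprod_compl m f g : nbprod m g -> nbprod m (f \o g).
Proof.
case: m => // m [f1 [g1 [nf ng e]]]; exists (f \o f1), g1; split=> //.
  exact: nb_compl.
by move=> x; rewrite /= e.
Qed.

Definition Jspan m (x : kmod X) :=
  exists n (g : 'I_n -> {linear X -> X}) (y : 'I_n -> X),
    (forall i, nbprod m (g i)) /\ x = \sum_i g i (y i).

Lemma Jspan_sub m : submod (Jspan m).
Proof.
have add x y : Jspan m x -> Jspan m y -> Jspan m (x + y).
  move=> [n [g [u [hg ->]]]] [n' [g' [u' [hg' ->]]]].
  exists (n + n')%N, (fun i => match fintype.split i with inl j => g j | inr j => g' j end),
    (fun i => match fintype.split i with inl j => u j | inr j => u' j end); split.
    by move=> i; case: fintype.split.
  rewrite big_split_ord; congr (_ + _); apply: eq_bigr => i _.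
    by rewrite (unsplitK (inl i)).
  by rewrite (unsplitK (inr i)).
split; first by exists 0%N, (fun=> idfun), (fun=> 0); split=> [[]//|]; rewrite big_ord0.
move=> a x y hx hy; apply: add => //.
move: hx => [n [g [u [hg ->]]]]; exists n, g, (fun i => ks a (u i)); split=> //.
by rewrite scaler_sumr; apply: eq_bigr => i _; rewrite ks_map.
Qed.

Lemma Jspan_endo m f x : Jspan m x -> Jspan m (f x).
Proof.
move=> [n [g [u [hg ->]]]]; exists n, (fun i => f \o g i), u; split.
  by move=> i; apply: nbprod_compl.
by rewrite linear_sum.
Qed.

Lemma nbprodS m g : nbprod m.+1 g -> nbprod m g.
Proof.
elim: m g => // m IH g [f [g' [nf hg e]]].
by exists f, g'; split=> //; apply: IH.
Qed.

(** Nakayama over End X, with radical J: choose m with J^m X = J^(m+1) X = S. If S is nonzero, take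
    a maximal proper End X-stable subspace Z of S, a non-invertible f and y in S with f y not in Z.
    Then Z + J y is stable and larger than Z, so it contains y; y = z + f' y with 1 - f' invertible
    forces y, hence f y, into Z. *)
Lemma nb_nilpotent : exists m, forall g, nbprod m g -> forall x, g x = 0.
Proof.
have /fin_dimP[n [w sw]] := fX.
have spw (S : kmod X -> Prop) : spans w S by move=> x _; apply: sw.
have [||S [m Sm] mn] := @submod_min _ (kmod X) n w (fun S => exists m, S = Jspan m).
- by move=> S [m ->]; split=> //; apply: Jspan_sub.
- by exists (Jspan 0), 0%N.
exists m; apply: contrapT => nz.
have JS x : S x -> Jspan m.+1 x.
  apply: (mn (Jspan m.+1)); first by exists m.+1.
  move=> y [n' [g [u [hg ->]]]]; rewrite Sm; exists n', g, u; split=> // i.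
  exact: nbprodS.
pose F (Z : kmod X -> Prop) := [/\ submod Z, forall f z, Z z -> Z (f z),
  forall z, Z z -> S z & exists2 s, S s & ~ Z s].
have [||Z [sZ eZ ZS [s Ss nZs]] mx] := @submod_max _ (kmod X) n w F.
- by move=> Z [].
- exists (fun z => z = 0); split.
  + by split=> // a x y -> ->; rewrite scaler0 addr0.
  + by move=> f z ->; rewrite linear0.
  + by move=> z ->; rewrite Sm; apply: (sm0 (Jspan_sub m)).
  + apply: contrapT => h; apply: nz => g hg x; apply: contrapT => gx; apply: h.
    exists (g x) => //; rewrite Sm; exists 1%N, (fun=> g), (fun=> x).
    by rewrite big_ord1.
have [f [y [nf Sy nZ]]] : exists f y, [/\ ~ isob f, S y & ~ Z (f y)].
  apply: contrapT => h; apply: nZs; have [n' [g [u [hg ->]]]] := JS s Ss.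
  apply: (sm_sum sZ) => i; have [f [g' [nf hg' ->]]] := hg i.
  apply: contrapT => nZ; apply: h; exists f, (g' (u i)); split=> //.
  by rewrite Sm; exists 1%N, (fun=> g'), (fun=> u i); rewrite big_ord1.
pose Z' z := exists z0 f', [/\ Z z0, ~ isob f' & z = z0 + f' y].
have sS : submod S by rewrite Sm; apply: Jspan_sub.
have eS f' z : S z -> S (f' z) by rewrite Sm; apply: Jspan_endo.
have Z'F : F Z' \/ forall s, S s -> Z' s.
  have [|h] := pselect (forall s, S s -> Z' s); [by right|left]; split.
  - split; first by exists 0, (zero_map X X); split; [exact: (sm0 sZ)|exact: nb_zero|rewrite addr0].
    move=> a _ _ [z1 [f1 [Z1 n1 ->]]] [z2 [f2 [Z2 n2 ->]]].
    exists (a *: z1 + z2), (kscale X a \o f1 \+ f2); split; first exact: sZ.2.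
      by apply: nb_add => //; apply: nb_scale.
    by rewrite scalerDr addrACA /= mklE.
  - move=> f' _ [z1 [f1 [Z1 n1 ->]]]; exists (f' z1), (f' \o f1).
    by split; [exact: eZ|exact: nb_compl|rewrite linearD].
  - by move=> _ [z1 [f1 [Z1 n1 ->]]]; apply: (smD sS); [apply: ZS|apply: eS].
  - apply: contrapT => h'; apply: h => s' Ss'; apply: contrapT => nZ'.
    by apply: h'; exists s'.
have ZZ' z : Z z -> Z' z.
  by move=> Zz; exists z, (zero_map X X); split=> //; [exact: nb_zero|rewrite addr0].
case: Z'F => [/mx h|/(_ y Sy)].
  apply: nZ; apply: (h ZZ'); exists 0, f; split=> //; [exact: (sm0 sZ)|by rewrite add0r].
move=> [z [f' [Zz nf' e]]].
have [g' [g'1 _]] := nb_1sub nf'.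
apply: nZ; apply: (eZ); rewrite -(g'1 y); apply: (eZ).
by rewrite {1}e addrK.
Qed.
End OneModule.

Lemma indec_split X Y (f : {linear Y -> X}) (w : {linear X -> Y}) :
  indecomposable Y -> (exists x : X, x != 0) -> (forall x, f (w x) = x) -> isob f /\ isob w.
Proof.
move=> [_ iY] [x0 x00] fw; have [N [k [[ki kf] iso]]] := retract_split fw.
have [zX|zN] := iY X N iso; first by rewrite (zX x0) eqxx in x00.
have fi : injective f.
  by apply: inj0 => y /kf [n <-]; rewrite (zN n) linear0.
split; first by split=> // x; exists (w x).
split=> [x y e|y]; first by rewrite -(fw x) e fw.
by exists (f y); apply: fi; rewrite fw.
Qed.

End LocalEndo.

(** * Finite dimensional silting modules *)

Section AddT.
Variables (K : closedFieldType) (A : falgType K).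
Implicit Types M N X Y Z P Q T U B I L E : lmodType A^c.

Definition inAdd T M := exists S : choiceType, retract M (copower S T).

Lemma inAdd_refl T : inAdd T T.
Proof.
exists bool; exists (cop_in T true), (cop_at T true) => x.
by rewrite cop_atE cop_inE eqxx.
Qed.

Lemma inAdd_retract T M N : retract N M -> inAdd T M -> inAdd T N.
Proof. by move=> rN [S rM]; exists S; apply: retract_trans rN rM. Qed.

Lemma inAdd_cop T (S : choiceType) : inAdd T (copower S T).
Proof. by exists S; apply: retract_refl. Qed.

Lemma inAdd_pair T M N : inAdd T M -> inAdd T N -> inAdd T (M * N)%type.
Proof.
move=> [S [i [r ri]]] [S' [i' [r' ri']]]; exists (S + S')%type.
pose j : {linear copower S T -> copower (S + S')%type T} :=
  cop_elim (fun a => cop_in T (inl a)).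
pose j' : {linear copower S' T -> copower (S + S')%type T} :=
  cop_elim (fun a => cop_in T (inr a)).
pose q : {linear copower (S + S')%type T -> copower S T} :=
  cop_elim (fun a => if a is inl b then cop_in T b else zero_map _ _).
pose q' : {linear copower (S + S')%type T -> copower S' T} :=
  cop_elim (fun a => if a is inr b then cop_in T b else zero_map _ _).
have qj x : q (j x) = x.
  by apply: (@cop_ext _ _ _ _ (q \o j) idfun) => a y; rewrite /= !cop_elimE.
have qj' x : q (j' x) = 0.
  by apply: (@cop_ext _ _ _ _ (q \o j') (zero_map _ _)) => a y; rewrite /= !cop_elimE.
have q'j x : q' (j x) = 0.
  by apply: (@cop_ext _ _ _ _ (q' \o j) (zero_map _ _)) => a y; rewrite /= !cop_elimE.
have q'j' x : q' (j' x) = x.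
  by apply: (@cop_ext _ _ _ _ (q' \o j') idfun) => a y; rewrite /= !cop_elimE.
exists (lcopair (j \o i) (j' \o i')), (lpair (r \o q) (r' \o q')) => -[x y].
rewrite lpairE /= !lcopairE /= !linearD qj qj' q'j q'j' ri ri' !linear0.
by rewrite addr0 add0r.
Qed.

Lemma inAdd_gen T M : inAdd T M -> Gen T M.
Proof.
move=> [S [i [r ri]]]; exists S, r => x; by exists (i x).
Qed.

Lemma gen_of_retract N M : retract N M -> gen (eq M) N.
Proof.
by move=> [i [r ri]] x; rewrite -(ri x); apply: tr_in.
Qed.

Lemma inAdd_lift P Q T (s : {linear P -> Q}) (p : {linear Q -> T}) M Y Z N
    (g : {linear Y -> Z}) (k : {linear N -> Y}) :
  projective_presentation s p -> inAdd T M -> onto g -> is_kernel k g -> Dclass s N ->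
  forall f : {linear M -> Z}, exists f' : {linear M -> Y}, forall t, g (f' t) = f t.
Proof.
move=> ps [S [i [r ri]]] go kg DN f.
have [f' hf'] := D_lift (cop_pres ps S) go kg (D_cop (I := S) DN) (f \o r).
by exists (f' \o i) => t; rewrite /= hf' /= ri.
Qed.

Lemma inAdd_D P Q T (s : {linear P -> Q}) (p : {linear Q -> T}) M P1 P0
    (d : {linear P1 -> P0}) (q : {linear P0 -> M}) :
  projective_presentation s p -> inAdd T M ->
  minimal_projective_presentation d q -> fin_dim P1 -> fin_dim P0 ->
  forall X, Dclass s X -> Dclass d X.
Proof.
move=> ps [S [i [r ri]]] md f1 f0 X DX.
apply: (D_retract (cop_pres ps S) ri md) => //; last exact: D_cop.
  by move=> e; apply: hopf.
by move=> e; apply: hopf.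
Qed.

Lemma fadd_lift (C : lmodType A^c -> Prop) M Y Z (g : {linear Y -> Z}) : fadd C M ->
  (forall N, C N -> forall f : {linear N -> Z}, exists f' : {linear N -> Y}, forall t, g (f' t) = f t) ->
  forall f : {linear M -> Z}, exists f' : {linear M -> Y}, forall t, g (f' t) = f t.
Proof.
move=> fM H; elim: fM => {M} [M zM|M CM|M N E _ IH1 _ IH2 iso] f.
- by exists (zero_map _ _) => t; rewrite (zM t) !linear0.
- exact: H.
have [[i [r ri]] _] := iso_retract iso.
pose fr : {linear (M * N)%type -> Z} := f \o r.
have [f1 h1] := IH1 (fr \o linl M N); have [f2 h2] := IH2 (fr \o linr M N).
pose f' : {linear (M * N)%type -> Y} := lcopair f1 f2.
have gf' u : g (f' u) = fr u.
  by case: u => a b; rewrite [f' _]lcopairE linearD [X in X + _]h1 [X in _ + X]h2 [in RHS]pair_sum [RHS]linearD.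
exists (f' \o i) => t; rewrite [LHS]gf'; congr (f _); exact: ri.
Qed.

Lemma fadd_gen (C : lmodType A^c -> Prop) M : fadd C M -> gen C M.
Proof.
elim=> {M} [M zM x|M CM|M N E _ IH1 _ IH2 iso x].
- by rewrite (zM x); apply: tr_0.
- exact: gen_self.
have [[i [r ri]] _] := iso_retract iso.
rewrite -(ri x) (surjective_pairing (i x)) pair_sum.
by rewrite linearD; apply: (smD (tr_submod _ _)); do 2 apply: tr_map.
Qed.

End AddT.

Section Silting.
Variables (K : closedFieldType) (A : falgType K).
Implicit Types M N X Y Z P Q U B I L E : lmodType A^c.
Variables (P Q T : lmodType A^c) (s : {linear P -> Q}) (p : {linear Q -> T}).
Hypotheses (ps : projective_presentation s p) (sG : Dclass s = Gen T) (fT : fin_dim T).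

Definition ind_add T M := [/\ fin_dim M, indecomposable M & inAdd T M].
Notation J := (ind_add T).

Lemma T_fadd : fadd J T.
Proof.
suff H M : fadd (fun N => [/\ indecomposable N, fin_dim N & retract N T]) M -> fadd J M.
  exact: H (krull_schmidt fT).
elim=> {M} [M zM|M [iM fM rM]|M N E _ IH1 _ IH2 iso].
- exact: fadd0.
- by apply: fadd1; split=> //; apply: inAdd_retract rM (inAdd_refl T).
- exact: faddD IH1 IH2 iso.
Qed.

Lemma silt_tors : tors (Gen T).
Proof. by apply: (Gen_tors ps) => X; rewrite sG. Qed.

Lemma GenJ X : Gen T X <-> gen J X.
Proof.
rewrite GenP; split; first by apply: gen_gen => M <-; apply: fadd_gen T_fadd.
by apply: gen_gen => M [_ _ /inAdd_gen/GenP].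
Qed.

Definition rad_gen X N (h : {linear N -> X}) := J N /\ ~ isob h.
(** This differs from the Jacobson radical of X: it is spanned by the images of the non-isomorphisms
    from indecomposables of Add T. So it lies in Gen T = D_s, and maps from Add T lift along the
    projection of X to its top. *)
Definition radX X := spim (@rad_gen X).

Lemma radX_Gen X Y (k : {linear Y -> X}) : injective k ->
  (forall x : X, radX x <-> exists y, k y = x) -> Gen T Y.
Proof. by move=> ki kp; apply/GenJ; apply: (spim_gen _ ki kp) => N h []. Qed.

Lemma rad_lift X B (b : {linear X -> B}) : onto b -> (forall x, b x = 0 <-> radX x) ->
  forall N, inAdd T N -> forall f : {linear N -> B}, exists f' : {linear N -> X}, forall t, b (f' t) = f t.
Proof.
move=> bo bk N aN f; have [Y [k [ki kp]]] := sub_ex (spim_submod (@rad_gen X)).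
apply: (inAdd_lift ps aN bo (k := k)); last by rewrite sG; apply: radX_Gen ki kp.
by split=> // x; rewrite bk; apply: kp.
Qed.

Definition is_top X B (b : {linear X -> B}) := onto b /\ forall x, b x = 0 <-> radX x.

Lemma top_ex X : exists B (b : {linear X -> B}), is_top b.
Proof. exact: quo_ex (spim_submod _). Qed.

(** If g : Y -> B is nonzero, some u : X1 -> Y from an indecomposable of Add T has g u nonzero. A
    lift th : X1 -> X of g u along b is an isomorphism, as otherwise b would kill it. So every map T
    -> B lifts to X and from there to Y, and Ker g is in D_s by [D_ker]. *)
Lemma top_afrak X B (b : {linear X -> B}) : J X -> is_top b -> afrak (Gen T) B.
Proof.
move=> JX [bo bk]; have aX : inAdd T X by case: JX.
have GB : Gen T B by apply: tors_onto bo _; [exact: silt_tors | apply: inAdd_gen].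
split=> // Y g GY N k kg; have [ki kp] := kg.
have kill M (h : {linear M -> X}) : J M -> ~ isob h -> forall m, b (h m) = 0.
  by move=> JM nh m; apply/bk; apply: spim_in.
have [g0|ng] := pselect (forall y, g y = 0).
  have ko : onto k by move=> y; apply/kp/g0.
  have [r [_ kr]] := lin_inv ki ko.
  apply: (tors_onto (f := r)) GY; first exact: silt_tors.
  by move=> n; exists (k n); apply: ki; rewrite kr.
have [X1 [u [JX1 [x1 gu]]]] : exists (X1 : lmodType A^c) (u : {linear X1 -> Y}), J X1 /\ exists x1, g (u x1) != 0.
  apply: contrapT => h; apply: ng => y; move/GenJ: GY => /(_ y).
  elim=> [|M u m z JM _ IH]; first by rewrite linear0.
  rewrite linearD IH addr0; apply/eqP/negPn/negP => gu; apply: h.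
  by exists M, u; split=> //; exists m.
have aX1 : inAdd T X1 by case: JX1.
have [th hth] := rad_lift bo bk aX1 (g \o u).
have [thi tho] : isob th.
  by apply: contrapT => nth; move: gu; rewrite -[g _]hth kill // eqxx.
have [v [_ thv]] := lin_inv thi tho.
rewrite -sG; apply: (D_ker ps kg); first by rewrite sG.
move=> f; have [f' hf'] := rad_lift bo bk (inAdd_refl T) f.
by exists (u \o v \o f') => t; rewrite /= -[g _]hth thv hf'.
Qed.

(** Suppose the C-torsion-free quotient N of T is nonzero. Among the nonzero h : X -> N with X
    indecomposable in Add T, one for which the subspace h Hom(T, X) of Hom(T, N) is minimal kills
    all radical maps, so it factors through the top of X, which is in C; this forces h = 0. *)
Lemma tops_generate (C : lmodType A^c -> Prop) : tors C ->
  (forall X B (b : {linear X -> B}), J X -> is_top b -> C B) -> C T.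
Proof.
move=> tC CB; have [T0 [k [N [q [[ki kq qo] CT0 perp]]]]] := tors_rad T tC.
have [q0|nq] := pselect (forall x, q x = 0).
  by apply: tors_onto CT0 => // x; apply/kq.
exfalso; have fN : fin_dim N := fd_onto qo fT.
have [m [v sv]] := fT.
have [l [w sw]] : exists n (w : 'I_n -> kmod (copower 'I_m N)), spans w (fun=> True).
  exact/fin_dimP/fd_cop.
(* Evaluation at a spanning family of T embeds Hom(T, N) into N^m, which has finite dimension. *)
pose ev (f : {linear T -> N}) : kmod (copower 'I_m N) := \sum_i cop_in N i (f (v i)).
have evi f i : ev f i = f (v i).
  rewrite /ev cop_sumE (bigD1 i) //= cop_inE eqxx big1 ?addr0 // => j.
  by rewrite cop_inE eq_sym => /negbTE ->.
have ev_inj f g : ev f = ev g -> f =1 g.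
  move=> e x; have [c ->] := sv x; rewrite !linear_sum; apply: eq_bigr => i _.
  by rewrite !linearZ -!evi e.
have ev_lin c (f g h : {linear T -> N}) : (forall x, h x = ks c (f x) + g x) ->
    ev h = c *: ev f + ev g.
  move=> e; apply/copowerP => i; rewrite -[RHS]/(ks c (ev f i) + ev g i).
  by rewrite !evi e.
pose Sh X (h : {linear X -> N}) (u : kmod (copower 'I_m N)) :=
  exists f : {linear T -> X}, u = ev (h \o f).
pose F S := exists (X : lmodType A^c) (h : {linear X -> N}), [/\ J X, exists x, h x != 0 & S = Sh X h].
have sSh X h : submod (Sh X h).
  split.
    exists (zero_map _ _); apply/copowerP => i; rewrite evi /= linear0 //.
  move=> a _ _ [f ->] [g ->]; exists ((kscale X a \o f) \+ g).
  by apply/esym/ev_lin => x; rewrite /= linearD mklE ks_map.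
have [||S [X [h [JX [x0 hx0] Se]]] mn] := @submod_min _ _ l w F.
- move=> S [X [h [_ _ ->]]]; split=> // x _; exact: sw.
- apply: contrapT => h; apply: nq => t.
  have := fadd_gen T_fadd t; elim=> [|M u y z JM _ IH]; first by rewrite linear0.
  rewrite linearD IH addr0; apply/eqP/negPn/negP => qu; apply: h.
  by exists (Sh M (q \o u)), M, (q \o u); split=> //; exists y.
have [fX iX aX] := JX.
(* By minimality h and h f define the same subspace; as X is a retract of a copower of T, this gives
   h = h e for an endomorphism e of X that factors through f. If e is invertible, f splits and is an
   isomorphism; if e is nilpotent, 1 - e is onto and h = 0. *)
have kill X' (f : {linear X' -> X}) : J X' -> ~ isob f -> forall x, h (f x) = 0.
  move=> JX' nf x; apply/eqP/negPn/negP => hf0.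
  have [fX' iX' aX'] := JX'.
  have sub : forall u, Sh X h u -> Sh X' (h \o f) u.
    move=> u; rewrite -{1}Se; apply: mn.
      by exists X', (h \o f); split=> //; exists x.
    by move=> u' [g ->]; rewrite Se; exists (f \o g).
  have [S' [i [r ri]]] := aX.
  have fact a : exists g : {linear T -> X'}, forall t, h (r (cop_in T a t)) = h (f (g t)).
    have /sub [g e] : Sh X h (ev (h \o (r \o cop_in T a))) by exists (r \o cop_in T a).
    by exists g; apply: ev_inj e.
  pose g a := sval (cid (fact a)).
  have hg a t : h (r (cop_in T a t)) = h (f (g a t)) by rewrite /g; case: cid.
  have hr y : h (r y) = h (f (cop_elim g y)).
    apply: (@cop_ext _ _ _ _ (h \o r) (h \o f \o cop_elim g)) => a t.
    by rewrite /= cop_elimE.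
  pose e := f \o (cop_elim g \o i); have he y : h (e y) = h y by rewrite /e /= -hr ri.
  case: (indec_endo e fX iX) => [[ei eo]|[k' /nilp_1sub[g' [_ g'2]]]].
    have [e' [_ ee']] := lin_inv ei eo; apply: nf.
    have [] // := @indec_split _ _ _ _ f (cop_elim g \o i \o e') iX' _ ee'.
    by exists x0; apply: contraNneq hx0 => ->; rewrite linear0.
  by move: hx0; rewrite -(g'2 x0) linearB he subrr eqxx.
have [B [b [bo bk]]] := top_ex X.
have [|h' hh'] := @fact_quo _ _ _ _ b h bo.
  move=> x /bk; apply: (spim_min (ker_submod h)) => M f [JM nf] y.
  exact: kill.
move: hx0; rewrite -hh' (perp B) ?eqxx //; exact: CB JX (conj bo bk).
Qed.

Lemma Gen_afrak : Gen T = tgen (afrak (Gen T)).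
Proof.
apply/funext => X; apply/propext; split=> [GX C tC aC|]; last first.
  by apply; [exact: silt_tors | move=> Y []].
have CT : C T by apply: tops_generate => // Y B b JY tb; apply: aC; exact: top_afrak JY tb.
apply: tC.1; move/GenP: GX; apply: gen_gen => M <-; exact: gen_self.
Qed.
End Silting.

(** * Torsion classes over a tau-tilting finite algebra *)

Section Descent.
Variables (K : closedFieldType) (A : falgType K).
Implicit Types M N X Y Z P Q U B I L E : lmodType A^c.

Section TopDescent.
Variables (P Q T : lmodType A^c) (s : {linear P -> Q}) (p : {linear Q -> T}).
Hypotheses (ps : projective_presentation s p) (sG : Dclass s = Gen T) (fT : fin_dim T).
Notation J := (ind_add T).
Variables (X B : lmodType A^c) (b : {linear X -> B}).
Hypotheses (JX : J X) (tb : is_top T b).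

(* Hom(X, Z) (rad End X)^m *)
Inductive HJ (Z : lmodType A^c) (m : nat) : {linear X -> Z} -> Prop :=
| HJ_0 (g : {linear X -> Z}) : (forall x, g x = 0) -> HJ m g
| HJ_D (g h : {linear X -> Z}) (f : {linear X -> X}) (g' : {linear X -> Z}) : nbprod m f -> HJ m g' ->
    (forall x, g x = h (f x) + g' x) -> HJ m g.

Lemma HJ_eq Z m (g g' : {linear X -> Z}) : g =1 g' -> HJ m g -> HJ m g'.
Proof.
move=> e hg; case: hg e => [g1 z e|g1 h f g2 pf hg2 e' e]; first by apply: HJ_0 => x; rewrite -e.
by apply: (HJ_D (h := h) pf hg2) => x; rewrite -e.
Qed.

Lemma HJ_add Z m (g1 g2 g : {linear X -> Z}) : HJ m g1 -> HJ m g2 ->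
  (forall x, g x = g1 x + g2 x) -> HJ m g.
Proof.
move=> h1 h2; elim: h1 g => {g1} [g1 z g e|g1 h f g' pf _ IH e g e'].
  by apply: HJ_eq h2 => x; rewrite e z add0r.
apply: (HJ_D (h := h) (f := f) (g' := g' \+ g2)) => //; first exact: IH.
by move=> x; rewrite e' e addrA.
Qed.

Lemma HJ_comp Z m (g : {linear X -> Z}) (f : {linear X -> X}) : nbprod m f -> HJ 1 g -> HJ m.+1 (g \o f).
Proof.
move=> pf; elim=> {g} [g z|g h f1 g' pf1 _ IH e].
  by apply: HJ_0 => x /=; rewrite z.
apply: (HJ_D (h := h) (f := f1 \o f) (g' := g' \o f)) => //=.
by have [f2 [f3 [nf2 _ e2]]] := pf1; exists f2, (f3 \o f); split=> //; case: JX => fX iX _; apply: nbprod_compl.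
Qed.

(** Nakayama for Hom(X, Z): if Hom(X, Z) rad End X were everything, so would be its products with
    higher powers of the radical, which vanish by [nb_nilpotent]. *)
Lemma HJ_proper Z (x0 : X) (h0 : {linear X -> Z}) : h0 x0 != 0 ->
  exists h : {linear X -> Z}, ~ HJ 1 h.
Proof.
move=> h00; have [fX iX _] := JX; apply: contrapT => al.
have all1 (h : {linear X -> Z}) : HJ 1 h by apply: contrapT => nh; apply: al; exists h.
have allm m (h : {linear X -> Z}) : HJ m h.
  elim: m h => [|m IH] h.
    by apply: (@HJ_D _ 0 h h idfun (zero_map _ _)) => // [|x]; [exact: HJ_0|rewrite /= addr0].
  elim: (IH h) => {h} [h z|h h1 f g pf _ IH' e]; first exact: HJ_0.
  exact: (HJ_add (HJ_comp pf (all1 h1)) IH').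
have [m nm] := nb_nilpotent fX iX.
move: h00; have z0 (h : {linear X -> Z}) : HJ m h -> forall x, h x = 0.
  by elim=> {h} [h z|h h1 f g pf _ IH e] x //; rewrite e (nm f pf) linear0 IH addr0.
by rewrite (z0 _ (allm m h0)) eqxx.
Qed.

(* A K-linear functional on Hom(X, Z), nonzero but killing Hom(X, Z) rad End X. *)
Lemma hom_functional Z (x0 : X) (h0 : {linear X -> Z}) : h0 x0 != 0 ->
  exists d : {linear X -> Z} -> K,
    [/\ forall (S : eqType) (r : seq S) (c : S -> K) (h : S -> {linear X -> Z})
          (f : S -> {linear X -> X}) (g : {linear X -> Z}),
          (forall i, ~ isob (f i \- kscale X (c i))) ->
          (forall x, g x = \sum_(i <- r) h i (f i x)) -> d g = \sum_(i <- r) c i * d (h i) &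
        exists h, d h = 1].
Proof.
move=> /HJ_proper [h1 nh1]; have [fX iX _] := JX; have [m [v sv]] := fX.
pose V := kmod (copower 'I_m Z).
pose ev (f : {linear X -> Z}) : V := \sum_i cop_in Z i (f (v i)).
have evi f i : ev f i = f (v i).
  rewrite /ev cop_sumE (bigD1 i) //= cop_inE eqxx big1 ?addr0 // => j.
  by rewrite cop_inE eq_sym => /negbTE ->.
have ev_inj f g : ev f = ev g -> f =1 g.
  move=> e x; have [c ->] := sv x; rewrite !linear_sum; apply: eq_bigr => i _.
  by rewrite !linearZ -!evi e.
have ev_lin c (f g h : {linear X -> Z}) : (forall x, h x = ks c (f x) + g x) ->
    ev h = c *: ev f + ev g.
  move=> e; apply/copowerP => i; rewrite -[RHS]/(ks c (ev f i) + ev g i).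
  by rewrite !evi e.
have ev0 (f : {linear X -> Z}) : (forall x, f x = 0) -> ev f = 0.
  by move=> z; rewrite (ev_lin (- 1) f f) ?scaleN1r ?addNr // => x; rewrite z /ks scaler0 addr0.
pose S (u : V) := exists g, HJ 1 g /\ u = ev g.
have sS : submod S.
  split; first by exists (zero_map _ _); split; [exact: HJ_0|rewrite ev0].
  move=> a _ _ [f [hf ->]] [g [hg ->]]; exists (kscale Z a \o f \+ g); split; last first.
    by apply/esym/ev_lin => x; rewrite /= mklE.
  apply: (HJ_add (g1 := kscale Z a \o f) (g2 := g)) => //.
  elim: hf => {f} [f z|f h f' g' pf _ IH e]; first by apply: HJ_0 => x /=; rewrite z linear0.
  by apply: (HJ_D (h := kscale Z a \o h) pf IH) => x; rewrite /= e linearD.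
have [|dl [dlin dS d1]] := @functional_sep K V S (ev h1) sS.
  by move=> [g [hg e]]; apply: nh1; apply: HJ_eq hg => x; apply/esym; apply: ev_inj e x.
have dl0 : dl 0 = 0 by apply: dS; apply: (sm0 sS).
exists (fun h => dl (ev h)); split; last by exists h1.
move=> S' r c h f g nf; elim: r g => [|i r IH] g e.
  by rewrite big_nil ev0 // => x; rewrite e big_nil.
pose g' : {linear X -> Z} := g \- (h i \o f i).
have eg' : dl (ev g') = \sum_(j <- r) c j * dl (ev (h j)).
  by apply: IH => x; rewrite /= e big_cons addrC addKr.
rewrite big_cons -eg'.
(* Modulo Hom(X, Z) rad End X, composing with [f i] is multiplication by [c i], since n is not
   invertible. *)
pose n := f i \- kscale X (c i).
have hn : HJ 1 (h i \o n).
  apply: (@HJ_D _ 1 _ (h i) n (zero_map _ _)); last by move=> x; rewrite /= addr0.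
    by exists n, idfun; split=> //; apply: nf.
  exact: HJ_0.
have -> : ev g = c i *: ev (h i) + (1 *: ev (h i \o n) + ev g').
  rewrite -(@ev_lin 1 (h i \o n) g' ((h i \o n) \+ g')); last first.
    by move=> x; rewrite /= /ks rmorph1 scale1r.
  apply: ev_lin => x; rewrite /= linearB mklE ks_map addrA.
  by rewrite [ks _ _ + _]addrC subrK addrC subrK.
by rewrite !dlin mul1r (dS (ev (h i \o n))) ?add0r //; exists (h i \o n).
Qed.

Definition ind_other N := J N /\ ~ lmod_iso X N.

(** Let W be the quotient of Z by the trace Y of the other indecomposables, and suppose W nonzero.
    Among the indecomposables of Add T only X maps nontrivially to W, so W is a quotient of X^(S)
    with S = Hom(X, W). The map psi : X^(S) -> B, equal to d(h) b on the summand h, kills the kernel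
    of X^(S) -> W; so B is a quotient of W and lies in C. *)
Lemma top_descent (C : lmodType A^c -> Prop) : tors C -> (forall Z, C Z -> Gen T Z) ->
  ~ C B -> forall Z, C Z -> gen ind_other Z.
Proof.
move=> tC CG nCB Z CZ; have [fX iX aX] := JX; have [bo bk] := tb.
have gJ Y : Gen T Y <-> gen J Y := GenJ fT Y.
have [Y [k [ki gY kp]]] := tr_ex ind_other Z.
have GY : Gen T Y by apply/gJ; apply: gen_gen gY => M [JM _]; apply: gen_self.
have [W [q [qo qq]]] := quo_ex (im_submod k).
have kq : is_kernel k q by split=> // z; rewrite qq.
have CW : C W by apply: tors_onto qo CZ.
have [W0|nW] := pselect (forall w : W, w = 0).
  by move=> z; apply/kp/qq/W0.
exfalso.
have other0 N (h : {linear N -> W}) : ind_other N -> forall n, h n = 0.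
  move=> oN n; have [[_ _ aN] _] := oN.
  have DY : Dclass s Y by rewrite sG.
  have [h' hh'] := inAdd_lift ps aN qo kq DY h.
  by rewrite -hh'; apply/qq/kp; apply: tr_in.
have GW : gen J W by apply/gJ/CG.
have [x0 [h0 h00]] : exists (x0 : X) (h0 : {linear X -> W}), h0 x0 != 0.
  apply: contrapT => h; apply: nW => w; elim: {w}(GW w) => // N u n z JN _ ->.
  rewrite addr0; have [iso|niso] := pselect (lmod_iso X N); last exact: other0.
  have /isoP[th [_ tho]] := iso; have [x <-] := tho n.
  by apply/eqP/negPn/negP => ux; apply: h; exists x, (u \o th).
have [d [dlin [h1 dh1]]] := hom_functional h00.
pose S : choiceType := {classic {linear X -> W}}.
pose pi : {linear copower S X -> W} := cop_elim (fun h : S => (h : {linear X -> W})).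
have piE (h : S) x : pi (cop_in X h x) = (h : {linear X -> W}) x by rewrite /pi cop_elimE.
pose psi : {linear copower S X -> B} := cop_elim (fun h : S => kscale B (d h) \o b).
have psiE (h : S) x : psi (cop_in X h x) = ks (d h) (b x) by rewrite /psi cop_elimE /= mklE.
clearbody pi psi.
have lift N : J N -> forall f : {linear N -> W}, exists f' : {linear N -> copower S X}, forall t, pi (f' t) = f t.
  move=> JN f; have [iso|niso] := pselect (lmod_iso X N).
    have /isoP[th [thi tho]] := iso; have [g [_ tg]] := lin_inv thi tho.
    exists (cop_in X (f \o th : S) \o g) => t; rewrite /= piE /= tg //.
  by exists (zero_map _ _) => t; rewrite other0 ?linear0.
(* Maps from J to W lift along pi, those from X because S contains all of them; so V is in Gen T by
   [D_ker], and psi only has to be tested on maps from J into V. *)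
have [V [kV kVpi]] := ker_ex pi.
have GV : Gen T V.
  rewrite -sG; apply: (D_ker ps kVpi).
    rewrite sG; apply/gJ; apply: (gen_gen _ (@gen_copower _ (eq X) S X erefl)) => M <-.
    exact: gen_self.
  exact: fadd_lift (T_fadd fT) lift.
(* The component of u at h is a scalar [c h] modulo the radical, so psi u is b times the sum of the
   [c h * d h], which is d (pi u) = 0. *)
have killX (u : {linear X -> copower S X}) : (forall x, pi (u x) = 0) -> forall x, psi (u x) = 0.
  move=> pu; pose c (h : S) := sval (cid (eigen fX iX (cop_at X h \o u))).
  have hc h : ~ isob ((cop_at X h \o u) \- kscale X (c h)) by rewrite /c; case: cid.
  have [m [v sv]] := fX.
  have [r ur hr] : exists2 r : seq S, uniq r & forall x h, h \notin r -> u x h = 0.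
    have H i : exists t : seq S, forall h, h \notin t -> u (v i) h = 0 := cop_supp (u (v i)).
    pose t i := sval (cid (H i)).
    have ht i h : h \notin t i -> u (v i) h = 0 by rewrite /t; case: cid => t' /= ht' /ht'.
    exists (undup (flatten [seq t i | i <- enum 'I_m])); first exact: undup_uniq.
    move=> x h; rewrite mem_undup => nh; have [a ->] := sv x.
    rewrite linear_sum -cop_atE linear_sum big1 // => i _.
    rewrite !linearZ cop_atE ht; first exact: scaler0.
    apply: contra nh => hi; apply/flattenP.
    by exists (t i) => //; apply: map_f; rewrite mem_enum.
  have uE x : u x = \sum_(h <- r) cop_in X h (u x h).
    apply/copowerP => h; rewrite cop_sumE; have [hr'|hr'] := boolP (h \in r).
      rewrite (bigD1_seq h) //= cop_inE eqxx big1 ?addr0 // => j.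
      by rewrite cop_inE eq_sym => /negbTE ->.
    rewrite hr // big_seq big1 // => j jr; rewrite cop_inE.
    by case: eqP => // e; rewrite e jr in hr'.
  have bc h x : b (u x h) = ks (c h) (b x).
    apply/eqP; rewrite -subr_eq0 -ks_map -linearB; apply/eqP/bk.
    have -> : u x h - ks (c h) x = ((cop_at X h \o u) \- kscale X (c h)) x.
      by rewrite /= cop_atE mklE.
    exact: (spim_in _ (conj JX (hc h))).
  move=> x; rewrite uE linear_sum.
  under eq_bigr => h _ do rewrite psiE bc.
  have := dlin _ r c (fun h : S => h : {linear X -> W}) (fun h => cop_at X h \o u) (pi \o u) hc.
  have -> : d (pi \o u) = 0.
    have := dlin S [::] c (fun h => h) (fun h => cop_at X h \o u) (pi \o u) hc.
    by rewrite big_nil; apply=> y; rewrite big_nil /= pu.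
  move=> e; have {}e : 0 = \sum_(h <- r) c h * d h.
    apply: e => y; rewrite /= {1}uE linear_sum; apply: eq_bigr => h _.
    by rewrite piE cop_atE.
  have sumks (l : seq S) : \sum_(h <- l) ks (d h) (ks (c h) (b x)) = ks (\sum_(h <- l) c h * d h) (b x).
    elim: l => [|h l IH]; first by rewrite !big_nil /ks rmorph0 scale0r.
    by rewrite !big_cons IH /ks !scalerA -scalerDl -!rmorphM -rmorphD mulrC.
  by rewrite sumks -e /ks rmorph0 scale0r.
(* For another indecomposable the components of u are non-isomorphisms into X, which b kills. *)
have kill N (u : {linear N -> copower S X}) : J N -> (forall n, pi (u n) = 0) -> forall n, psi (u n) = 0.
  move=> JN pu n; have [iso|niso] := pselect (lmod_iso X N).
    have /isoP[th [thi tho]] := iso; have [x <-] := tho n.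
    by apply: (killX (u \o th)) => y /=; apply: pu.
  have [r ->] := copE (u n); rewrite linear_sum big1 // => h _; rewrite psiE.
  rewrite (_ : b _ = 0) ?[ks _ 0]scaler0 //; apply/bk.
  rewrite -cop_atE; apply: (@spim_in _ _ _ _ (cop_at X h \o u)); split=> // ib.
  by apply: niso; apply/iso_sym/isoP; exists (cop_at X h \o u).
have psi0 y : pi y = 0 -> psi y = 0.
  have [_ kVp] := kVpi; move=> /kVp [v0 <-].
  have /gJ gV := GV; elim: {v0}(gV v0) => [|N u n z JN _ IH]; first by rewrite !linear0.
  rewrite !linearD IH addr0; apply: (kill _ (kV \o u)) => // n'.
  by apply/kVp; exists (u n').
have pio : onto pi.
  move=> w; elim: {w}(GW w) => [|N u n z JN _ [y <-]]; first by exists 0; rewrite linear0.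
  have [u' hu'] := lift N JN u; exists (u' n + y); by rewrite linearD hu'.
have [phi hphi] := fact_quo pio psi0.
apply: nCB; apply: (tors_onto (f := phi)) CW => // y; have [x <-] := bo y.
by exists (h1 x); rewrite -piE hphi psiE dh1 /ks rmorph1 scale1r.
Qed.
End TopDescent.
End Descent.

(** * Completion to a silting module with the same Gen *)

Section Completion.
Variables (K : closedFieldType) (A : falgType K).
Implicit Types M N X Y Z P Q T U B I L E : lmodType A^c.
Notation Areg := ((A^c)^o : lmodType A^c).

Lemma fd_zero : fin_dim (zero_mod A^c).
Proof. by exists 0%N, (fun=> 0) => x; exists (fun=> 0); rewrite big_ord0; apply: zero_mod0. Qed.

Lemma fin_sum T n (F : 'I_n -> lmodType A^c) (D : 'I_n -> Prop) :
  (forall i, D i -> fin_dim (F i) /\ inAdd T (F i)) ->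
  exists U, [/\ fin_dim U, inAdd T U, forall i, D i -> retract (F i) U &
    gen (fun N => exists2 i, D i & N = F i) U].
Proof.
elim: n F D => [|n IH] F D H.
  exists (zero_mod A^c); split=> [||[]//|x]; first exact: fd_zero.
    by exists bool, (zero_map _ _), (zero_map _ _) => x; apply/esym/zero_mod0.
  by rewrite (zero_mod0 x); apply: tr_0.
have [|U [fU aU rU gU]] := IH (fun i => F (lift ord0 i)) (fun i => D (lift ord0 i)).
  by move=> i; apply: H.
have gU' : gen (fun N => exists2 i, D i & N = F i) U.
  by apply: gen_gen gU => N [i Di ->]; apply: gen_self; exists (lift ord0 i).
have [D0|nD0] := pselect (D ord0); last first.
  by exists U; split=> // i; case: (unliftP ord0 i) => [j ->|-> //]; apply: rU.
have [fM aM] := H ord0 D0.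
exists (F ord0 * U)%type; split=> //.
- exact: fd_pair.
- exact: inAdd_pair.
- move=> i; case: (unliftP ord0 i) => [j ->|-> _].
    move=> /rU rN; apply: (retract_trans rN).
    exact: retract_inr.
  exact: retract_inl.
- case=> x u; rewrite pair_sum.
  apply: (smD (tr_submod _ _)); first by apply: tr_in; exists ord0.
  exact: tr_map.
Qed.

Lemma pres_pair P Q T P' Q' T' (s : {linear P -> Q}) (p : {linear Q -> T})
    (s' : {linear P' -> Q'}) (p' : {linear Q' -> T'}) :
  projective_presentation s p -> projective_presentation s' p' ->
  projective_presentation (lpair (s \o lfst P P') (s' \o lsnd P P'))
    (lpair (p \o lfst Q Q') (p' \o lsnd Q Q')).
Proof.
move=> [pP pQ sp po] [pP' pQ' sp' po']; split; [exact: proj_pair|exact: proj_pair| |].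
  case=> y y'; rewrite lpairE /=; split=> [[/sp [x <-] /sp' [x' <-]]|[[x x']]].
    by exists (x, x'); rewrite lpairE.
  by rewrite lpairE /= => -[<- <-]; congr pair; [apply/sp|apply/sp']; [exists x|exists x'].
by case=> t t'; have [x <-] := po t; have [x' <-] := po' t'; exists (x, x'); rewrite lpairE.
Qed.

Lemma D_pair P Q P' Q' (s : {linear P -> Q}) (s' : {linear P' -> Q'}) X :
  Dclass (lpair (s \o lfst P P') (s' \o lsnd P P')) X <-> Dclass s X /\ Dclass s' X.
Proof.
split=> [D|[D D'] f].
  split=> f.
    have [g hg] := D (f \o lfst P P'); exists (g \o linl Q Q') => x.
    by have := hg (x, 0); rewrite lpairE /= !linear0 linlE.
  have [g hg] := D (f \o lsnd P P'); exists (g \o linr Q Q') => x.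
  by have := hg (0, x); rewrite lpairE /= !linear0 linrE.
have [g hg] := D (f \o linl P P'); have [g' hg'] := D' (f \o linr P P').
exists (lcopair g g') => -[x x']; rewrite lpairE lcopairE /= hg hg' /= -linearD linlE linrE.
by congr (f _); congr pair; rewrite /= ?addr0 ?add0r.
Qed.

(* The cone of A -> d^m given by a lift of an element u0 of U^m. *)
Section Cone.
Variables (P0 Q0 U : lmodType A^c) (d : {linear P0 -> Q0}) (p : {linear Q0 -> U}).
Hypothesis ps : projective_presentation d p.
Variable y0 : Q0.
Definition cone_pres : {linear (P0 * Areg)%type -> Q0} := lcopair d (elt y0).

Lemma cone_pres_ex : exists (C : lmodType A^c) (c : {linear U -> C}),
  [/\ onto c, exact (elt (p y0)) c & projective_presentation cone_pres (c \o p)].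
Proof.
have [pP pQ dp po] := ps.
have [C [c [co cc]]] := quo_ex (im_submod (elt (p y0))).
exists C, c; split=> //; split=> //.
- by apply: proj_pair => //; apply: proj_reg.
- move=> y; rewrite /= cc; split=> [[a e]|[[x a] <-]].
    have /dp [x hx] : p (y - elt y0 a) = 0.
      by rewrite linearB -e !mklE linearZ subrr.
    by exists (x, a); rewrite /cone_pres lcopairE hx subrK.
  exists a; rewrite /cone_pres lcopairE linearD /= !mklE linearZ.
  by rewrite (_ : p (d x) = 0) ?add0r //; apply/dp; exists x.
- by move=> z; have [u <-] := co z; have [y <-] := po u; exists y.
Qed.

Lemma D_cone X : Dclass d X -> (Dclass cone_pres X <->
  forall x : X, exists g : {linear U -> X}, g (p y0) = x).
Proof.
have [pP pQ dp po] := ps; move=> DX; split=> [D x|H f].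
  have [g hg] := D (elt x \o lsnd P0 Areg).
  have [|g' hg'] := @fact_quo _ _ _ _ p g po.
    by move=> y /dp [z <-]; have := hg (z, 0); rewrite /cone_pres lcopairE /= !linear0 addr0.
  exists g'; rewrite hg'; have := hg (0, 1).
  by rewrite /cone_pres lcopairE /= linear0 add0r !elt1.
have [g hg] := DX (f \o linl P0 Areg).
have [g' hg'] := H (f (0, 1) - g y0).
exists (g \+ (g' \o p)) => -[x a]; rewrite /cone_pres lcopairE /= !linearD hg /=.
rewrite (_ : p (d x) = 0) ?linear0 ?add0r; last by apply/dp; exists x.
rewrite !mklE !linearZ hg' /= scalerBr addrA addrAC addrK -linearZ -linearD.
congr (f _); congr pair; rewrite /= ?add0r ?addr0 //; first by rewrite scaler0 addr0.
exact: mulr1.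
Qed.
End Cone.

(** So the element (v_i) of U^n gives a left Gen U-approximation A -> U^n. In a sum of values h(m),
    the coordinates of m in the v_i are absorbed into h, as scalars of K act by endomorphisms. *)
Lemma Gen_elt U n (v : 'I_n -> kmod U) X (x : X) : spans v (fun=> True) -> Gen U X ->
  exists g : {linear copower 'I_n U -> X}, g (\sum_i cop_in U i (v i)) = x.
Proof.
move=> sv /GenP /(_ x); elim=> {x} [|M h m z e _ [g <-]].
  by exists (zero_map _ _).
case: _ / e h m => h m; have [c ->] := sv m I.
exists (cop_elim (fun i => h \o kscale U (c i)) \+ g); rewrite /= !linear_sum; congr (_ + _).
by apply: eq_bigr => i _; rewrite cop_elimE /= mklE.
Qed.

(** The co-Bongartz completion U + C, with C the cokernel of the approximation A -> U^n. By [D_cone]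
    the class D of the sum of both presentations consists of the X in D_d all of whose elements are
    images of one element of U^n, which is Gen U. *)
Lemma completion P Q U (d : {linear P -> Q}) (p : {linear Q -> U}) :
  projective_presentation d p -> fin_dim U -> (forall X, Gen U X -> Dclass d X) ->
  exists P' Q' T (s : {linear P' -> Q'}), [/\ fin_dim T, silting_wrt T s & Gen T = Gen U].
Proof.
move=> pd fU GD; have /fin_dimP [n [v sv]] := fU.
have [pP pQ dp po] := pd.
have [y0 hy0] := cop_map_onto (I := 'I_n) po (\sum_i cop_in U i (v i)).
have [C [c [co cc pc]]] := cone_pres_ex (cop_pres pd 'I_n) y0.
have GC : gen (eq U) C by apply: gen_onto co _; apply: gen_copower.
have GT : Gen (U * C)%type = Gen U.
  apply/funext => X; apply/propext; rewrite !GenP; split; apply: gen_gen => M <-.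
    case=> u z; have -> : (u, z) = linl U C u + linr U C z.
      by rewrite linlE linrE; congr pair; rewrite /= ?addr0 ?add0r.
    by apply: (smD (tr_submod _ _)); [apply: tr_in|apply: tr_map].
  apply: (@gen_onto _ _ _ _ (lfst U C)); last exact: gen_self.
  by move=> u; exists (u, 0).
do 3 eexists; exists (lpair (d \o lfst _ _) (cone_pres (cop_map d) y0 \o lsnd _ _)).
split; last exact: GT.
  by apply: fd_pair => //; apply: fd_onto co _; apply: fd_cop.
split; first by eexists; apply: pres_pair pd pc.
rewrite GT; apply/funext => X; apply/propext; rewrite D_pair; split=> [[DX DcX]|GX].
  apply/GenP => x; have [h _] := D_cone (cop_pres pd 'I_n) y0 (D_cop (I := 'I_n) DX).
  have [g <-] := h DcX x; apply: tr_map; exact: gen_copower.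
have DX := GD X GX; split=> //.
apply/(D_cone (cop_pres pd 'I_n) y0 (D_cop (I := 'I_n) DX)) => x.
have [g <-] := Gen_elt x sv GX; exists g; congr (g _).
by rewrite -hy0.
Qed.
End Completion.

Section TorsionClasses.
Variables (K : closedFieldType) (A : falgType K) (tau_fin : tau_tilting_finite A).
Implicit Types M N X Y Z P Q T U B I L E : lmodType A^c.
Notation Areg := ((A^c)^o : lmodType A^c).

Lemma ind_add_tau P Q T (s : {linear P -> Q}) (p : {linear Q -> T}) M :
  projective_presentation s p -> Dclass s = Gen T -> ind_add T M -> tau_rigid M.
Proof.
move=> ps sG [fM iM aM]; have [P1 [P0 [d [q [md f1 f0]]]]] := min_pres_ex fM.
apply: (tau_rigid_of fM f1 f0 md); apply: (inAdd_D ps aM md f1 f0).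
by rewrite sG; apply: inAdd_gen.
Qed.

Lemma ind_add_iso T M N : lmod_iso M N -> ind_add T M -> ind_add T N.
Proof.
move=> iso [fM [[x x0] iM] aM]; have [rMN rNM] := iso_retract iso.
have [f [fi fo]] := (isoP M N).1 iso; split; first exact: fd_onto fo fM.
  split; first by exists (f x); rewrite -(linear0 f) (inj_eq fi).
  by move=> M1 M2 iso'; apply: iM; apply: iso_trans iso iso'.
exact: inAdd_retract rNM aM.
Qed.

Lemma tors_silting (C : lmodType A^c -> Prop) : tors C -> exists T, fd_silting T /\ C = Gen T.
Proof.
move=> tC; have [n [F hF]] := tau_fin.
(* The descent starts from Gen A, which is all of Mod-A. *)
have [P0 [Q0 [T0 [s0 [fT0 st0 GT0]]]]] : exists P Q T (s : {linear P -> Q}),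
    [/\ fin_dim T, silting_wrt T s & Gen T = Gen Areg].
  apply: (@completion _ _ _ _ Areg (zero_map (zero_mod A^c) Areg) idfun).
  - split; [exact: proj_zero|exact: proj_reg| |by move=> x; exists x].
    by move=> x; split=> [/= ->|[z <-]] //; exists 0.
  - exact: fd_reg.
  - by move=> X _ f; exists (zero_map _ _) => x; rewrite (zero_mod0 x) !linear0.
have CT0 Z : C Z -> Gen T0 Z.
  by rewrite GT0 => _; apply/GenP => z; rewrite -(elt1 z); apply: tr_in.
(* The measure is the number of listed modules in Gen T; the list contains every indecomposable
   tau-rigid module up to isomorphism. *)
pose m T := #|[set i | `[< Gen T (F i) >]]|.
have [k km] : exists k, (m T0 < k)%N by exists (m T0).+1.
elim: k P0 Q0 T0 s0 fT0 st0 km CT0 {GT0} => // k IH P Q T s fT [[p ps] sG] km CT.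
have [CTT|nCT] := pselect (C T).
  exists T; split; first by split=> //; exists P, Q, s; split=> //; exists p.
  apply/funext => Z; apply/propext; split=> [/CT //|/GenP gZ].
  by apply: tC.1; apply: gen_gen gZ => M <-; apply: gen_self.
have [X [B [b [JX tb nCB]]]] : exists X B (b : {linear X -> B}), [/\ ind_add T X, is_top T b & ~ C B].
  apply: contrapT => h; apply: nCT; apply: (tops_generate fT tC) => X B b JX tb.
  by apply: contrapT => nCB; apply: h; exists X, B, b.
have desc := top_descent ps sG fT JX tb tC CT nCB.
(* U is the sum of the listed representatives of the indecomposables of Add T other than X. *)
have [|U [fU aU rU gU]] := @fin_sum K A T n F (fun i => ind_other T X (F i)).
  by move=> i [[]].
have othU N : ind_other T X N -> gen (eq U) N.
  move=> [JN niso]; have [i iso] := hF N (ind_add_tau ps sG JN) (let: And3 _ iN _ := JN in iN).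
  have [rNi _] := iso_retract iso.
  apply: gen_of_retract; apply: (retract_trans rNi); apply: rU.
  split; first exact: ind_add_iso JN.
  by move=> iso'; apply: niso; apply: iso_trans iso' (iso_sym iso).
have [P1 [P2 [d [q [md f1 f2]]]]] := min_pres_ex fU.
have GUT Z : Gen U Z -> Gen T Z.
  by move=> /GenP gZ; apply/GenP; apply: gen_gen gZ => M <-; apply/GenP/inAdd_gen.
have [|P' [Q' [T' [s' [fT' st' GT']]]]] := completion (minpres_exact md) fU.
  by move=> Z /GUT; rewrite -sG; apply: (inAdd_D ps aU md f1 f2).
apply: (IH P' Q' T' s' fT' st'); last first.
  by move=> Z /desc gZ; rewrite GT'; apply/GenP; apply: gen_gen gZ.
(* The representative of X leaves the class: if it were in Gen U, X would be spanned by images of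
   other indecomposables, so X = [radX], and B = 0 would be in C. *)
have [i0 iso] := hF X (ind_add_tau ps sG JX) (let: And3 _ iX _ := JX in iX).
rewrite -ltnS; apply: leq_trans km; rewrite ltnS; apply: proper_card; apply/properP; split.
  by apply/subsetP => i; rewrite !inE => /asboolP; rewrite GT' => /GUT h; apply/asboolP.
have [rXF rFX] := iso_retract iso.
exists i0; rewrite inE; apply/asboolP.
  by apply: inAdd_gen; apply: inAdd_retract rFX _; case: JX.
rewrite GT' => /GenP gF; apply: nCB; apply: tC.1 => z; have [bo bk] := tb.
have [x <-] := bo z; rewrite (_ : b x = 0); first exact: tr_0.
apply/bk; have : gen (ind_other T X) X.
  apply: gen_gen (gen_of_retract rXF) => M <-; apply: gen_gen gF => M' <-.
  by apply: gen_gen gU => M2 [i oi ->]; apply: gen_self.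
move=> /(_ x); elim=> [|N h y z' [JN niso] _ IH']; first exact: spim_0.
apply: spim_D => //; split=> // hb; apply: niso; apply/iso_sym/isoP; by exists h.
Qed.
End TorsionClasses.

(** * Minimal approximations *)

Section Approx.
Variable R : pzRingType.
Implicit Types M N X Y Z P Q T U B I L E : lmodType R.

Definition perp M : subcat R := fun X => forall f : {linear M -> X}, f =1 \0.

Lemma Xclass_perp P Q T (s : {linear P -> Q}) (p : {linear Q -> T}) X :
  projective_presentation s p -> Xclass s X <-> Dclass s X /\ perp T X.
Proof.
case=> pP pQ sp po; split=> [H|[D pe] f].
  split=> [f|f t]; first by have [g [gf _]] := H f; exists g.
  have [g [_ u]] := H (zero_map P X); have [x <-] := po t.
  rewrite -[LHS]/((f \o p) x) (u (f \o p)); last first.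
    by move=> y /=; rewrite (_ : p (s y) = 0) ?linear0 //; apply/sp; exists y.
  by rewrite -(u (zero_map Q X)).
have [g gf] := D f; exists g; split=> // g' g'f x.
have [|h hh] := @fact_quo _ _ _ _ p (g' \- g) po.
  by move=> y /sp [z <-] /=; rewrite g'f gf subrr.
by apply/eqP; rewrite -subr_eq0 -[_ - _]/((g' \- g) x) -hh pe.
Qed.

(* x0 : T0 stands for the map R -> T0, r |-> r x0, a left minimal
   Gen T-approximation, with cokernel T1. *)
Lemma afrak_perp T T0 T1 (x0 : T0) (c : {linear T0 -> T1}) :
  tors (Gen T) -> Gen T T0 -> onto c -> exact (elt x0) c ->
  (forall X, Gen T X -> forall x : X, exists g : {linear T0 -> X}, g x0 = x) ->
  (forall e : {linear T0 -> T0}, e x0 = x0 -> onto e) ->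
  forall X, afrak (Gen T) X <-> Gen T X /\ perp T1 X.
Proof.
move=> tG G0 co ce ap mi X; split=> [[GX aX]|[GX pX]].
  (* The kernel of h c is in Gen T and contains x0, so some endomorphism k g of T0 with image in it
     fixes x0; by minimality it is onto, hence h c = 0. *)
  split=> // h y; have [z <-] := co y.
  have [N [k kk]] := ker_ex (h \o c); have GN := aX _ _ G0 _ _ kk.
  have [ki kp] := kk; have /kp [n kn] : (h \o c) x0 = 0.
    by rewrite /= (_ : c x0 = 0) ?linear0 //; apply/ce; exists 1; rewrite elt1.
  have [g gx] := ap _ GN n; have [|w] := mi (k \o g) _ z; first by rewrite /= gx.
  by move=> <-; apply/(kp (k (g w))); exists (g w).
(* An element of Ker g is h x0 for some h : T0 -> Y; g h kills x0, so it factors through T1 and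
   vanishes, and h lands in Ker g. *)
split=> // Y g GY N k [ki kg]; apply: tG.1 => n.
have [h hx] := ap _ GY (k n).
have gh z : g (h z) = 0.
  have [|f hf] := @fact_quo _ _ _ _ c (g \o h) co; last by rewrite -[LHS](hf z) pX.
  move=> w /ce [r <-]; rewrite /= mklE !linearZ hx (_ : g (k n) = 0).
    exact: scaler0.
  by apply/kg; exists n.
have [|h' hh'] := @fact_sub _ _ _ _ k h ki; first by move=> z; apply/kg.
have <- : h' x0 = n by apply: ki; rewrite hh'.
exact: tr_in.
Qed.

(** L is T0 modulo the trace N of T1. As N is in Gen T, hence in D_{s1}, a map T1 -> L lifts to T0,
    lands in N and is zero. Two maps agreeing at x0 differ by one that factors through T1, whence
    uniqueness. *)
Lemma perp_reflection T P1 Q1 T0 T1 (x0 : T0) (c : {linear T0 -> T1})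
    (s1 : {linear P1 -> Q1}) (q : {linear Q1 -> T1}) :
  tors (Gen T) -> Gen T T0 -> onto c -> exact (elt x0) c ->
  (forall X, Gen T X -> forall x : X, exists g : {linear T0 -> X}, g x0 = x) ->
  projective_presentation s1 q -> (forall X, Gen T X -> Dclass s1 X) ->
  exists L (l : {linear T0 -> L}), [/\ onto l, Gen T L /\ perp T1 L &
    forall X, Gen T X -> perp T1 X -> forall x : X, exists g : {linear L -> X}, g (l x0) = x /\
      forall g' : {linear L -> X}, g' (l x0) = x -> g' =1 g].
Proof.
move=> tG G0 co ce ap ps GD.
have [N [k [ki gN kp]]] := tr_ex (eq T1) T0.
have GN : Gen T N.
  apply: tG.1; apply: gen_gen gN => M <-; apply: gen_onto co _; exact: gen_self.
have [L [l [lo ll]]] := quo_ex (im_submod k).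
have kl : is_kernel k l by split=> // x; rewrite ll.
exists L, l; split=> //.
  split; first exact: tors_onto lo G0.
  move=> f t; have [f' hf'] := D_lift ps lo kl (GD _ GN) f.
  by rewrite -hf'; apply/ll/kp; apply: tr_in.
move=> X GX pX x; have [g gx] := ap _ GX x.
have [|g' hg'] := @fact_quo _ _ _ _ l g lo.
  move=> y /ll /kp; elim=> [|M h m z e _ IH]; first by rewrite linear0.
  by case: _ / e h m => h m; rewrite linearD IH addr0; apply: (pX (g \o h)).
exists g'; split=> [|g2 e2 y]; first by rewrite hg'.
have [z <-] := lo y.
have [|h hh] := @fact_quo _ _ _ _ c ((g2 \- g') \o l) co.
  by move=> w /ce [r <-]; rewrite mklE !linearZ /= e2 hg' gx subrr scaler0.
by apply/eqP; rewrite -subr_eq0 -[_ - _]/(((g2 \- g') \o l) z) -hh pX.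
Qed.
End Approx.

Section MinApprox.
Variables (K : closedFieldType) (A : falgType K).
Implicit Types M N X Y Z P Q U B I L E : lmodType A^c.
Notation Areg := ((A^c)^o : lmodType A^c).
Variables (P Q T : lmodType A^c) (s : {linear P -> Q}) (p : {linear Q -> T}).
Hypotheses (ps : projective_presentation s p) (sG : Dclass s = Gen T) (fT : fin_dim T).

(** T0 has least dimension among the modules of Add T with an element x0 that reaches every element
    of every module in Gen T. The Fitting image of an endomorphism fixing x0 is a summand that
    contains x0, so it has the same property and is everything. *)
Lemma min_approx : exists (T0 : lmodType A^c) (x0 : T0), [/\ fin_dim T0, inAdd T T0,
  forall X, Gen T X -> forall x : X, exists g : {linear T0 -> X}, g x0 = x &
  forall e : {linear T0 -> T0}, e x0 = x0 -> isob e].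
Proof.
pose ap (T0 : lmodType A^c) (x0 : T0) :=
  forall X, Gen T X -> forall x : X, exists g : {linear T0 -> X}, g x0 = x.
pose F n := `[< exists (T0 : lmodType A^c) (x0 : T0), [/\ fdn n T0, inAdd T T0 & ap T0 x0] >].
have exF : exists n, F n.
  have /fin_dimP[m [v sv]] := fT.
  have /fin_dimP[n fn] := fd_cop 'I_m fT.
  exists n; apply/asboolP; exists (copower 'I_m T), (\sum_i cop_in T i (v i)).
  split=> //; first exact: inAdd_cop.
  by move=> X GX x; apply: Gen_elt sv GX.
have [n /asboolP[T0 [x0 [fn a0 ap0]]] mn] := ex_minnP exF.
have f0 : fin_dim T0 by apply/fin_dimP; exists n.
exists T0, x0; split=> // e ex.
have [k [I [a [j [ao ji ja [r [rj _ _]]]]]]] := fitting e f0.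
have ek m : epow e m x0 = x0 by elim: m => //= m ->.
have jx : j (a x0) = x0 by rewrite ja ek.
have [m mn' [fI lt]] := fdn_sub ji fn.
have jo : onto j.
  apply: contrapT => /lt; rewrite ltnNge => /negP; apply; apply: mn.
  apply/asboolP; exists I, (a x0); split=> //.
    by apply: inAdd_retract a0; exists j, r.
  by move=> X GX x; have [g <-] := ap0 X GX x; exists (g \o j); rewrite /= jx.
have eo : onto e.
  move=> y; have [i <-] := jo y; have [z <-] := ao i; rewrite ja.
  by exists (epow e k z).
by split=> //; apply: hopf.
Qed.

Lemma min_silting_ex : exists (T0 P1 P0 T1 : lmodType A^c) (x0 : T0) (y0 : P0)
    (d : {linear P1 -> P0}) (q : {linear P0 -> T0}) (c : {linear T0 -> T1}),
  [/\ [/\ fin_dim T0, inAdd T T0, fin_dim P1 & fin_dim P0],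
      [/\ minimal_projective_presentation d q, q y0 = x0, onto c & exact (elt x0) c],
      forall X, Gen T X -> forall x : X, exists g : {linear T0 -> X}, g x0 = x,
      forall e : {linear T0 -> T0}, e x0 = x0 -> isob e &
      projective_presentation (cone_pres d y0) (c \o q) /\ Dclass (cone_pres d y0) = Gen T].
Proof.
have [T0 [x0 [f0 a0 ap0 mi0]]] := min_approx.
have [P1 [P0 [d [q [md f1 f2]]]]] := min_pres_ex f0.
have pd := minpres_exact md; have [_ _ _ qo] := pd.
have [y0 qy] := qo x0.
have [T1 [c [co ce pc]]] := cone_pres_ex pd y0.
exists T0, P1, P0, T1, x0, y0, d, q, c; split=> //; first by rewrite -qy.
split=> //; apply/funext => X; apply/propext; split=> [D|GX].
  have Dd : Dclass d X.
    move=> f; have [g hg] := D (f \o lfst P1 Areg); exists g => x.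
    by have := hg (x, 0); rewrite /cone_pres lcopairE /= linear0 addr0.
  apply/GenP => x; have [g] := (D_cone pd y0 Dd).1 D x; rewrite qy => <-.
  by apply: tr_map; have /GenP := inAdd_gen a0; apply.
have Dd : Dclass d X by apply: (inAdd_D ps a0 md f1 f2); rewrite sG.
apply/(D_cone pd y0 Dd) => x; rewrite qy; exact: ap0.
Qed.
End MinApprox.

(** * Ring epimorphisms and bireflective subcategories *)

Section AddEnd.
Variable V : zmodType.

(* Additive endomorphisms of V, composed in reading order. *)
Record aend := Aend { ae_fun :> V -> V; ae_add : {morph ae_fun : x y / x + y} }.
HB.instance Definition _ := gen_eqMixin aend.
HB.instance Definition _ := gen_choiceMixin aend.

Lemma aendP (u v : aend) : u =1 v -> u = v.
Proof.
case: u v => [u hu] [v hv] /= /funext uv; move: hu hv; rewrite uv => hu hv.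
by rewrite (Prop_irrelevance hu hv).
Qed.

Fact ae_zeroP : {morph (fun _ : V => 0 : V) : x y / x + y}. Proof. by move=> x y; rewrite addr0. Qed.
Fact ae_addP (u v : aend) : {morph (fun x => u x + v x) : x y / x + y}.
Proof. by move=> x y; rewrite !ae_add addrACA. Qed.
Fact ae_oppP (u : aend) : {morph (fun x => - u x) : x y / x + y}.
Proof. by move=> x y; rewrite ae_add opprD. Qed.
Fact ae_oneP : {morph (@id V) : x y / x + y}. Proof. by []. Qed.
Fact ae_mulP (u v : aend) : {morph (fun x => v (u x)) : x y / x + y}.
Proof. by move=> x y; rewrite !ae_add. Qed.
Definition ae_zero := Aend ae_zeroP.
Definition ae_plus u v := Aend (ae_addP u v).
Definition ae_opp u := Aend (ae_oppP u).
Definition ae_one := Aend ae_oneP.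
Definition ae_mul u v := Aend (ae_mulP u v).
Fact ae_addA : associative ae_plus. Proof. by move=> u v w; apply/aendP => x /=; rewrite addrA. Qed.
Fact ae_addC : commutative ae_plus. Proof. by move=> u v; apply/aendP => x /=; rewrite addrC. Qed.
Fact ae_add0 : left_id ae_zero ae_plus. Proof. by move=> u; apply/aendP => x /=; rewrite add0r. Qed.
Fact ae_addN : left_inverse ae_zero ae_opp ae_plus.
Proof. by move=> u; apply/aendP => x /=; rewrite addNr. Qed.
HB.instance Definition _ := GRing.isZmodule.Build aend ae_addA ae_addC ae_add0 ae_addN.
Fact ae_mulA : associative ae_mul. Proof. by move=> u v w; apply/aendP. Qed.
Fact ae_mul1 : left_id ae_one ae_mul. Proof. by move=> u; apply/aendP. Qed.
Fact ae_1mul : right_id ae_one ae_mul. Proof. by move=> u; apply/aendP. Qed.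
Fact ae_mulDl : left_distributive ae_mul +%R.
Proof. by move=> u v w; apply/aendP => x /=; rewrite ae_add. Qed.
Fact ae_mulDr : right_distributive ae_mul +%R.
Proof. by move=> u v w; apply/aendP. Qed.
HB.instance Definition _ := GRing.Zmodule_isPzRing.Build aend ae_mulA ae_mul1 ae_1mul ae_mulDl ae_mulDr.
End AddEnd.

Section MakeRMorphism.
Variables (R S : pzRingType) (f : R -> S).
Hypotheses (fB : zmod_morphism f) (fM : monoid_morphism f).
Definition mkr_fun of zmod_morphism f & monoid_morphism f := f.
HB.instance Definition _ := GRing.isZmodMorphism.Build R S (mkr_fun fB fM) fB.
HB.instance Definition _ := GRing.isMonoidMorphism.Build R S (mkr_fun fB fM) fM.
Definition mkr : {rmorphism R -> S} := mkr_fun fB fM.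
Lemma mkrE x : mkr x = f x. Proof. by []. Qed.
End MakeRMorphism.

Section RingEpi.
Variable A : pzRingType.
Implicit Types (f g : ring_from A) (X Z N Q M P E : lmodType A^c).

Notation rs f Y := (restr (opmap (rf_map f)) Y : lmodType A^c).
Notation Bc f := ((rf_cod f)^c).

Lemma rsE f (Y : lmodType (Bc f)) (a : A^c) (y : rs f Y) :
  a *: y = (rf_map f a : Bc f) *: (y : Y).
Proof. by []. Qed.

Lemma rs_lin f (Y Y' : lmodType (Bc f)) (h : {linear Y -> Y'}) :
  linear (h : rs f Y -> rs f Y').
Proof. by move=> a x y; apply: (linearP h (rf_map f a : Bc f)). Qed.
Definition rsmap f (Y Y' : lmodType (Bc f)) (h : {linear Y -> Y'}) : {linear rs f Y -> rs f Y'} :=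
  mkl (rs_lin h).

(* Two actions of B on Y + Y', conjugate under the automorphism (y, y') |->
   (y, y' + h y), agree on A, hence on B. *)
Lemma epi_lin f (Y Y' : lmodType (Bc f)) (h : {linear rs f Y -> rs f Y'}) :
  ring_epi f -> linear (h : Y -> Y').
Proof.
move=> epi; pose V : zmodType := (Y * Y')%type.
have hB (y z : Y) : h (y - z) = h y - h z := linearB h y z.
have g1 b : {morph (fun u : V => (((b : Bc f) *: u.1, (b : Bc f) *: u.2) : V)) : x y / x + y}.
  by move=> x y; rewrite /= !scalerDr.
have g2 b : {morph (fun u : V => (((b : Bc f) *: u.1,
    (b : Bc f) *: (u.2 - h u.1) + h ((b : Bc f) *: u.1)) : V)) : x y / x + y}.
  move=> x y; congr pair; rewrite /=; first by rewrite scalerDr.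
  rewrite [h (x.1 + y.1)](linearD h) opprD addrACA !scalerDr.
  by rewrite [h (_ + _)](linearD h) addrACA.
pose G1 b := Aend (g1 b); pose G2 b := Aend (g2 b).
have G1B : zmod_morphism (G1 : rf_cod f -> aend V).
  by move=> b c; apply/aendP => u; congr pair; rewrite /= scalerBl.
have G1M : monoid_morphism (G1 : rf_cod f -> aend V).
  split; first by apply/aendP => -[y y']; congr pair; rewrite /= scale1r.
  by move=> b c; apply/aendP => u; congr pair; rewrite /= scalerA.
have G2B : zmod_morphism (G2 : rf_cod f -> aend V).
  move=> b c; apply/aendP => u; congr pair; rewrite /= ?scalerBl //.
  by rewrite hB opprD addrACA.
have G2M : monoid_morphism (G2 : rf_cod f -> aend V).
  split; first by apply/aendP => -[y y']; congr pair; rewrite /= !scale1r // subrK.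
  move=> b c; apply/aendP => u; congr pair; rewrite /= ?scalerA //.
  by rewrite addrK scalerA.
have G12 a : mkr G1B G1M (rf_map f a) = mkr G2B G2M (rf_map f a).
  apply/aendP => u; congr pair; rewrite /=.
  have e : h ((rf_map f a : Bc f) *: u.1) = (rf_map f a : Bc f) *: (h u.1 : Y') :=
    linearZ_LR h (a : A^c) u.1.
  by rewrite e scalerBr subrK.
have eq12 := epi _ _ _ G12.
have hZ (b : Bc f) (y : Y) : h (b *: y) = b *: (h y : Y').
  have := congr1 (fun u : aend V => (u (y, 0)).2) (eq12 b) => /=.
  rewrite scaler0 sub0r scalerN => /esym/eqP; rewrite addrC subr_eq0 => /eqP ->.
  by [].
by move=> b x y; rewrite -hZ -[RHS]linearD.
Qed.
Definition epi_map f (Y Y' : lmodType (Bc f)) (h : {linear rs f Y -> rs f Y'}) (ef : ring_epi f) :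
  {linear Y -> Y'} := mkl (epi_lin h ef).

Lemma Xring_repl f : replete (Xring f).
Proof.
move=> M N iso [Y iso']; exists Y; apply: iso_trans iso'; exact: iso_sym.
Qed.

Lemma Xring_rs f (Y : lmodType (Bc f)) : Xring f (rs f Y).
Proof. by exists Y, idfun; exists idfun. Qed.

(** By [epi_lin] the map h becomes B-linear through the chosen isomorphisms, so its kernel can be
    formed over B; likewise for the cokernel below. *)
Lemma Xring_ker f X Z N (h : {linear X -> Z}) (k : {linear N -> X}) :
  ring_epi f -> is_kernel k h -> Xring f X -> Xring f Z -> Xring f N.
Proof.
move=> ef [ki kh] [Y /isoP[i [ii io]]] [Y' /isoP[j [ji jo]]].
have [i' [i1 i2]] := lin_inv ii io.
pose H := epi_map (j \o h \o i') ef.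
have [K [m [mi mh]]] := ker_ex H; exists K; apply/iso_sym/isoP.
have [|n hn] := @fact_sub _ _ _ _ k (i' \o rsmap m) ki.
  move=> x; apply/kh; rewrite /= mklE; apply: ji; rewrite linear0.
  have /mh : exists n, m n = m x by exists x.
  by rewrite /H /epi_map mklE.
exists n; split.
  apply: inj0 => x nx; have := hn x; rewrite nx linear0 /= mklE => /esym e.
  apply: mi; rewrite linear0; have := congr1 i e.
  by rewrite i2 linear0.
move=> y; have hy : H (i (k y)) = 0.
  rewrite /H /epi_map mklE /= i1 (_ : h (k y) = 0) ?linear0 //.
  by apply/kh; exists y.
have /mh [x xm] := hy; exists x; apply: ki; rewrite hn /= mklE xm i1 //.
Qed.

Lemma Xring_coker f X Z Q (h : {linear X -> Z}) (p : {linear Z -> Q}) :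
  ring_epi f -> onto p -> exact h p -> Xring f X -> Xring f Z -> Xring f Q.
Proof.
move=> ef po hp [Y /isoP[i [ii io]]] [Y' /isoP[j [ji jo]]].
have [i' [i1 i2]] := lin_inv ii io; have [j' [j1 j2]] := lin_inv ji jo.
pose H := epi_map (j \o h \o i') ef.
have HE x : H x = j (h (i' x)) by rewrite /H /epi_map mklE.
have [W [q [qo qq]]] := quo_ex (im_submod H); exists W; apply/iso_sym/isoP.
have [||t ht] := @fact_quo _ _ _ _ (rsmap q) (p \o j').
- by move=> w; have [y <-] := qo w; exists y; rewrite mklE.
- move=> y; rewrite mklE => /qq [x xy]; apply/hp; exists (i' x).
  by rewrite -xy HE j1.
exists t; split; last first.
  by move=> z; have [y <-] := po z; exists (rsmap q (j y)); rewrite ht /= j1.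
apply: inj0 => w; have [y <-] := qo w; rewrite -[q y](mklE (rs_lin q)) ht => /hp [x hx].
rewrite mklE; apply/qq; exists (i x); rewrite HE i1 hx j2 //.
Qed.

Lemma Xring_cop f (S : choiceType) X : Xring f X -> Xring f (copower S X).
Proof.
move=> [Y /isoP[i [ii io]]]; have [i' [i1 i2]] := lin_inv ii io.
exists (copower S Y); apply/isoP.
have tS (u : copower S X) : exists r : seq S, forall k, k \notin r -> (i (u k) : Y) = 0.
  by have [r hr] := cop_supp u; exists r => k /hr ->; rewrite linear0.
pose t (u : copower S X) : copower S Y := Copower (tS u).
have tl : linear (t : copower S X -> rs f (copower S Y)).
  by move=> a u v; apply/copowerP => k /=; rewrite linearP.
exists (mkl tl); split.
  apply: inj0 => u; rewrite mklE => e; apply/copowerP => k; apply: ii; rewrite linear0.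
  exact: (congr1 (fun v : copower S Y => v k) e).
move=> v; have vS : exists r : seq S, forall k, k \notin r -> i' (v k) = 0.
  have [r hr] := cop_supp v; exists r => k /hr ->; exact: (linear0 i').
exists (Copower vS); rewrite mklE; apply/copowerP => k /=; exact: i2.
Qed.

(** B is the reflection of the regular module A in X_B: by [epi_lin] the maps from B are B-linear,
    so they are determined at 1. *)
Lemma rightreg_ext f X (x : X) : ring_epi f -> Xring f X ->
  exists g : {linear rightreg f -> X}, g 1 = x /\
    forall g' : {linear rightreg f -> X}, g' 1 = x -> g' =1 g.
Proof.
move=> ef [Y /isoP[i [ii io]]]; have [i' [i1 i2]] := lin_inv ii io.
exists (i' \o rsmap (elt (i x : Y))); split=> [|g' g'1 b].
  by rewrite /= mklE elt1.
apply: ii; rewrite /= mklE i2.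
have := @reg_ext _ _ (epi_map (i \o g') ef) (elt (i x : Y)).
rewrite /epi_map mklE elt1 /= g'1 => /(_ erefl b).
by rewrite mklE.
Qed.

Lemma rightreg_uniq f X (g g' : {linear rightreg f -> X}) : ring_epi f -> Xring f X ->
  g 1 = g' 1 -> g =1 g'.
Proof.
move=> ef fX e; have [h [_ hu]] := rightreg_ext (g 1) ef fX.
by move=> b; rewrite (hu g) // (hu g').
Qed.

Lemma rightreg_scale f (a : A^c) (b : rightreg f) : a *: b = (b : rf_cod f) * rf_map f a.
Proof. by []. Qed.

(** The A-linear map h between the rings with h 1 = 1 is multiplicative: h(b c) and h(b) h(c) are
    A-linear in c and agree at c = 1. *)
Lemma epi_hom f g : ring_epi f -> Xring f (rightreg g) ->
  exists h : {rmorphism rf_cod f -> rf_cod g}, forall a, h (f a) = g a.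
Proof.
move=> ef fg; have [h [h1 hu]] := rightreg_ext (1 : rightreg g) ef fg.
have hM (b b' : rf_cod f) : h ((b * b')%R : rf_cod f) = (h b : rf_cod g) * (h b' : rf_cod g).
  have l1 : linear (fun c : rightreg f => h (b * (c : rf_cod f) : rf_cod f)).
    by move=> a x y; rewrite -linearP; congr (h _); rewrite !rightreg_scale mulrDr mulrA.
  have l2 : linear (fun c : rightreg f => ((h b : rf_cod g) * (h c : rf_cod g) : rightreg g)).
    by move=> a x y; rewrite linearP !rightreg_scale mulrDr mulrA.
  have := @rightreg_uniq f _ (mkl l1) (mkl l2) ef fg _ b'.
  by rewrite !mklE mulr1 h1 mulr1; apply.
have hB : zmod_morphism (h : rf_cod f -> rf_cod g) by move=> x y; apply: (linearB h).
have hMM : monoid_morphism (h : rf_cod f -> rf_cod g) by split.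
exists (mkr hB hMM) => a; rewrite mkrE.
have := linearZ_LR h (a : A^c) (1 : rightreg f).
by rewrite /= !rightreg_scale mul1r h1 mul1r.
Qed.

Lemma Xring_same_epiclass f g : ring_epi f -> ring_epi g -> Xring f = Xring g -> same_epiclass f g.
Proof.
move=> ef eg e.
have [|h hf] := epi_hom (g := g) ef; first by rewrite e; apply: Xring_rs.
have [|k kg] := epi_hom (g := f) eg; first by rewrite -e; apply: Xring_rs.
exists h; split=> // ; exists k.
  by apply: (ef _ (k \o h) idfun) => a /=; rewrite hf kg.
by apply: (eg _ (h \o k) idfun) => a /=; rewrite kg hf.
Qed.

Lemma same_epiclass_sub f g : same_epiclass f g -> forall X, Xring g X -> Xring f X.
Proof.
move=> [h [_ gh]] X [Y /isoP[i [ii io]]].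
exists (restr (opmap h) Y); apply/isoP.
have il : linear (i : X -> rs f (restr (opmap h) Y)).
  move=> a x y; rewrite linearP rsE; congr (_ + _).
  by rewrite rsE gh.
exists (mkl il); split=> [x y|y]; first by rewrite !mklE; apply: ii.
by have [x <-] := io y; exists x; rewrite mklE.
Qed.

Lemma same_epiclass_sym f g : same_epiclass f g -> same_epiclass g f.
Proof.
move=> [h [[k hk kh] gh]].
have kB : zmod_morphism k by move=> x y; apply: (can_inj hk); rewrite rmorphB !kh.
have kM : monoid_morphism k.
  by split=> [|x y]; apply: (can_inj hk); rewrite ?rmorph1 ?rmorphM !kh.
exists (mkr kB kM); split; first by exists h.
by move=> a; rewrite gh mkrE hk.
Qed.

Lemma same_epiclass_Xring f g : same_epiclass f g -> Xring f = Xring g.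
Proof.
move=> e; apply/funext => X; apply/propext; split; last exact: same_epiclass_sub.
exact/same_epiclass_sub/same_epiclass_sym.
Qed.
End RingEpi.

(* A subcategory with a reflection ld_mod of the regular module. *)
Record loc_data (A : pzRingType) := LocData {
  ld_cat : lmodType A^c -> Prop;
  ld_mod : lmodType A^c;
  ld_gen : ld_mod;
  ld_in : ld_cat ld_mod;
  ld_uni : forall X, ld_cat X -> forall x : X, exists g : {linear ld_mod -> X},
    g ld_gen = x /\ forall g' : {linear ld_mod -> X}, g' ld_gen = x -> g' =1 g
}.

Section LocRing.
Variables (A : pzRingType) (d : loc_data A).
Local Notation D := (ld_cat d).
Local Notation L := (ld_mod d).
Local Notation l0 := (ld_gen d).

Definition ext X (DX : D X) (x : X) : {linear L -> X} := sval (cid (ld_uni DX x)).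
Lemma ext1 X (DX : D X) (x : X) : ext DX x l0 = x.
Proof. by rewrite /ext; case: cid => g []. Qed.
Lemma ext_uniq X (DX : D X) (g g' : {linear L -> X}) : g l0 = g' l0 -> g =1 g'.
Proof.
move=> e; have [h [_ hu]] := ld_uni DX (g' l0).
by move=> y; rewrite (hu g) // (hu g').
Qed.
Lemma extE X (DX : D X) (g : {linear L -> X}) : g =1 ext DX (g l0).
Proof. by apply: (ext_uniq DX); rewrite ext1. Qed.
Lemma extD X (DX : D X) (x y : X) u : ext DX (x + y) u = ext DX x u + ext DX y u.
Proof.
by rewrite -[RHS]/((ext DX x \+ ext DX y) u) (extE DX (_ \+ _)) /= !ext1.
Qed.
Lemma ext_lin X Y (DX : D X) (DY : D Y) (h : {linear X -> Y}) x u :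
  h (ext DX x u) = ext DY (h x) u.
Proof. by rewrite -[LHS]/((h \o ext DX x) u) (extE DY (h \o _)) /= ext1. Qed.

Definition locR : Type := L.
HB.instance Definition _ := GRing.Zmodule.on locR.
(** The product of End L, transported along evaluation of endomorphisms at [ld_gen]. *)
Definition loc_mul (u v : locR) : locR := ext (ld_in d) u v.
Fact loc_mulA : associative loc_mul.
Proof. by move=> u v w; apply: (ext_lin (ld_in d) (ld_in d)). Qed.
Fact loc_mul1 : left_id (l0 : locR) loc_mul.
Proof. by move=> u; rewrite /loc_mul -(extE (ld_in d) idfun). Qed.
Fact loc_1mul : right_id (l0 : locR) loc_mul.
Proof. by move=> u; rewrite /loc_mul ext1. Qed.
Fact loc_mulDl : left_distributive loc_mul +%R.
Proof. by move=> u v w; rewrite /loc_mul extD. Qed.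
Fact loc_mulDr : right_distributive loc_mul +%R.
Proof. by move=> u v w; rewrite /loc_mul linearD. Qed.
HB.instance Definition _ := GRing.Zmodule_isPzRing.Build locR
  loc_mulA loc_mul1 loc_1mul loc_mulDl loc_mulDr.

Definition loc_map (a : A) : locR := (a : A^c) *: l0.
Fact loc_zmod : zmod_morphism loc_map.
Proof. by move=> a b; rewrite /loc_map scalerBl. Qed.
Fact loc_monoid : monoid_morphism loc_map.
Proof.
split=> [|a b]; first exact: scale1r.
by rewrite /loc_map [RHS]/GRing.mul /= /loc_mul linearZ /= ext1 scalerA.
Qed.
Lemma loc_scale (a : A^c) (u : L) : a *: u = ((u : locR) * loc_map a : locR).
Proof. by rewrite [RHS]/GRing.mul /= /loc_mul linearZ /= ext1. Qed.
Definition loc_ring : ring_from A := RingFrom (mkr loc_zmod loc_monoid).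

Section LocMod.
Variables (X : lmodType A^c) (DX : D X).
(** The proof of membership is a parameter because B acts on X through the extension of elements of
    X to maps L -> X. *)
Definition locM of D X : Type := X.
HB.instance Definition _ := GRing.Zmodule.on (locM DX).
Definition locM_scale (u : locR^c) (x : locM DX) : locM DX := ext DX x u.
Fact locM_scaleA a b x : locM_scale a (locM_scale b x) = locM_scale (a * b) x.
Proof. exact: esym (ext_lin (ld_in d) DX (ext DX x) b a). Qed.
Fact locM_scale1 : left_id 1 locM_scale. Proof. by move=> x; apply: ext1. Qed.
Fact locM_scaleDr : right_distributive locM_scale +%R.
Proof. by move=> a x y; apply: extD. Qed.
Fact locM_scaleDl x : {morph locM_scale^~ x : a b / a + b}.
Proof. by move=> a b; apply: linearD. Qed.
HB.instance Definition _ := GRing.Zmodule_isLmodule.Build locR^c (locM DX)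
  locM_scaleA locM_scale1 locM_scaleDr locM_scaleDl.
End LocMod.

Hypotheses (Drepl : replete D)
  (Dcok : forall (X Y Q : lmodType A^c) (f : {linear X -> Y}) (p : {linear Y -> Q}),
     onto p -> exact f p -> D X -> D Y -> D Q)
  (Dcop : forall (S : choiceType) (X : lmodType A^c), D X -> D (copower S X)).

Lemma loc_sub X : D X -> Xring loc_ring X.
Proof.
move=> DX; exists (locM DX); apply/isoP.
have il : linear (fun x : X => (x : restr (opmap (rf_map loc_ring)) (locM DX))).
  move=> a x y; congr (_ + _); rewrite rsE /= -[RHS]/(ext DX x (a *: l0)).
  by rewrite linearZ /= ext1.
by exists (mkl il); split=> [x y|y]; [rewrite !mklE|exists y; rewrite mklE].
Qed.

(** A B-module has a free presentation over B, and free B-modules restrict to copowers of L, which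
    are in D; so it is a cokernel of a map in D. *)
Lemma loc_sup X : Xring loc_ring X -> D X.
Proof.
move=> [Y iso]; apply: (Drepl (iso_sym iso)).
pose rY : lmodType A^c := restr (opmap (rf_map loc_ring)) Y.
have hl (y : Y) : linear (fun u : L => ((u : locR^c) *: y : rY)).
  move=> a u v; rewrite scalerDl; congr (_ + _).
  by rewrite rsE scalerA loc_scale.
pose pi : {linear copower Y L -> rY} := cop_elim (fun y => mkl (hl y)).
have piE y u : pi (cop_in L y u) = (u : locR^c) *: y by rewrite /pi cop_elimE mklE.
have DY : D (copower Y L) := Dcop Y (ld_in d).
(* pi is only A-linear by construction; its compatibility with the action of B makes its composite
   with h zero. *)
have act (z : copower Y L) u : pi (ext DY z u) = (u : locR^c) *: (pi z : Y).
  have [r ->] := copE z; elim: r => [|i r IH].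
    have z0 : ext DY 0 u = 0.
      by rewrite -[RHS]/(zero_map L _ u) (extE DY (zero_map L _)).
    by rewrite big_nil z0 linear0 scaler0.
  rewrite big_cons extD !linearD IH scalerDr; congr (_ + _).
  by rewrite -(ext_lin (ld_in d) DY (cop_in L i)) !piE scalerA.
pose S : choiceType := {classic {z : copower Y L | pi z = 0}}.
pose h : {linear copower S L -> copower Y L} := cop_elim (fun z : S => ext DY (sval z)).
apply: (@Dcok _ _ rY h pi) => //; last exact: Dcop (ld_in d).
  by move=> y; exists (cop_in L y l0); rewrite piE scale1r.
move=> z; split=> [pz|[w <-]].
  by exists (cop_in L (exist _ z pz : S) l0); rewrite /h cop_elimE ext1.
have [r ->] := copE w; rewrite !linear_sum big1 // => i _.
by rewrite /h cop_elimE act (svalP i) scaler0.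
Qed.

Lemma loc_Xring : Xring loc_ring = D.
Proof. by apply/funext => X; apply/propext; split; [apply: loc_sup|apply: loc_sub]. Qed.

(** If g and h agree on A, both are A-linear maps from L to C restricted along g, with the same
    value at 1; that module is in D, so they coincide. *)
Lemma loc_epi : ring_epi loc_ring.
Proof.
move=> C g h gh.
pose X : lmodType A^c := restr (opmap (rf_map loc_ring)) (restr (opmap g) C^c^o).
have DX : D X by apply/loc_sup/Xring_rs.
have gl : linear (fun u : L => (g u : X)).
  move=> a x y; rewrite (rmorphD g); congr (_ + _).
  by rewrite -[RHS]/(g x * g (loc_map a)) -rmorphM loc_scale.
have hl : linear (fun u : L => (h u : X)).
  move=> a x y; rewrite (rmorphD h); congr (_ + _).
  rewrite -[RHS]/(h x * g (loc_map a)) [g _](gh a) -rmorphM loc_scale.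
  by [].
have e := @ext_uniq _ DX (mkl gl) (mkl hl).
move=> u; have := e _ u; rewrite !mklE; apply.
by rewrite (rmorph1 g) (rmorph1 h).
Qed.
End LocRing.

Section Bireflective.
Variables (R : pzRingType).
Implicit Types (X Y L : lmodType R) (C : subcat R).

Lemma reflective_of C :
  (forall X, exists L (eta : {linear X -> L}), C L /\
    forall Y (f : {linear X -> Y}), C Y ->
      exists g : {linear L -> Y}, (forall x, g (eta x) = f x) /\
        forall g' : {linear L -> Y}, (forall x, g' (eta x) = f x) -> g' =1 g) ->
  reflective C.
Proof.
move=> H; pose L X := sval (cid (H X)).
have HL X : exists eta : {linear X -> L X}, C (L X) /\
    forall Y (f : {linear X -> Y}), C Y ->
      exists g : {linear L X -> Y}, (forall x, g (eta x) = f x) /\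
        forall g' : {linear L X -> Y}, (forall x, g' (eta x) = f x) -> g' =1 g := svalP (cid (H X)).
exists L, (fun X => sval (cid (HL X))); split=> [X|X Y f CY].
  by have [] := svalP (cid (HL X)).
by have [_] := svalP (cid (HL X)); apply.
Qed.

Lemma coreflective_of C :
  (forall X, exists L (eps : {linear L -> X}), C L /\
    forall Y (f : {linear Y -> X}), C Y ->
      exists g : {linear Y -> L}, (forall y, eps (g y) = f y) /\
        forall g' : {linear Y -> L}, (forall y, eps (g' y) = f y) -> g' =1 g) ->
  coreflective C.
Proof.
move=> H; pose L X := sval (cid (H X)).
have HL X : exists eps : {linear L X -> X}, C (L X) /\
    forall Y (f : {linear Y -> X}), C Y ->
      exists g : {linear Y -> L X}, (forall y, eps (g y) = f y) /\
        forall g' : {linear Y -> L X}, (forall y, eps (g' y) = f y) -> g' =1 g := svalP (cid (H X)).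
exists L, (fun X => sval (cid (HL X))); split=> [X|X Y f CY].
  by have [] := svalP (cid (HL X)).
by have [_] := svalP (cid (HL X)); apply.
Qed.
End Bireflective.

(* Hom_A(B, X), with the B-action (h b)(c) = h(b c). *)
Section Coinduced.
Variables (A : pzRingType) (f : ring_from A) (X : lmodType A^c).
Record coind := Coind { ci_fun :> rightreg f -> X; ci_lin : linear ci_fun }.
HB.instance Definition _ := gen_eqMixin coind.
HB.instance Definition _ := gen_choiceMixin coind.
Lemma coindP (u v : coind) : u =1 v -> u = v.
Proof.
case: u v => [u hu] [v hv] /= /funext uv; move: hu hv; rewrite uv => hu hv.
by rewrite (Prop_irrelevance hu hv).
Qed.
Lemma ciD (u : coind) x y : u (x + y) = u x + u y.
Proof. by have := ci_lin u 1 x y; rewrite !scale1r. Qed.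
Fact ci_zeroP : linear (fun _ : rightreg f => 0 : X).
Proof. by move=> a x y; rewrite scaler0 addr0. Qed.
Fact ci_addP (u v : coind) : linear (fun x => u x + v x).
Proof. by move=> a x y; rewrite !ci_lin scalerDr addrACA. Qed.
Fact ci_oppP (u : coind) : linear (fun x => - u x).
Proof. by move=> a x y; rewrite ci_lin opprD scalerN. Qed.
Fact ci_scaleP (b : (rf_cod f)^c) (u : coind) :
  linear (fun c : rightreg f => u ((b : rf_cod f) * (c : rf_cod f) : rf_cod f)).
Proof. by move=> a x y; rewrite -ci_lin; congr (u _); rewrite !rightreg_scale mulrDr mulrA. Qed.
Definition ci_zero := Coind ci_zeroP.
Definition ci_add u v := Coind (ci_addP u v).
Definition ci_opp u := Coind (ci_oppP u).
Definition ci_scale b u := Coind (ci_scaleP b u).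
Fact ci_addA : associative ci_add. Proof. by move=> u v w; apply/coindP => x /=; rewrite addrA. Qed.
Fact ci_addC : commutative ci_add. Proof. by move=> u v; apply/coindP => x /=; rewrite addrC. Qed.
Fact ci_add0 : left_id ci_zero ci_add. Proof. by move=> u; apply/coindP => x /=; rewrite add0r. Qed.
Fact ci_addN : left_inverse ci_zero ci_opp ci_add.
Proof. by move=> u; apply/coindP => x /=; rewrite addNr. Qed.
HB.instance Definition _ := GRing.isZmodule.Build coind ci_addA ci_addC ci_add0 ci_addN.
Fact ci_scaleA a b u : ci_scale a (ci_scale b u) = ci_scale (a * b) u.
Proof. by apply/coindP => x /=; rewrite mulrA. Qed.
Fact ci_scale1 : left_id 1 ci_scale.
Proof. by move=> u; apply/coindP => x /=; rewrite mul1r. Qed.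
Fact ci_scaleDr : right_distributive ci_scale +%R.
Proof. by move=> a u v; apply/coindP. Qed.
Fact ci_scaleDl u : {morph ci_scale^~ u : a b / a + b}.
Proof. by move=> a b; apply/coindP => x /=; rewrite -ciD mulrDl. Qed.
HB.instance Definition _ := GRing.Zmodule_isLmodule.Build (rf_cod f)^c coind
  ci_scaleA ci_scale1 ci_scaleDr ci_scaleDl.
End Coinduced.

Section XringBireflective.
Variables (A : pzRingType) (f : ring_from A) (ef : ring_epi f).
Implicit Types X : lmodType A^c.
Notation Bc := ((rf_cod f)^c).
Notation rs Y := (restr (opmap (rf_map f)) Y : lmodType A^c).

Lemma Xring_coreflective : coreflective (Xring f).
Proof.
apply: coreflective_of => X.
have el : linear (fun u : rs (coind f X) => (u : coind f X) 1).
  move=> a u v; rewrite -[LHS]/((u : coind f X) (rf_map f a * 1) + (v : coind f X) 1).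
  congr (_ + _); have := ci_lin (u : coind f X) a 1 0.
  have u0 : (u : coind f X) 0 = 0.
    by apply/eqP; rewrite -(inj_eq (addrI ((u : coind f X) 0))) -ciD !addr0.
  by rewrite !addr0 u0 addr0 rightreg_scale mulr1 mul1r.
exists (rs (coind f X)), (mkl el); split; first exact: Xring_rs.
move=> Y h [Y0 /isoP[i [ii io]]]; have [i' [i1 i2]] := lin_inv ii io.
have bl (y : Y0) : linear (fun b : rightreg f => h (i' ((b : Bc) *: y))).
  move=> a b c; rewrite scalerDl -!linearP; congr (h (i' (_ + _))).
  by rewrite [RHS]rsE scalerA.
pose g0 (y : Y0) : coind f X := Coind (bl y).
have g0l : linear g0.
  move=> a x y; apply/coindP => c /=; rewrite -!linearD scalerDr scalerA //.
exists (rsmap (mkl g0l) \o i); split=> [y|g' hg' y].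
  by rewrite /= !mklE /= scale1r i1.
pose G := epi_map (g' \o i') ef.
have GE x : G x = g' (i' x) by rewrite /G /epi_map mklE.
rewrite /= !mklE -{1}(i1 y) -GE; apply/coindP => c /=.
have -> : G (i y) c = ((c : Bc) *: G (i y)) 1 by rewrite /= mulr1.
by rewrite -linearZ GE -hg' mklE.
Qed.

(** The reflection is X (x)_A B, built as the free B-module on the set X modulo the relations that
    make x |-> x (x) 1 A-linear. *)
Lemma Xring_reflective : reflective (Xring f).
Proof.
apply: reflective_of => X; pose Breg : lmodType Bc := Bc^o.
pose F := copower X Breg; pose e (x : X) (b : Bc) : F := cop_in Breg x b.
pose rel (z : F) := exists (a : A^c) (x y : X), z = e (a *: x + y) 1 - ((rf_map f a : Bc) *: e x 1 + e y 1).
pose S (z : F) := forall S' : F -> Prop, submod S' -> (forall z, rel z -> S' z) -> S' z.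
have sS : submod S.
  split=> [S' sS' _|a x y Sx Sy S' sS' rS']; first exact: (sm0 sS').
  by apply: sS'.2; [apply: Sx|apply: Sy].
have [Q [p [po pp]]] := quo_ex sS.
have etal : linear (fun x : X => (p (e x 1) : rs Q)).
  move=> a x y; apply/eqP; rewrite -subr_eq0 rsE -linearP -linearB; apply/eqP/pp.
  by move=> S' _; apply; exists a, x, y.
exists (rs Q), (mkl etal); split; first exact: Xring_rs.
move=> Y h [Y0 /isoP[i [ii io]]]; have [i' [i1 i2]] := lin_inv ii io.
pose G : {linear F -> Y0} := cop_elim (fun x => elt (i (h x) : Y0)).
have GE x b : G (e x b) = b *: (i (h x) : Y0) by rewrite /G /e cop_elimE mklE.
have [|g hg] := @fact_quo _ _ _ _ p G po.
  move=> z /pp /(_ _ (ker_submod G)); apply => _ [a [x [y ->]]].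
  rewrite linearB linearD linearZ !GE !scale1r /=.
  by rewrite linearP linearP rsE subrr.
exists (i' \o rsmap g); split=> [x|g' hg' z].
  by rewrite /= !mklE hg GE scale1r i1.
apply: ii; rewrite /= mklE i2.
pose G' := epi_map (i \o g') ef.
have G'E x : G' x = i (g' x) by rewrite /G' /epi_map mklE.
rewrite -G'E; have [w <-] := po z; rewrite hg.
apply: (@cop_ext _ _ _ _ (G' \o p) G) => x b; rewrite -/(e x b) GE /=.
have -> : e x b = b *: e x 1 by rewrite /e -linearZ; congr (cop_in _ _ _); apply/esym/mulr1.
rewrite linearZ linearZ; congr (_ *: _).
by rewrite G'E -hg' mklE.
Qed.
End XringBireflective.

(** * Tensor products and universal localisation *)

Section TensorModule.
Variables (A : pzRingType) (f : ring_from A).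
Implicit Types M N P X : lmodType A^c.
Notation B := (rf_cod f).
Notation Bc := ((rf_cod f)^c).
Notation rs Y := (restr (opmap (rf_map f)) Y : lmodType A^c).
Local Notation lreg := (leftreg f).

Section Scale.
Variable M : lmodType A^c.
Definition tensB : Type := tensor M lreg.
HB.instance Definition _ := GRing.Zmodule.on tensB.
Definition tb_scale_seq (b : B) (s : seq (M * lreg)) : seq (M * lreg) :=
  [seq (q.1, (q.2 : B) * b : lreg) | q <- s].
Definition tb_scale (b : Bc) (t : tensB) : tensB :=
  tens_class (tb_scale_seq b (generic_quotient.repr (t : tensor M lreg))).

Lemma tb_scale_class b s : tb_scale b (tens_class s) = tens_class (tb_scale_seq b s).
Proof.
apply/tens_classP; have := repr_class s; move: (generic_quotient.repr _) => t.
elim=> {s t} [s t /(perm_map (fun q => (q.1, (q.2 : B) * b : lreg))) st|s t _|s t u _ st _ tu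
  |s t u _ st|n|m m' n|m n n'|a m n] /=.
- exact: tens_perm.
- exact: tens_sym.
- exact: tens_trans st tu.
- by rewrite /tb_scale_seq !map_cat; apply: tens_cat.
- exact: tens_0l.
- exact: tens_Dl.
- by rewrite mulrDl; apply: tens_Dr.
- have -> : (a *: n : lreg) * b = a *: ((n : B) * b : lreg) :> B.
    exact: esym (mulrA (rf_map f a) (n : B) b).
  exact: tens_mul.
Qed.

Definition tb (m : M) (b : B) : tensB := tens_class [:: (m, b : lreg)].
Lemma tb_ind (Pr : tensB -> Prop) : Pr 0 ->
  (forall m b t, Pr t -> Pr (tb m b + t)) -> forall t, Pr t.
Proof.
move=> P0 PD t; rewrite -[t](tens_classK (t : tensor M lreg)).
elim: (generic_quotient.repr _) => [|[m b] s IH]; first exact: P0.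
by have := PD m b _ IH; rewrite /tb [_ + _]tens_class_cat.
Qed.

Lemma tbDl m m' b : tb (m + m') b = tb m b + tb m' b.
Proof. by rewrite [RHS]tens_class_cat; apply/tens_classP/tens_Dl. Qed.
Lemma tbDr m b b' : tb m (b + b') = tb m b + tb m b'.
Proof. by rewrite [RHS]tens_class_cat; apply/tens_classP/tens_Dr. Qed.
Lemma tb0 b : tb 0 b = 0. Proof. by apply/tens_classP/tens_0l. Qed.
Lemma tbZ (a : A^c) m b : tb (a *: m) b = tb m (rf_map f a * b).
Proof. exact/tens_classP/tens_mul. Qed.
Lemma tb_scaleE b m c : tb_scale b (tb m c) = tb m (c * b).
Proof. exact: tb_scale_class. Qed.
Lemma tb_scaleD b (x y : tensB) : tb_scale b (x + y) = tb_scale b x + tb_scale b y.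
Proof.
rewrite -[x](tens_classK (x : tensor M lreg)) -[y](tens_classK (y : tensor M lreg)).
by rewrite [_ + _]tens_class_cat !tb_scale_class [RHS]tens_class_cat /tb_scale_seq map_cat.
Qed.
Lemma tb_scale0 b : tb_scale b 0 = 0.
Proof. exact: (tb_scale_class b [::]). Qed.
Fact tb_scaleA a b t : tb_scale a (tb_scale b t) = tb_scale (a * b) t.
Proof.
elim/tb_ind: t => [|m c t IH]; first by rewrite !tb_scale0.
by rewrite !tb_scaleD IH !tb_scaleE -mulrA.
Qed.
Fact tb_scale1 : left_id 1 tb_scale.
Proof.
elim/tb_ind=> [|m c t IH]; first by rewrite tb_scale0.
by rewrite tb_scaleD IH tb_scaleE mulr1.
Qed.
Fact tb_scaleDr : right_distributive tb_scale +%R. Proof. exact: tb_scaleD. Qed.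
Fact tb_scaleDl t : {morph tb_scale^~ t : a b / a + b}.
Proof.
move=> a b; elim/tb_ind: t => [|m c t IH]; first by rewrite !tb_scale0 addr0.
by rewrite !tb_scaleD IH !tb_scaleE mulrDr tbDr addrACA.
Qed.
HB.instance Definition _ := GRing.Zmodule_isLmodule.Build Bc tensB
  tb_scaleA tb_scale1 tb_scaleDr tb_scaleDl.

Lemma tb_Z (b : Bc) m c : b *: tb m c = tb m (c * b). Proof. exact: tb_scaleE. Qed.

Lemma tb_in_lin : linear (fun m : M => (tb m 1 : rs tensB)).
Proof.
move=> a x y; rewrite tbDl tbZ; congr (_ + _).
by rewrite rsE tb_Z mul1r mulr1.
Qed.
Definition tb_in : {linear M -> rs tensB} := mkl tb_in_lin.

Lemma tb_ext (Y : lmodType Bc) (g h : {linear tensB -> Y}) :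
  (forall m, g (tb m 1) = h (tb m 1)) -> g =1 h.
Proof.
move=> e t; elim/tb_ind: t => [|m b t IH]; first by rewrite !linear0.
by rewrite !linearD IH -(mul1r b) -tb_Z !linearZ /= e.
Qed.

Section Lift.
Variables (Y : lmodType Bc) (u : {linear M -> rs Y}).
Definition tb_sum (s : seq (M * lreg)) : Y := \sum_(q <- s) ((q.2 : Bc) *: (u q.1 : Y)).
Lemma tb_sumP s t : tens_rel s t -> tb_sum s = tb_sum t.
Proof.
elim=> {s t} [s t st|s t _|s t v _ st _ tv|s t v _ st|n|m m' n|m n n'|a m n].
- exact: perm_big.
- by [].
- by rewrite st.
- by rewrite /tb_sum !big_cat /= [X in X + _]st.
- by rewrite /tb_sum big_cons !big_nil /= linear0 addr0 scaler0.
- by rewrite /tb_sum !big_cons !big_nil /= linearD !addr0 scalerDr.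
- by rewrite /tb_sum !big_cons !big_nil /= !addr0 scalerDl.
- rewrite /tb_sum !big_cons !big_nil /= !addr0 linearZ /= rsE scalerA.
  by [].
Qed.
Definition tb_lift_fun (t : tensB) : Y := tb_sum (generic_quotient.repr (t : tensor M lreg)).
Lemma tb_lift_class s : tb_lift_fun (tens_class s) = tb_sum s.
Proof. by apply: tb_sumP; apply: repr_class. Qed.
Lemma tb_liftD x y : tb_lift_fun (x + y) = tb_lift_fun x + tb_lift_fun y.
Proof.
rewrite -[x](tens_classK (x : tensor M lreg)) -[y](tens_classK (y : tensor M lreg)).
by rewrite [_ + _]tens_class_cat !tb_lift_class /tb_sum big_cat.
Qed.
Lemma tb_lift_tb m b : tb_lift_fun (tb m b) = (b : Bc) *: (u m : Y).
Proof. by rewrite tb_lift_class /tb_sum big_seq1. Qed.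
Lemma tb_lift_lin : linear tb_lift_fun.
Proof.
move=> b x y; rewrite tb_liftD; congr (_ + _).
have z : tb_lift_fun 0 = 0 by rewrite -[0]/(tens_class [::]) tb_lift_class /tb_sum big_nil.
elim/tb_ind: x => [|m c t IH]; first by rewrite scaler0 z scaler0.
by rewrite scalerDr !tb_liftD IH tb_Z !tb_lift_tb scalerDr scalerA.
Qed.
Definition tb_lift : {linear tensB -> Y} := mkl tb_lift_lin.
Lemma tb_liftE m b : tb_lift (tb m b) = (b : Bc) *: (u m : Y).
Proof. by rewrite mklE tb_lift_tb. Qed.
Lemma tb_lift1 m : tb_lift (tb m 1) = u m.
Proof. by rewrite tb_liftE scale1r. Qed.
End Lift.
End Scale.

Section Map.
Variables (M N : lmodType A^c) (h : {linear M -> N}).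
Lemma tens_map_lin : linear (tens_map lreg h : tensB M -> tensB N).
Proof.
have D (x y : tensB M) : tens_map lreg h (x + y) = (tens_map lreg h x + tens_map lreg h y : tensB N).
  rewrite -[x](tens_classK (x : tensor M lreg)) -[y](tens_classK (y : tensor M lreg)).
  by rewrite [_ + _]tens_class_cat !tens_map_class [RHS]tens_class_cat /tens_map_seq map_cat.
have T m b : tens_map lreg h (tb m b) = tb (h m) b by rewrite /tb tens_map_class.
have Z : tens_map lreg h (0 : tensB M) = (0 : tensB N) by exact: (tens_map_class h [::]).
move=> b x y; rewrite D; congr (_ + _).
elim/tb_ind: x => [|m c t IH]; first by rewrite scaler0 Z scaler0.
by rewrite scalerDr !D IH tb_Z !T scalerDr tb_Z.
Qed.
Definition tmap : {linear tensB M -> tensB N} := mkl tens_map_lin.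
Lemma tmapE t : tmap t = tens_map lreg h t. Proof. exact: mklE. Qed.
Lemma tmap_tb m b : tmap (tb m b) = tb (h m) b.
Proof. by rewrite tmapE /tb tens_map_class. Qed.
End Map.
End TensorModule.

(** * Vanishing of Tor_1(B, B) and extension-closure of X_B *)

Section TorExt.
Variables (A : pzRingType) (f : ring_from A) (ef : ring_epi f).
Implicit Types M N P X Y Z E Q : lmodType A^c.
Notation B := (rf_cod f).
Notation Bc := ((rf_cod f)^c).
Notation rs Y := (restr (opmap (rf_map f)) Y : lmodType A^c).
Notation Breg := (rightreg f).

Lemma free_onto (R : pzRingType) (X : lmodType R) :
  exists (P : lmodType R) (p : {linear P -> X}), projective P /\ onto p.
Proof.
exists (copower X (R^o : lmodType R)), (cop_elim (fun x => elt x)); split.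
  exact/proj_cop/proj_reg.
by move=> x; exists (cop_in (R^o : lmodType R) x 1); rewrite cop_elimE elt1.
Qed.

(* Right exactness of - (x) B: as B (x) B = B for a ring epimorphism, the kernel
   of P0 (x) B -> B is the image of P1 (x) B. *)
Lemma tens_right_exact P1 P0 (d1 : {linear P1 -> P0}) (d0 : {linear P0 -> Breg}) :
  exact d1 d0 -> onto d0 ->
  exists D0 : {linear tensB f P0 -> Bc^o}, [/\ forall x b, D0 (tb x b) = (b : Bc) *: (d0 x : Bc^o),
    exact (tmap f d1) D0 & onto D0].
Proof.
move=> e1 d0o; exists (tb_lift (f := f) (d0 : {linear P0 -> rs Bc^o})).
set D0 := tb_lift _; have D0E x b : D0 (tb x b) = (b : Bc) *: (d0 x : Bc^o) by rewrite /D0 tb_liftE.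
split=> // [|y]; last first.
  by have [x hx] := d0o y; exists (tb x 1); rewrite D0E scale1r.
have [W [q [qo qq]]] := quo_ex (im_submod (tmap f d1)).
have [|w hw] := @fact_quo _ _ _ _ d0 (rsmap q \o tb_in f P0) d0o.
  move=> x /e1 [y <-]; rewrite /= /tb_in !mklE; apply/qq; exists (tb y 1).
  by rewrite tmap_tb.
have wD t : epi_map w ef (D0 t) = q t.
  apply: (tb_ext (g := epi_map w ef \o D0)) => x.
  by rewrite /= D0E scale1r /epi_map mklE hw /= /tb_in !mklE.
move=> t; split=> [t0|[z <-]]; first by apply/qq; rewrite -wD t0 linear0.
apply: (tb_ext (g := D0 \o tmap f d1) (h := zero_map _ _)) => x.
rewrite /= tmap_tb D0E (_ : d0 (d1 x) = 0) ?scaler0 //.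
by apply/e1; exists x.
Qed.

(** This says Ext^1_A(B, N) = 0 for N in X_B. The obstruction u : P1 -> N extends to P1 (x) B and,
    as Tor_1 vanishes, factors through the image of P1 (x) B in P0 (x) B; this image is a direct
    summand, so u extends along d1. *)
Lemma tor_lift : Tor1_zero (rightreg f) (leftreg f) ->
  forall E Z N (g : {linear E -> Z}) (k : {linear N -> E}), onto g -> is_kernel k g -> Xring f N ->
  forall v : {linear Breg -> Z}, exists v' : {linear Breg -> E}, forall b, g (v' b) = v b.
Proof.
move=> tor E Z N g k go [ki kg] [Y /isoP[i [ii io]]] v.
have [P0 [d0 [pP0 d0o]]] := free_onto Breg.
have [K0 [k0 [k0i k0d]]] := ker_ex d0.
have [P1 [e1 [pP1 e1o]]] := free_onto K0; pose d1 : {linear P1 -> P0} := k0 \o e1.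
have ex1 : exact d1 d0.
  move=> x; rewrite k0d; split=> [[z <-]|[z <-]]; last by exists (e1 z).
  by have [y <-] := e1o z; exists y.
have [K1 [k1 [k1i k1d]]] := ker_ex d1.
have [P2 [e2 [pP2 e2o]]] := free_onto K1; pose d2 : {linear P2 -> P1} := k1 \o e2.
have ex2 : exact d2 d1.
  move=> x; rewrite k1d; split=> [[z <-]|[z <-]]; last by exists (e2 z).
  by have [y <-] := e2o z; exists y.
have torE := tor _ _ _ d2 d1 d0 pP2 pP1 pP0 ex2 ex1 d0o.
have [D0 [D0E exD D0o]] := tens_right_exact ex1 d0o.
have [a0 ha0] := pP0 _ _ g (v \o d0) go.
have [|u hu] := @fact_sub _ _ _ _ k (a0 \o d1) ki.
  move=> x; apply/kg; rewrite /= ha0 /= (_ : d0 (k0 (e1 x)) = 0) ?linear0 //.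
  by apply/ex1; exists x.
have ud2 x : u (d2 x) = 0.
  apply: ki; rewrite hu /= (_ : k0 (e1 _) = 0) ?linear0 //.
  by apply/ex2; exists x.
pose U : {linear tensB f P1 -> Y} := tb_lift (i \o u : {linear P1 -> rs Y}).
have UE x : U (tb x 1) = i (u x) by rewrite /U tb_lift1.
have Uker t : tmap f d1 t = 0 -> U t = 0.
  rewrite tmapE => /torE [z <-]; rewrite -(tmapE d2).
  apply: (tb_ext (g := U \o tmap f d2) (h := zero_map _ _)) => x.
  by rewrite /= tmap_tb UE ud2 linear0.
have [I [a [j [ao ji ja]]]] := im_ex (tmap f d1).
have [|U' hU'] := @fact_quo _ _ _ _ a U ao.
  by move=> t at0; apply: Uker; rewrite -ja at0 linear0.
(* The quotient B of P0 (x) B is free over B; its section gives the retraction r onto the image of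
   d1 (x) B. *)
have [sg hsg] := @proj_reg Bc _ _ D0 idfun D0o.
have [|r hr] := @fact_sub _ _ _ _ j (idfun \- (sg \o D0)) ji.
  move=> t; have /exD [z hz] : D0 ((idfun \- (sg \o D0)) t) = 0.
    by rewrite linearB /= hsg subrr.
  by exists (a z); rewrite ja.
pose w : {linear P0 -> rs Y} := rsmap (U' \o r) \o tb_in f P0.
have wd x : w (d1 x) = i (u x).
  rewrite /w /= /tb_in !mklE /= -[i _]UE -hU'; congr (U' _); apply: ji.
  have e0 : D0 (tb (d1 x) 1) = 0 by apply/exD; exists (tb x 1); rewrite tmap_tb.
  by rewrite hr /= e0 linear0 subr0 ja tmap_tb.
clearbody w; have [i' [i1 i2]] := lin_inv ii io.
have [|v' hv'] := @fact_quo _ _ _ _ d0 (a0 \- (k \o i' \o w)) d0o.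
  by move=> x /ex1 [y <-] /=; rewrite wd i1 hu subrr.
exists v' => b; have [x <-] := d0o b; rewrite hv' linearB ha0 /=.
by rewrite (_ : g (k _) = 0) ?subr0 //; apply/kg; exists (i' (w x)).
Qed.

Lemma Xring_pair X Z : Xring f X -> Xring f Z -> Xring f (X * Z)%type.
Proof.
move=> [Y /isoP[i [ii io]]] [Y' /isoP[j [ji jo]]]; exists (Y * Y')%type; apply/isoP.
have l : linear (fun u : (X * Z)%type => ((i u.1, j u.2) : rs (Y * Y')%type)).
  by move=> a u v; rewrite /= !linearP.
exists (mkl l); split=> [[x z] [x' z']|[y y']]; first by rewrite !mklE => -[/ii -> /ji ->].
by have [x <-] := io y; have [z <-] := jo y'; exists (x, z); rewrite mklE.
Qed.

(** A free B-module F covers Z, and F -> Z lifts to E by [tor_lift]. Then X + F -> E is onto, with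
    kernel isomorphic to that of F -> Z, so E is a cokernel of a map in X_B. *)
Lemma tor_ext_closed : Tor1_zero (rightreg f) (leftreg f) -> extension_closed (Xring f).
Proof.
move=> tor X E Z k g [ki kg go] fX fZ.
have fB : Xring f Breg by apply: Xring_rs.
pose c (z : Z) := sval (cid (rightreg_ext z ef fZ)).
have c1 z : c z 1 = z by rewrite /c; case: cid => h [].
have H z := tor_lift tor go (conj ki kg) fX (c z).
pose c' z := sval (cid (H z)); have hc' z b : g (c' z b) = c z b by rewrite /c'; case: cid.
pose F := copower Z Breg; have fF : Xring f F by apply: Xring_cop.
pose l : {linear F -> E} := cop_elim c'.
have gl z b : g (l (cop_in Breg z b)) = c z b by rewrite /l cop_elimE.
pose t : {linear (X * F)%type -> E} := lcopair k l.
have fXF : Xring f (X * F)%type by apply: Xring_pair.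
have to : onto t.
  move=> e; have /kg [x hx] : g (e - l (cop_in Breg (g e) 1)) = 0.
    by rewrite linearB gl c1 subrr.
  by exists (x, cop_in Breg (g e) 1); rewrite /t lcopairE /= hx subrK.
have [N [n [ni ng]]] := ker_ex (g \o l).
have fN : Xring f N by apply: Xring_ker ef (conj ni ng) fF fZ.
have [|m hm] := @fact_sub _ _ _ _ k (l \o n) ki.
  by move=> x; apply/kg/(ng (n x)); exists x.
apply: (@Xring_coker _ f N (X * F)%type E (lpair (\- m) n) t) => // u.
rewrite /t lcopairE; split=> [tu|[x <-]].
  have /ng [x hx] : (g \o l) u.2 = 0.
    have := congr1 g tu; rewrite linearD linear0 (_ : g (k _) = 0) ?add0r //.
    by apply/kg; exists u.1.
  exists x; rewrite lpairE [RHS]surjective_pairing hx; congr pair.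
  apply: ki; rewrite /= linearN hm /= hx; apply/eqP.
  by rewrite eq_sym -addr_eq0 tu.
by rewrite lpairE /= linearN hm addNr.
Qed.

(** It suffices to extend u : P1 -> Y = Coker (d2 (x) B) along d1, for then the projection q factors
    through d1 (x) B and kills t. The pushout of d1 along u is an extension of B by Y, hence in X_B,
    and by [rightreg_ext] a preimage of 1 yields a section splitting it. *)
Lemma ext_closed_tor : extension_closed (Xring f) -> Tor1_zero (rightreg f) (leftreg f).
Proof.
move=> ec P2 P1 P0 d2 d1 d0 pP2 pP1 pP0 e2 e1 d0o t; rewrite -(tmapE d1).
have fB : Xring f Breg by apply: Xring_rs.
split=> [t0|[z <-]]; last first.
  rewrite -(tmapE d2); apply: (tb_ext (g := tmap f d1 \o tmap f d2) (h := zero_map _ _)) => x.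
  by rewrite /= !tmap_tb (_ : d1 (d2 x) = 0) ?tb0 //; apply/e2; exists x.
have [Y [q [qo qq]]] := quo_ex (im_submod (tmap f d2)).
pose u : {linear P1 -> rs Y} := rsmap q \o tb_in f P1.
have uE x : u x = q (tb x 1) by rewrite /u /= /tb_in !mklE.
have ud2 x : u (d2 x) = 0.
  by rewrite uE; apply/qq; exists (tb x 1); rewrite tmap_tb.
suff [w hw] : exists w : {linear P0 -> rs Y}, forall x, w (d1 x) = u x.
  have : q t = 0.
    rewrite -[q t](tb_ext (g := tb_lift w \o tmap f d1) (h := q)).
      by rewrite /= t0 linear0.
    by move=> x; rewrite /= tmap_tb tb_lift1 hw uE.
  by move=> /qq [z hz]; exists z; rewrite -(tmapE d2).
have [E [p [po pp]]] := quo_ex (im_submod (lpair u (\- d1))).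
pose k : {linear rs Y -> E} := p \o linl (rs Y) P0.
have [|g hg] := @fact_quo _ _ _ _ p (d0 \o lsnd (rs Y) P0) po.
  move=> z /pp [x <-]; rewrite lpairE /= linearN (_ : d0 (d1 x) = 0) ?oppr0 //.
  by apply/e1; exists x.
(* This uses that u kills the image of d2, which is the kernel of d1. *)
have ki : injective k.
  apply: inj0 => y /= /pp [x]; rewrite linlE lpairE => -[<- e].
  have /e2 [z <-] : d1 x = 0 by apply/eqP; rewrite -oppr_eq0; apply/eqP.
  exact: ud2.
have kg : exact k g.
  move=> e; have [[y x] <-] := po e; rewrite hg /=; split=> [/e1 [z hz]|[y' hy']].
    exists (y + u z); apply/eqP; rewrite -subr_eq0 /= -linearB; apply/eqP/pp.
    exists z; rewrite lpairE linlE; congr pair; rewrite /= ?sub0r ?hz //.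
    by rewrite addrC addKr.
  have := congr1 g hy'; rewrite /= !hg /= linlE /= linear0 => <-.
  by [].
have go : onto g.
  by move=> b; have [x <-] := d0o b; exists (p (linr _ _ x)); rewrite hg linrE.
have fE : Xring f E by apply: (ec _ _ _ k g) => //; apply: Xring_rs.
have [e0 ge0] := go 1.
have [s [s1 _]] := rightreg_ext e0 ef fE.
have gs b : g (s b) = b.
  by apply: (rightreg_uniq (g := g \o s) (g' := idfun) ef fB); rewrite /= s1.
have [|r hr] := @fact_sub _ _ _ _ k (idfun \- (s \o g)) ki.
  by move=> e; apply/kg; rewrite linearB /= gs subrr.
exists (r \o p \o linr (rs Y) P0) => x /=; apply: ki; rewrite hr /= hg linrE /=.
rewrite (_ : d0 (d1 x) = 0) ?linear0 ?addr0; last by apply/e1; exists x.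
apply/eqP; rewrite eq_sym -subr_eq0 -linearB; apply/eqP/pp; exists x.
by rewrite lpairE linlE; congr pair; rewrite /= ?subr0 ?sub0r.
Qed.

End TorExt.

Section UniversalLocalisation.
Variables (A : pzRingType) (f : ring_from A) (ef : ring_epi f).

(** With B' the target of g, A-linear maps P -> B' are B'-linear maps P (x) B' -> B'; so if s (x) B'
    is invertible, Hom(s, B') is bijective. *)
Lemma Xclass_of_inverts (g : ring_from A) (P Q : lmodType A^c) (s : {linear P -> Q}) :
  bijective (tens_map (leftreg g) s) -> Xclass s (rightreg g).
Proof.
move=> bij; have /bijP[ti to] : bijective (tmap g s).
  by case: bij => t h1 h2; exists t => x; rewrite tmapE (h1, h2).
have [t [t1 t2]] := lin_inv ti to.
pose C : lmodType (rf_cod g)^c := (rf_cod g)^c^o.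
move=> u; pose U : {linear tensB g P -> C} := tb_lift u.
exists (rsmap (U \o t) \o tb_in g Q); split=> [x|v hv y].
  by rewrite /= /tb_in !mklE /= -tmap_tb t1 /U tb_lift1.
rewrite /= /tb_in !mklE /=; pose V : {linear tensB g Q -> C} := tb_lift v.
rewrite -[LHS](tb_lift1 (Y := C)) -/V -{1}(t2 (tb y 1)).
apply: (tb_ext (g := V \o tmap g s) (h := U)) => x.
by rewrite /= tmap_tb /V /U !tb_lift1 hv.
Qed.

(** Only s is inverted. P (x) B is in X_B = X_s, so P -> P (x) B extends along s, which gives the
    inverse of s (x) B. A ring over A that inverts s lies in X_s = X_B as an A-module, and [epi_hom]
    provides the morphism. *)
Lemma univ_loc (P Q : lmodType A^c) (s : {linear P -> Q}) :
  projective P -> projective Q -> fin_gen P -> fin_gen Q -> Xring f = Xclass s ->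
  universal_localisation f.
Proof.
move=> pP pQ fP fQ fs; exists (fun m => m = Morphism s); split.
- by move=> _ ->.
- move=> _ ->.
  suff [t [t1 t2]] : exists t : {linear tensB f Q -> tensB f P},
      (forall x, t (tmap f s x) = x) /\ forall y, tmap f s (t y) = y.
    by exists t => x; [rewrite -[RHS]t1 tmapE|rewrite -[RHS]t2 tmapE].
  have fin (Y : lmodType (rf_cod f)^c) : Xclass s (restr (opmap (rf_map f)) Y).
    by rewrite -fs; apply: Xring_rs.
  have [w [ws _]] := fin _ (tb_in f P).
  pose t : {linear tensB f Q -> tensB f P} := tb_lift w.
  have ts x : t (tmap f s x) = x.
    apply: (tb_ext (g := t \o tmap f s) (h := idfun)) => m.
    by rewrite /= tmap_tb /t tb_lift1 ws mklE.
  exists t; split=> // y.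
  apply: (tb_ext (g := tmap f s \o t) (h := idfun)) => m.
  have [v [_ vu]] := fin _ (tb_in f Q \o s).
  rewrite /= /t tb_lift1; have e1 := vu (rsmap (tmap f s) \o w).
  have -> : tmap f s (w m) = (rsmap (tmap f s) \o w) m by rewrite /= /rsmap [RHS]mklE.
  rewrite e1; last first.
    move=> x; rewrite /= ws; have e2 y : tb_in f P y = tb y 1 := mklE _ _.
    have e3 y : tb_in f Q y = tb y 1 := mklE _ _.
    by rewrite e2 e3 -[RHS](tmap_tb (f := f) s) /rsmap [LHS]mklE.
  by rewrite -(vu (tb_in f Q)) // mklE.
- move=> g ig; have [|h hg] := epi_hom (g := g) ef.
    rewrite fs; apply: Xclass_of_inverts; exact: (ig (Morphism s)).
  exists h; split=> [a|h' h'g]; first exact: hg.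
  by apply: ef => a; rewrite h'g hg.
Qed.
End UniversalLocalisation.

(** * Two-term complexes in the derived category *)

Section DerivedTools.
Variable R : pzRingType.
Implicit Types (X Y Z V : cpx R) (M N P Q : lmodType R).

Lemma homotopic_eq X Y (f g : cmap X Y) : (forall i x, f i x = g i x) -> homotopic f g.
Proof.
move=> e; exists (fun i => zero_map _ _) => i x; rewrite e subrr /=.
by rewrite linear0 addr0.
Qed.

Lemma homotopic_refl X Y (f : cmap X Y) : homotopic f f.
Proof. exact: homotopic_eq. Qed.

Lemma homotopic_sym X Y (f g : cmap X Y) : homotopic f g -> homotopic g f.
Proof.
case=> s hs; exists (fun i => (\- s i)) => i x /=.
by rewrite linearN -opprD -hs opprB.
Qed.

Lemma homotopic_trans X Y (f g h : cmap X Y) : homotopic f g -> homotopic g h -> homotopic f h.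
Proof.
case=> s hs [t ht]; exists (fun i => (s i \+ t i)) => i x /=.
by rewrite linearD addrACA -hs -ht addrA subrK.
Qed.

Lemma homotopic_compl X Y Z (f g : cmap X Y) (h : cmap Y Z) :
  homotopic f g -> homotopic (ccomp h f) (ccomp h g).
Proof.
case=> s hs; exists (fun i => h i \o s i) => i x /=.
by rewrite -linearB hs linearD cfunP.
Qed.

Lemma homotopic_compr X Y Z (f g : cmap Y Z) (h : cmap X Y) :
  homotopic f g -> homotopic (ccomp f h) (ccomp g h).
Proof.
case=> s hs; exists (fun i => s i \o h (i + 1)) => i x /=.
by rewrite hs cfunP.
Qed.

(** The two halves of [qis] are kept apart because the composites defining an isomorphism of the
    derived category yield them separately. *)
Definition hinj X Y (f : cmap X Y) := forall i (x : X (i + 1)), cdiff X (i + 1) x = 0 ->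
  (exists y, f (i + 1) x = cdiff Y i y) -> exists z, x = cdiff X i z.
Definition hsur X Y (f : cmap X Y) := forall i (y : Y (i + 1)), cdiff Y (i + 1) y = 0 ->
  exists x z, cdiff X (i + 1) x = 0 /\ f (i + 1) x + cdiff Y i z = y.

Lemma qisP X Y (f : cmap X Y) : qis f <-> hinj f /\ hsur f.
Proof.
split=> [q|[h1 h2] i]; last by split=> [x|y]; [apply: h1|apply: h2].
by split=> i x; case: (q i) => h1 h2; [apply: h1|apply: h2].
Qed.

Lemma hinj_homot X Y (f g : cmap X Y) : homotopic f g -> hinj f -> hinj g.
Proof.
case=> s hs hf i x dx [y gx]; apply: hf => //; exists (s i x + y).
by have := hs i x; rewrite dx linear0 addr0 linearD -gx => <-; rewrite subrK.
Qed.

Lemma hsur_homot X Y (f g : cmap X Y) : homotopic f g -> hsur f -> hsur g.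
Proof.
case=> s hs hf i y dy; have [x [z [dx <-]]] := hf i y dy; exists x, (s i x + z); split=> //.
by have := hs i x; rewrite dx linear0 addr0 linearD => <-; rewrite addrA addrCA subrr addr0.
Qed.

Lemma qis_homot X Y (f g : cmap X Y) : homotopic f g -> qis f -> qis g.
Proof.
by move=> fg /qisP[h1 h2]; apply/qisP; split; [apply: hinj_homot h1|apply: hsur_homot h2].
Qed.

Lemma hinj_comp X Y Z (f : cmap X Y) (g : cmap Y Z) : hinj f -> hinj g -> hinj (ccomp g f).
Proof.
move=> hf hg i x dx h; apply: hf => //; apply: hg => //.
by rewrite -cfunP dx linear0.
Qed.

Lemma hinj_compK X Y Z (f : cmap X Y) (g : cmap Y Z) : hinj (ccomp g f) -> hinj f.
Proof.
move=> h i x dx [y fx]; apply: h => //; exists (g i y).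
by rewrite /= fx cfunP.
Qed.

Lemma hsur_comp X Y Z (f : cmap X Y) (g : cmap Y Z) : hsur f -> hsur g -> hsur (ccomp g f).
Proof.
move=> hf hg i z dz; have [y [u [dy <-]]] := hg i z dz; have [x [v [dx <-]]] := hf i y dy.
exists x, (g i v + u); split=> //=.
by rewrite !linearD -cfunP addrA.
Qed.

Lemma hsur_compK X Y Z (f : cmap X Y) (g : cmap Y Z) : hsur (ccomp g f) -> hsur g.
Proof.
move=> h i z dz; have [x [u [dx <-]]] := h i z dz; exists (f (i + 1) x), u; split=> //.
by rewrite -cfunP dx linear0.
Qed.

Lemma hinj_sur X Y Z (f : cmap X Y) (g : cmap Y Z) : hsur f -> hinj (ccomp g f) -> hinj g.
Proof.
move=> hf h i y dy [z gy]; have [x [u [dx e]]] := hf i y dy.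
have [|w hw] := h i x dx.
  by exists (z - g i u); rewrite linearB -gy -cfunP -e linearD addrK.
by exists (f i w + u); rewrite linearD -cfunP -hw e.
Qed.

Lemma hsur_inj X Y Z (f : cmap X Y) (g : cmap Y Z) : hinj g -> hsur (ccomp g f) -> hsur f.
Proof.
move=> hg h i y dy; have [|x [z [dx e]]] := h i (g (i + 1) y).
  by rewrite -cfunP dy linear0.
have [||u hu] := hg i (y - f (i + 1) x).
- by rewrite linearB dy -cfunP dx linear0 subr0.
- by exists z; rewrite linearB -e /= addrAC subrr add0r.
by exists x, u; rewrite -hu; split=> //; rewrite [LHS]addrC subrK.
Qed.

Lemma qis_comp X Y Z (f : cmap X Y) (g : cmap Y Z) : qis f -> qis g -> qis (ccomp g f).
Proof.
by move=> /qisP[f1 f2] /qisP[g1 g2]; apply/qisP; split; [apply: hinj_comp|apply: hsur_comp].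
Qed.

Lemma qis_compK X Y Z (f : cmap X Y) (g : cmap Y Z) : qis g -> qis (ccomp g f) -> qis f.
Proof.
by move=> /qisP[g1 g2] /qisP[h1 h2]; apply/qisP; split; [apply: hinj_compK h1|apply: hsur_inj h2].
Qed.

Lemma qis_bij X Y (f : cmap X Y) : (forall i, isob (f i)) -> qis f.
Proof.
move=> bf i; have [fi fo] := bf (i + 1); split=> [x dx [y e]|y dy].
  have [z hz] := (bf i).2 y; exists z; apply: fi.
  by rewrite e -hz cfunP.
have [x hx] := fo y; exists x, 0; rewrite linear0 addr0; split=> //.
by apply: (bf (i + 1 + 1)).1; rewrite cfunP hx dy linear0.
Qed.

(** K-projectivity, in the form that lets chain maps up to homotopy compute morphisms of the derived
    category. *)
Definition Kproj X := forall Y Z (w : cmap Z Y), qis w ->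
  (forall a : cmap X Y, exists a' : cmap X Z, homotopic (ccomp w a') a) /\
  (forall b b' : cmap X Z, homotopic (ccomp w b) (ccomp w b') -> homotopic b b').

(** The solutions (m, x) form a submodule that maps onto P; a section, given by projectivity, makes
    the choice of m linear in x. *)
Lemma lin_choice M P N1 N2 (L1 : {linear (M * P)%type -> N1}) (L2 : {linear (M * P)%type -> N2}) :
  projective P -> (forall x, exists m, L1 (m, x) = 0 /\ L2 (m, x) = 0) ->
  exists g : {linear P -> M}, forall x, L1 (g x, x) = 0 /\ L2 (g x, x) = 0.
Proof.
move=> pP h; have [N [k [ki kp]]] := ker_ex (lpair L1 L2).
have [|g hg] := pP _ _ (lsnd M P \o k) idfun.
  move=> x; have [m [h1 h2]] := h x; have /kp [n hn] : lpair L1 L2 (m, x) = 0.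
    by rewrite lpairE h1 h2.
  by exists n; rewrite /= hn.
exists (lfst M P \o k \o g) => x.
have e : k (g x) = ((k (g x)).1, x).
  by rewrite [LHS]surjective_pairing; congr pair; apply: hg.
have /kp : exists n, k n = k (g x) by exists (g x).
by rewrite lpairE e => -[-> ->].
Qed.

Definition proj_two_term X := (forall i, projective (X i)) /\
  forall i, i <> Negz 0 -> i <> Posz 0 -> forall x : X i, x = 0.

Definition tt_fun X Y (f1 : {linear X (Negz 0) -> Y (Negz 0)}) (f0 : {linear X (Posz 0) -> Y (Posz 0)})
    i : {linear X i -> Y i} :=
  match i return {linear X i -> Y i} with
  | Negz 0 => f1
  | Posz 0 => f0
  | _ => zero_map _ _
  end.

Lemma int1_neq (n : nat) : Posz n + 1 <> Negz 0 /\ Posz n + 1 <> Posz 0.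
Proof. by split=> /eqP; rewrite -?PoszD ?addn1. Qed.

Lemma int2_neq (n : nat) : Negz n.+2 + 1 <> Negz 0 /\ Negz n.+2 + 1 <> Posz 0.
Proof. by split=> /eqP; rewrite NegzE -(addn1 n.+2) PoszD opprD subrK. Qed.

Lemma tt_cmap X Y (f1 : {linear X (Negz 0) -> Y (Negz 0)}) (f0 : {linear X (Posz 0) -> Y (Posz 0)}) :
  proj_two_term X -> (forall x, f0 (cdiff X (Negz 0) x) = cdiff Y (Negz 0) (f1 x)) ->
  (forall x, cdiff Y (Posz 0) (f0 x) = 0) ->
  exists f : cmap X Y, (f (Negz 0) =1 f1) /\ (f (Posz 0) =1 f0).
Proof.
move=> [_ tX] e1 e0.
have ch i x : tt_fun f1 f0 (i + 1) (cdiff X i x) = cdiff Y i (tt_fun f1 f0 i x).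
  case: i x => [[|n]|[|n]] x.
  - rewrite [RHS]e0 (tX _ _ _ (cdiff X 0 x)) ?linear0 //.
  - by rewrite (tX (Posz n.+1) _ _ x) ?linear0.
  - exact: e1.
  - by rewrite (tX (Negz n.+1) _ _ x) ?linear0.
by exists (Cmap ch).
Qed.

(** The component in degree i starts at X (i + 1), so only those in degrees -1 and -2, [Negz 0] and
    [Negz 1], can be nonzero. *)
Definition tt_hfun X Y (h2 : {linear X (Negz 0) -> Y (Negz 1)}) (h1 : {linear X (Posz 0) -> Y (Negz 0)})
    i : {linear X (i + 1) -> Y i} :=
  match i return {linear X (i + 1) -> Y i} with
  | Negz 0 => h1
  | Negz 1 => h2
  | j => zero_map (X (j + 1)) (Y j)
  end.

Lemma tt_homotopic X Y (f g : cmap X Y) (h2 : {linear X (Negz 0) -> Y (Negz 1)})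
    (h1 : {linear X (Posz 0) -> Y (Negz 0)}) : proj_two_term X ->
  (forall x, f (Negz 0) x - g (Negz 0) x = cdiff Y (Negz 1) (h2 x) + h1 (cdiff X (Negz 0) x)) ->
  (forall x, f (Posz 0) x - g (Posz 0) x = cdiff Y (Negz 0) (h1 x)) ->
  homotopic f g.
Proof.
move=> [_ tX] e2 e1; exists (tt_hfun h2 h1); case=> [n|[|[|n]]] x.
- have [n1 n2] := int1_neq n.
  by rewrite (tX _ n1 n2 x) !linear0.
- by rewrite [LHS]e1 /= addr0.
- exact: e2.
- have [n1 n2] := int2_neq n.
  by rewrite (tX _ n1 n2 x) !linear0.
Qed.

Lemma tt_homotopicP X Y (f g : cmap X Y) : proj_two_term X -> homotopic f g ->
  exists (h2 : {linear X (Negz 0) -> Y (Negz 1)}) (h1 : {linear X (Posz 0) -> Y (Negz 0)}),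
  (forall x, f (Negz 0) x - g (Negz 0) x = cdiff Y (Negz 1) (h2 x) + h1 (cdiff X (Negz 0) x)) /\
  (forall x, f (Posz 0) x - g (Posz 0) x = cdiff Y (Negz 0) (h1 x)).
Proof.
move=> [_ tX] [s hs]; exists (s (Negz 1)), (s (Negz 0)); split=> x; first exact: (hs (Negz 1)).
have := hs (Negz 0) x; rewrite (tX _ _ _ (cdiff X (Negz 0 + 1) x)) // linear0 addr0.
by [].
Qed.

(** The lift is built from degree 0 downwards; in each degree [lin_choice] selects it together with
    a component of the homotopy. *)
Lemma tt_Kproj X : proj_two_term X -> Kproj X.
Proof.
move=> tX Y Z w /qisP[wi ws]; have [pX zX] := tX.
have d0 (x : X (Posz 0)) : cdiff X (Posz 0) x = 0 by apply: zX.
have wd (z : Z (Negz 0)) : w (Posz 0) (cdiff Z (Negz 0) z) = cdiff Y (Negz 0) (w (Negz 0) z) := @cfunP _ _ _ w (Negz 0) z.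
have wi0 (z : Z (Posz 0)) : cdiff Z (Posz 0) z = 0 -> (exists y, w (Posz 0) z = cdiff Y (Negz 0) y) ->
  exists u, z = cdiff Z (Negz 0) u := wi (Negz 0) z.
have wi1 (z : Z (Negz 0)) : cdiff Z (Negz 0) z = 0 -> (exists y, w (Negz 0) z = cdiff Y (Negz 1) y) ->
  exists u, z = cdiff Z (Negz 1) u := wi (Negz 1) z.
have ws0 (y : Y (Posz 0)) : cdiff Y (Posz 0) y = 0 -> exists z u, cdiff Z (Posz 0) z = 0 /\
  w (Posz 0) z + cdiff Y (Negz 0) u = y := ws (Negz 0) y.
have ws1 (y : Y (Negz 0)) : cdiff Y (Negz 0) y = 0 -> exists z u, cdiff Z (Negz 0) z = 0 /\
  w (Negz 0) z + cdiff Y (Negz 1) u = y := ws (Negz 1) y.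
split=> [a|b b' hb].
  have ad (x : X (Negz 0)) : a (Posz 0) (cdiff X (Negz 0) x) = cdiff Y (Negz 0) (a (Negz 0) x) := @cfunP _ _ _ a (Negz 0) x.
  have ad0 (x : X (Posz 0)) : cdiff Y (Posz 0) (a (Posz 0) x) = 0.
    have := @cfunP _ _ _ a (Posz 0) x; rewrite d0 linear0 => <- //.
  have [|g hg] := @lin_choice (Z (Posz 0) * Y (Negz 0))%type (X (Posz 0)) _ _
    (cdiff Z (Posz 0) \o lfst _ _ \o lfst _ _)
    (((w (Posz 0) \o lfst _ _ \o lfst _ _) \+ (cdiff Y (Negz 0) \o lsnd _ _ \o lfst _ _))
       \- (a (Posz 0) \o lsnd _ _)) (pX _).
    by move=> x; have [z [y [h1 h2]]] := ws0 _ (ad0 x); exists (z, y); rewrite /= h1 h2 [X in _ /\ X = _]subrr.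
  pose a0 : {linear X (Posz 0) -> Z (Posz 0)} := lfst _ _ \o g.
  pose y0 : {linear X (Posz 0) -> Y (Negz 0)} := lsnd _ _ \o g.
  have da0 x : cdiff Z (Posz 0) (a0 x) = 0 by have [] := hg x.
  have wa0 x : w (Posz 0) (a0 x) + cdiff Y (Negz 0) (y0 x) = a (Posz 0) x.
    by have [_ /= /eqP] := hg x; rewrite subr_eq0 => /eqP.
  clearbody a0 y0.
  (* Injectivity of w on cohomology gives u bounding the degree 0 part; surjectivity corrects u by a
     cycle so that its image under w is right up to a boundary. *)
  have [|g' hg'] := @lin_choice (Z (Negz 0) * Y (Negz 1))%type (X (Negz 0)) _ _
    ((cdiff Z (Negz 0) \o lfst _ _ \o lfst _ _) \- (a0 \o cdiff X (Negz 0) \o lsnd _ _))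
    (((w (Negz 0) \o lfst _ _ \o lfst _ _) \- ((a (Negz 0) \- (y0 \o cdiff X (Negz 0))) \o lsnd _ _))
       \- (cdiff Y (Negz 1) \o lsnd _ _ \o lfst _ _)) (pX _).
    move=> x; have [|u hu] := wi0 (a0 (cdiff X (Negz 0) x)) (da0 _).
      exists (a (Negz 0) x - y0 (cdiff X (Negz 0) x)); rewrite linearB -ad -wa0.
      by rewrite addrK.
    have [|z [y [dz e]]] := ws1 (w (Negz 0) u - (a (Negz 0) x - y0 (cdiff X (Negz 0) x))).
      by rewrite linearB -wd -hu linearB -ad -wa0 addrK [LHS]subrr.
    exists (u - z, y); rewrite /= linearB dz subr0 hu; split; first exact: subrr.
    by rewrite linearB [X in X - _ = _]addrAC -e [X in X - _ = _]addrAC [X in X + _ - _]subrr add0r [LHS]subrr.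
  have [f [f1 f0]] := tt_cmap (f1 := lfst _ _ \o g') (f0 := a0) tX
    (fun x => esym (subr0_eq (hg' x).1)) da0.
  exists f; apply: (tt_homotopic (h2 := lsnd _ _ \o g') (h1 := \- y0) tX) => x /=.
    rewrite f1; have [_ /= /eqP] := hg' x; rewrite subr_eq0 => /eqP <-.
    by rewrite opprB addrA addrAC addrK addrC.
  by rewrite f0 -wa0 opprD addrA subrr sub0r linearN.
have [t2 [t1 [e2 e1]]] := tt_homotopicP tX hb.
(* For uniqueness, the difference of b and b' is contracted, starting from the homotopy t of its
   image under w to zero. *)
pose c1 := b (Negz 0) \- b' (Negz 0); pose c0 := b (Posz 0) \- b' (Posz 0).
have dc0 x : cdiff Z (Posz 0) (c0 x) = 0.
  rewrite /= linearB; have := @cfunP _ _ _ b (Posz 0) x; have := @cfunP _ _ _ b' (Posz 0) x.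
  by rewrite d0 !linear0 => h h'; rewrite -[cdiff Z _ _]h' -[X in _ - X]h subrr.
have dc1 x : cdiff Z (Negz 0) (c1 x) = c0 (cdiff X (Negz 0) x).
  by rewrite /= linearB -(@cfunP _ _ _ b (Negz 0)) -(@cfunP _ _ _ b' (Negz 0)).
have wc0 x : w (Posz 0) (c0 x) = cdiff Y (Negz 0) (t1 x) by rewrite -e1 linearB.
have wc1 x : w (Negz 0) (c1 x) = cdiff Y (Negz 1) (t2 x) + t1 (cdiff X (Negz 0) x).
  by rewrite -e2 linearB.
have [|g hg] := @lin_choice (Z (Negz 0) * Y (Negz 1))%type (X (Posz 0)) _ _
  ((cdiff Z (Negz 0) \o lfst _ _ \o lfst _ _) \- (c0 \o lsnd _ _))
  (((w (Negz 0) \o lfst _ _ \o lfst _ _) \- (t1 \o lsnd _ _))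
     \- (cdiff Y (Negz 1) \o lsnd _ _ \o lfst _ _)) (pX _).
  move=> x; have [|u hu] := wi0 (c0 x) (dc0 x); first by exists (t1 x).
  have [|z [y [dz e]]] := ws1 (w (Negz 0) u - t1 x).
    by rewrite linearB -wd -hu wc0 [LHS]subrr.
  exists (u - z, y); rewrite /= linearB dz subr0 -hu; split; first exact: subrr.
  by rewrite linearB [X in X - _ = _]addrAC -e [X in X - _ = _]addrAC [X in X + _ - _]subrr add0r [LHS]subrr.
pose h1 : {linear X (Posz 0) -> Z (Negz 0)} := lfst _ _ \o g.
pose y1 : {linear X (Posz 0) -> Y (Negz 1)} := lsnd _ _ \o g.
have dh1 x : cdiff Z (Negz 0) (h1 x) = c0 x by have [/subr0_eq] := hg x.
have wh1 x : w (Negz 0) (h1 x) - t1 x = cdiff Y (Negz 1) (y1 x) by have [_ /subr0_eq] := hg x.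
clearbody h1 y1.
have [|h2 hh2] := @lin_choice (Z (Negz 1)) (X (Negz 0)) _ _
  ((cdiff Z (Negz 1) \o lfst _ _) \- ((c1 \- (h1 \o cdiff X (Negz 0))) \o lsnd _ _))
  (zero_map _ (zero_mod R)) (pX _).
  move=> x; have [||u hu] := wi1 (c1 x - h1 (cdiff X (Negz 0) x)).
  - by rewrite linearB dc1 dh1 [LHS]subrr.
  - exists (t2 x - y1 (cdiff X (Negz 0) x)).
    rewrite linearB wc1 [RHS]linearB -wh1 opprB addrA.
    by rewrite -!addrA; congr (_ + _); rewrite addrC.
  by exists u; rewrite /= -hu; split; first exact: subrr.
apply: (tt_homotopic (h2 := h2) (h1 := h1) tX) => x.
  have [/subr0_eq /= -> _] := hh2 x.
  by rewrite subrK.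
by rewrite dh1.
Qed.
End DerivedTools.

(* boolp.cid hides the identity chain map. *)
Local Notation cid := Defs.cid.

Section Act.
Variable R : pzRingType.
Implicit Types (X Y Z V W : cpx R) (M N P Q : lmodType R).

(* Maps from a K-projective complex into X, up to homotopy, form a functor of X
   on the derived category; act F a b says that F sends a to b. *)
Definition act W X Y (F : dhom X Y) (a : cmap W X) (b : cmap W Y) :=
  exists a' : cmap W (apex F), homotopic (ccomp (dback F) a') a /\ homotopic (ccomp (dfwd F) a') b.

Lemma act_homot W X Y (F : dhom X Y) (a a2 : cmap W X) (b b2 : cmap W Y) :
  act F a b -> homotopic a a2 -> homotopic b b2 -> act F a2 b2.
Proof.
move=> [a' [h1 h2]] ha hb; exists a'.
by split; [apply: homotopic_trans ha|apply: homotopic_trans hb].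
Qed.

Lemma act_pre W W' X Y (F : dhom X Y) (a : cmap W X) (b : cmap W Y) (e : cmap W' W) :
  act F a b -> act F (ccomp a e) (ccomp b e).
Proof.
move=> [a' [h1 h2]]; exists (ccomp a' e); split.
  exact: (homotopic_compr e h1).
exact: (homotopic_compr e h2).
Qed.

Lemma act_dmap W X Y (f : cmap X Y) (a : cmap W X) : act (dmap f) a (ccomp f a).
Proof. by exists a; split; apply: homotopic_eq. Qed.

Section KP.
Variables (W : cpx R) (kW : Kproj W).

Lemma act_ex X Y (F : dhom X Y) (a : cmap W X) : exists b, act F a b.
Proof.
have [a' ha'] := (kW (@dback_qis _ _ _ F)).1 a.
exists (ccomp (dfwd F) a'), a'; split=> //; exact: homotopic_refl.
Qed.

Lemma act_uniq X Y (F : dhom X Y) (a a2 : cmap W X) (b b2 : cmap W Y) :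
  act F a b -> act F a2 b2 -> homotopic a a2 -> homotopic b b2.
Proof.
move=> [a' [h1 h2]] [a2' [h3 h4]] h.
have e : homotopic a' a2'.
  apply: (kW (@dback_qis _ _ _ F)).2; apply: homotopic_trans h1 _.
  apply: homotopic_trans h _; exact: homotopic_sym.
apply: homotopic_trans (homotopic_sym h2) _; apply: homotopic_trans h4.
exact: homotopic_compl.
Qed.

Lemma act_comp X Y Z (G : dhom Y Z) (F : dhom X Y) (H : dhom X Z)
    (a : cmap W X) (b : cmap W Y) (c : cmap W Z) :
  dcomp G F H -> act F a b -> act G b c -> act H a c.
Proof.
move=> [V [u [v [w [qw h1 h2 h3]]]]] aF aG.
have [aH haH] := (kW (@dback_qis _ _ _ H)).1 a.
have [aV haV] := (kW qw).1 aH.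
have actF : act F a (ccomp (dfwd F) (ccomp u aV)).
  exists (ccomp u aV); split; last exact: homotopic_refl.
  apply: homotopic_trans haH; apply: homotopic_trans (homotopic_compl _ haV).
  exact: (homotopic_compr aV h1).
have e1 : homotopic (ccomp (dfwd F) (ccomp u aV)) b.
  exact: act_uniq actF aF (homotopic_refl a).
have actG : act G b (ccomp (dfwd G) (ccomp v aV)).
  exists (ccomp v aV); split; last exact: homotopic_refl.
  by apply: homotopic_trans e1; apply: homotopic_sym; apply: (homotopic_compr aV h2).
have e2 := act_uniq actG aG (homotopic_refl b).
exists aH; split=> //; apply: homotopic_trans e2.
apply: homotopic_sym; apply: homotopic_trans (homotopic_compl _ haV).
exact: (homotopic_compr aV h3).
Qed.

(** A morphism out of a K-projective W is determined by the image of the identity of W, so a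
    composition can be checked there. *)
Lemma act_dcomp Y Z (G : dhom Y Z) (F : dhom W Y) (H : dhom W Z) (b : cmap W Y) (c : cmap W Z) :
  act F (cid W) b -> act G b c -> act H (cid W) c -> dcomp G F H.
Proof.
move=> [u [u1 u2]] [v [v1 v2]] [w [w1 w2]]; exists W, u, v, w; split.
- apply: (qis_compK (@dback_qis _ _ _ H)).
  by apply: qis_homot (homotopic_sym w1) _; apply: qis_id.
- by apply: homotopic_trans u1 _; apply: homotopic_sym.
- by apply: homotopic_trans u2 _; apply: homotopic_sym.
- by apply: homotopic_trans v2 _; apply: homotopic_sym.
Qed.

Lemma act_inv X Y (F : dhom X Y) (G : dhom Y X) (a : cmap W X) (b : cmap W Y) :
  dcomp G F (dmap (cid X)) -> act F a b -> act G b a.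
Proof.
move=> GF aF; have [c aG] := act_ex G b.
have h := act_comp GF aF aG; apply: act_homot aG (homotopic_refl b) _.
have := act_uniq h (act_dmap (cid X) a) (homotopic_refl a).
by move=> e; apply: homotopic_trans e _; apply: homotopic_eq.
Qed.
End KP.

Lemma d_iso_sym X Y (F : dhom X Y) (G : dhom Y X) :
  dcomp G F (dmap (cid X)) -> dcomp F G (dmap (cid Y)) -> d_iso F /\ d_iso G.
Proof. by move=> h1 h2; split; [exists G|exists F]. Qed.

(** The composite G F = 1 makes the forward leg of F injective on cohomology, and F G = 1 makes it
    surjective. *)
Lemma d_iso_qis X Y (F : dhom X Y) : d_iso F -> qis (dfwd F).
Proof.
move=> [G [[V [u [v [w [qw h1 h2 h3]]]]] [V' [u' [v' [w' [qw' h1' h2' h3']]]]]]].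
have id_w Z Z' (f : cmap Z Z') : homotopic (ccomp (dback (dmap (cid Z'))) f) f.
  exact: homotopic_eq.
have qu : qis u.
  apply: (qis_compK (@dback_qis _ _ _ F)); apply: qis_homot (homotopic_sym h1) _.
  exact: qis_homot (homotopic_sym (id_w _ _ w)) qw.
apply/qisP; split.
  have [_ su] := (qisP u).1 qu; apply: (hinj_sur su).
  apply: hinj_homot (homotopic_sym h2) _.
  apply: hinj_comp; last by have [] := (qisP _).1 (@dback_qis _ _ _ G).
  apply: (@hinj_compK _ _ _ _ v (dfwd G)); apply: hinj_homot (homotopic_sym h3) _.
  have [iw _] := (qisP w).1 qw.
  by apply: hinj_homot iw; apply: homotopic_sym; apply: id_w.
apply: (@hsur_compK _ _ _ _ v' (dfwd F)).
apply: hsur_homot (homotopic_sym h3') _.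
have [_ sw] := (qisP w').1 qw'.
by apply: hsur_homot sw; apply: homotopic_sym; apply: id_w.
Qed.

Lemma d_iso_act_qis W X Y (F : dhom X Y) (a : cmap W X) (b : cmap W Y) :
  d_iso F -> act F a b -> qis a -> qis b.
Proof.
move=> iF [a' [h1 h2]] qa; apply: qis_homot h2 _; apply: qis_comp (d_iso_qis iF).
by apply: (qis_compK (@dback_qis _ _ _ F)); apply: qis_homot (homotopic_sym h1) _.
Qed.

Lemma dcomp_dmap X Y Z (g : cmap Y Z) (f : cmap X Y) (h : cmap X Z) :
  homotopic (ccomp g f) h -> dcomp (dmap g) (dmap f) (dmap h).
Proof.
move=> e; exists X, (cid X), f, (cid X); split; first exact: qis_id.
- exact: homotopic_refl.
- exact: homotopic_eq.
- exact: homotopic_trans e (homotopic_eq _).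
Qed.

Lemma d_iso_dmap X Y (f : cmap X Y) (g : cmap Y X) :
  homotopic (ccomp g f) (cid X) -> homotopic (ccomp f g) (cid Y) -> d_iso (dmap f).
Proof. by move=> h1 h2; exists (dmap g); split; apply: dcomp_dmap. Qed.

Lemma qis_d_iso X Y (f : cmap X Y) (qf : qis f) :
  d_iso (dmap f) /\ d_iso (Roof qf (cid X)).
Proof.
apply: d_iso_sym.
  exists X, (cid X), (cid X), (cid X).
  by split; [exact: qis_id| | |]; apply: homotopic_eq.
exists X, (cid X), (cid X), f.
by split; [exact: qf| | |]; apply: homotopic_eq.
Qed.

Definition cinl X Y : cmap X (csum X Y).
Proof.
refine (@Cmap R X (csum X Y) (fun i => linl (X i) (Y i)) _).
by move=> i x; rewrite !linlE /= /csum_d_fun /= linear0.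
Defined.
Definition cfst X Y : cmap (csum X Y) X.
Proof. by refine (@Cmap R (csum X Y) X (fun i => lfst (X i) (Y i)) _). Defined.

Section AddCover.
Variables (X Z : cpx R) (aZ : Add X Z) (tX : proj_two_term X).

Lemma ccop_tt (I : choiceType) : proj_two_term (ccop I X).
Proof.
case: tX => pX zX; split=> [i|i n1 n2 x]; first exact: proj_cop.
by apply/copowerP => k; apply: zX.
Qed.

(** Z is a summand of copies of X in the derived category only; as these copies are K-projective,
    the projection to Z is represented by a chain map r. *)
Lemma Add_cover : exists (I : choiceType) (r : cmap (ccop I X) Z),
  forall W, Kproj W -> forall a : cmap W Z, exists b : cmap W (ccop I X), homotopic (ccomp r b) a.
Proof.
have [I [Y' [F [G [GF FG]]]]] := aZ.
have kI := tt_Kproj (ccop_tt I).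
have [g aG] := act_ex kI G (cid (ccop I X)).
exists I, (ccomp (cfst Z Y') g) => W kW a.
have [b aF] := act_ex kW F (ccomp (cinl Z Y') a).
exists b; have h1 := act_inv kW GF aF.
have h2 : act G b (ccomp g b).
  apply: act_homot (act_pre b aG) (homotopic_eq _) (homotopic_refl _) => i x //.
have e := act_uniq kW h2 h1 (homotopic_refl b).
have e2 := homotopic_compl (cfst Z Y') e.
apply: homotopic_trans (homotopic_trans _ e2) _; first exact: homotopic_eq.
by apply: homotopic_eq => i x; rewrite /= linlE.
Qed.
End AddCover.

Section RetractAdd.
Variables (X T : cpx R) (I : choiceType) (k : cmap T (ccop I X)) (r : cmap (ccop I X) T).
Hypothesis rk : homotopic (ccomp r k) (cid T).
Let C := cone k.

(* Since k is split, ccop I X = T + cone k in the derived category. *)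
Definition split_map : cmap (ccop I X) (csum T C).
Proof.
refine (@Cmap R (ccop I X) (csum T C) (fun i => lpair (r i) (linr (T (i + 1)) (ccop I X i))) _).
move=> i x; rewrite !lpairE; congr pair; first exact: cfunP.
by rewrite /= /cone_d_fun /= !linear0 add0r.
Defined.

Lemma split_mapE i x : split_map i x = (r i x, (0, x)).
Proof. by rewrite /split_map /= !lpairE. Qed.

Lemma cdD Y i (x y : Y i) : cdiff Y i (x + y) = cdiff Y i x + cdiff Y i y.
Proof. exact: linearD. Qed.
Lemma cdN Y i (x : Y i) : cdiff Y i (- x) = - cdiff Y i x.
Proof. exact: linearN. Qed.
Lemma cdB Y i (x y : Y i) : cdiff Y i (x - y) = cdiff Y i x - cdiff Y i y.
Proof. exact: linearB. Qed.

(** As r k is homotopic to the identity, the first entry u of a cocycle (u, v) of the cone is a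
    boundary, with primitive - (r v + h u); the preimages are built from it. *)
Lemma split_qis : qis split_map.
Proof.
case: rk => h hh; apply/qisP; split.
  move=> i x dx [[y [u v]] /=]; rewrite lpairE linrE /csum_d_fun /= /cone_d_fun /=.
  case=> ry; rewrite -[0]oppr0 => /oppr_inj /esym du xe.
  have e1 : u = cdiff T i (y - (r i v + h i u)).
    have := hh i u; rewrite du linear0 addr0 /= => e.
    have e3 : r (i + 1) (k (i + 1) u) = cdiff T i y - cdiff T i (r i v).
      by rewrite -ry xe linearD cfunP addrK.
    rewrite linearB linearD opprD addrA -e3 -e.
    by rewrite opprB addrCA subrr addr0.
  exists (k i (y - (r i v + h i u)) + v); apply: esym; apply: etrans (@cdD (ccop I X) i _ _) _; rewrite -cfunP -e1 xe; exact: erefl.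
move=> i [y [u v]] e.
have dy : cdiff T (i + 1) y = 0 := congr1 fst e.
have du : cdiff T (i + 1 + 1) u = 0.
  by apply: oppr_inj; rewrite oppr0; exact: (congr1 (fun w => w.2.1) e).
have kv : k (i + 1 + 1) u + cdiff (ccop I X) (i + 1) v = 0 := congr1 (fun w => w.2.2) e.
pose u' := r (i + 1) v + h (i + 1) u.
have eu : u = - cdiff T (i + 1) u'.
  have := hh (i + 1) u; rewrite du linear0 addr0 /= => e2.
  have e3 : r (i + 1 + 1) (k (i + 1 + 1) u) = - cdiff T (i + 1) (r (i + 1) v).
    by rewrite -(cfunP r) -(addr0_eq kv) linearN opprK.
  by rewrite /u' cdD -e2 e3 addrA addrN sub0r opprK.
pose x1 := v - k (i + 1) u'.
have dx1 : cdiff (ccop I X) (i + 1) x1 = 0.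
  have ku : k (i + 1 + 1) u = - k (i + 1 + 1) (cdiff T (i + 1) u') by rewrite {1}eu linearN.
  rewrite /x1 cdB -cfunP -[RHS]kv ku; exact: addrC.
pose t := y - r (i + 1) x1.
have dt : cdiff T (i + 1) t = 0 by rewrite /t cdB dy -cfunP dx1 linear0 subr0.
have ht := hh i t; rewrite dt linear0 addr0 in ht.
exists (x1 + k (i + 1) t), (- h i t, (u' - t, 0)); split.
  by rewrite cdD dx1 -cfunP dt linear0 addr0.
transitivity (r (i + 1) (x1 + k (i + 1) t) + cdiff T i (- h i t),
  (0 - cdiff T (i + 1) (u' - t), x1 + k (i + 1) t + (k (i + 1) (u' - t) + cdiff (ccop I X) i 0))).
  by rewrite split_mapE.
congr pair; [|congr pair].
- rewrite cdN -ht linearD opprB /t addrA [LHS]addrAC addrK /=.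
  by rewrite addrC subrK.
- transitivity (- (cdiff T (i + 1) u' - cdiff T (i + 1) t)); last by rewrite dt subr0 -eu.
  by rewrite [LHS]sub0r; congr (- _); exact: cdB.
- rewrite linear0 addr0.
  transitivity (x1 + k (i + 1) t + (k (i + 1) u' - k (i + 1) t)); first by congr (_ + _); exact: linearB.
  by rewrite /x1 addrA addrAC addrK subrK.
Qed.

Lemma retract_Add : Add X T.
Proof.
exists I, C; exists (Roof split_qis (cid _)).
by have [] := qis_d_iso split_qis.
Qed.
End RetractAdd.
End Act.

(** * The middle term of a triangle as a two-term complex *)

Section Resolution.
Variable R : pzRingType.
Implicit Types (X Y Z V W : cpx R) (M N P Q : lmodType R).
Let S : cpx R := stalk R^o.

Lemma two_term_tt P Q (s : {linear P -> Q}) : projective P -> projective Q -> proj_two_term (two_term s).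
Proof.
move=> pP pQ; split=> [[[|n]|[|n]]|[[|n]|[|n]]] //=; try exact: proj_zero.
- by move=> _ _ x; apply: zero_mod0.
- by move=> _ _ x; apply: zero_mod0.
Qed.

Lemma stalk_tt : proj_two_term S.
Proof. by apply: two_term_tt; [exact: proj_zero|exact: proj_reg]. Qed.

Section Theta.
Variables (P1 Q1 : lmodType R) (s1 : {linear P1 -> Q1}) (X' Y' : cpx R) (f : cmap X' Y').
Variables (al : cmap S X') (c : cmap (two_term s1) (cone f)) (om : cmap (two_term s1) (shift S)).
Hypotheses (pP : projective P1) (pQ : projective Q1) (qal : qis al) (qc : qis c).
Hypothesis hom : homotopic (ccomp (shift_map al) om) (ccomp (cone_out f) c).

(* The cocone of om : P1[1] -> R[1], in degrees -1 and 0. *)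
Definition eta : {linear P1 -> R^o} := om (Negz 0).
Definition cocone : {linear P1 -> (R^o * Q1)%type} := lpair (\- eta) s1.

Lemma coconeE p : cocone p = (- eta p, s1 p).
Proof. exact: lpairE. Qed.

(** The five lemma for the triangles R -> [cocone] -> s1 and X' -> Y' -> cone f, carried out on
    elements: [al] and c are quasi-isomorphisms, so the map between the middle terms is one. *)
Lemma theta_ex : exists th : cmap (two_term cocone) Y', qis th /\
  forall a : R^o, th (Posz 0) (a, 0) = f (Posz 0) (al (Posz 0) a).
Proof.
have tW : proj_two_term (two_term cocone) by apply: two_term_tt => //; apply: proj_pair => //; exact: proj_reg.
have tT := @two_term_tt _ _ s1 pP pQ.
have [h2' [h1' [e2 e1]]] := tt_homotopicP tT hom.
pose h2 : {linear P1 -> X' (Negz 0)} := h2'.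
pose h1 : {linear Q1 -> X' (Posz 0)} := h1'.
pose c1m : {linear P1 -> X' (Posz 0)} := lfst _ _ \o c (Negz 0).
pose c2m : {linear P1 -> Y' (Negz 0)} := lsnd _ _ \o c (Negz 0).
pose c1 : {linear Q1 -> X' (Posz 1)} := lfst _ _ \o c (Posz 0).
pose c2 : {linear Q1 -> Y' (Posz 0)} := lsnd _ _ \o c (Posz 0).
have E2 p : al (Posz 0) (eta p) - c1m p = - cdiff X' (Negz 0) (h2 p) + h1 (s1 p) := e2 p.
have E1 q : c1 q = cdiff X' (Posz 0) (h1 q).
  apply: oppr_inj; transitivity (al (Posz 1) (om (Posz 0) q) - c1 q).
    by rewrite (zero_mod0 (om (Posz 0) q)) linear0 sub0r.
  exact: (e1 q).
have C2 p : c2 (s1 p) = f (Posz 0) (c1m p) + cdiff Y' (Negz 0) (c2m p) :=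
  congr1 snd (@cfunP _ _ _ c (Negz 0) p).
have C3 q : f (Posz 1) (c1 q) + cdiff Y' (Posz 0) (c2 q) = 0.
  rewrite -[LHS](congr1 snd (@cfunP _ _ _ c (Posz 0) q)).
  by rewrite (_ : cdiff (two_term s1) (Posz 0) q = 0) ?linear0.
have tS := stalk_tt.
have /qisP[alI alS] := qal; have /qisP[cI cS] := qc.
have alI0 (a : R^o) : (exists y, al (Posz 0) a = cdiff X' (Negz 0) y) -> a = 0.
  by case=> y hy; have [|z ->] := alI (Negz 0) a erefl _; first by exists y.
have alS0 (x : X' (Posz 0)) : cdiff X' (Posz 0) x = 0 ->
    exists a x', al (Posz 0) a + cdiff X' (Negz 0) x' = x.
  by move=> dx; have [a [z [_ e]]] := alS (Negz 0) x dx; exists a, z.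
have alSm (x : X' (Negz 0)) : cdiff X' (Negz 0) x = 0 -> exists x', x = cdiff X' (Negz 1) x'.
  move=> dx; have [a [z [_ <-]]] := alS (Negz 1) x dx; exists z.
  by rewrite (zero_mod0 a) linear0 add0r.
have cS0 (y : Y' (Posz 0)) : cdiff Y' (Posz 0) y = 0 -> exists q x z,
    c1 q = cdiff X' (Posz 0) x /\ c2 q + (f (Posz 0) x + cdiff Y' (Negz 0) z) = y.
  move=> dy; have [|q [[x z] [_ e]]] := cS (Negz 0) (0, y).
    by rewrite /= /cone_d_fun /= !linear0 add0r; congr pair.
  exists q, x, z; split; last exact: (congr1 snd e).
  exact: subr0_eq (congr1 fst e).
have cSm (x0 : X' (Posz 0)) (y : Y' (Negz 0)) : cdiff X' (Posz 0) x0 = 0 ->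
    f (Posz 0) x0 + cdiff Y' (Negz 0) y = 0 -> exists p x z, [/\ s1 p = 0,
    c1m p - cdiff X' (Negz 0) x = x0 & c2m p + (f (Negz 0) x + cdiff Y' (Negz 1) z) = y].
  move=> dx dy; have [|p [[x z] [sp e]]] := cS (Negz 1) (x0, y).
    by rewrite /= /cone_d_fun /= [X in - X]dx oppr0; congr pair.
  by exists p, x, z; split; [|exact: (congr1 fst e)|exact: (congr1 snd e)].
have cI0 q x z : c1 q = - cdiff X' (Posz 0) x -> c2 q = f (Posz 0) x + cdiff Y' (Negz 0) z ->
    exists p, q = s1 p.
  move=> h3 h4; apply: (cI (Negz 0) q) => //; exists (x, z).
  by rewrite [LHS]surjective_pairing; congr pair.
have cIm p x z : s1 p = 0 -> c1m p = - cdiff X' (Negz 0) x ->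
    c2m p = f (Negz 0) x + cdiff Y' (Negz 1) z -> p = 0.
  move=> sp h3 h4; have [|u ->] := cI (Negz 1) p sp; last by [].
  by exists (x, z); rewrite [LHS]surjective_pairing; congr pair.
have fd (x : X' (Negz 0)) : f (Posz 0) (cdiff X' (Negz 0) x) = cdiff Y' (Negz 0) (f (Negz 0) x).
  exact: (@cfunP _ _ _ f (Negz 0)).
have fd1 (x : X' (Negz 1)) : f (Negz 0) (cdiff X' (Negz 1) x) = cdiff Y' (Negz 1) (f (Negz 1) x).
  exact: (@cfunP _ _ _ f (Negz 1)).
have fd0 (x : X' (Posz 0)) : f (Posz 1) (cdiff X' (Posz 0) x) = cdiff Y' (Posz 0) (f (Posz 0) x).
  exact: (@cfunP _ _ _ f (Posz 0)).
have dal a : cdiff X' (Posz 0) (al (Posz 0) a) = 0.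
  rewrite -[LHS](@cfunP _ _ _ al (Posz 0) a); exact: linear0.
have Kp p : f (Posz 0) (al (Posz 0) (eta p)) =
    f (Posz 0) (c1m p) - cdiff Y' (Negz 0) (f (Negz 0) (h2 p)) + f (Posz 0) (h1 (s1 p)).
  have -> : al (Posz 0) (eta p) = - cdiff X' (Negz 0) (h2 p) + h1 (s1 p) + c1m p by rewrite -E2 subrK.
  rewrite 2!linearD linearN fd.
  by rewrite addrC addrA.
move: cI cS alI alS hom qal qc tS; clearbody c1 c2 c1m c2m h1 h2; clear h1' h2' e1 e2 => cI cS alI alS _ _ _ tS.
(* On R the map is f al, on s1 the Y'-component of c; adding f of the homotopy h makes it commute
   with the differentials. *)
pose f1 : {linear P1 -> Y' (Negz 0)} := c2m \+ (f (Negz 0) \o h2).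
pose f0 : {linear (R^o * Q1)%type -> Y' (Posz 0)} :=
  ((f (Posz 0) \o al (Posz 0) \o lfst _ _) \+ (c2 \o lsnd _ _)) \+ (f (Posz 0) \o h1 \o lsnd _ _).
have ch p : f0 (cocone p) = cdiff Y' (Negz 0) (f1 p).
  rewrite coconeE /= !linearN Kp C2 cdD.
  by rewrite opprD opprB addrAC subrK addrA subrK addrC.
have d0 u : cdiff Y' (Posz 0) (f0 u) = 0.
  rewrite /= !cdD -!fd0 dal linear0 -E1 [X in X + _ = _]add0r.
  by apply: etrans (C3 u.2); exact: addrC.
have [th [th1 th0]] := @tt_cmap _ (two_term cocone) Y' f1 f0 tW ch d0.
exists th; split; last first.
  by move=> a; rewrite th0 /= !linear0 !addr0.
apply/qisP; split.
  case=> [n|[|[|n]]] x dx [y e].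
  - have [n1 n2] := int1_neq n; exists 0; by rewrite linear0 (tW.2 _ n1 n2 x).
  - case: x dx e => [a q] _ e0.
    have e : f (Posz 0) (al (Posz 0) a) + c2 q + f (Posz 0) (h1 q) = cdiff Y' (Negz 0) y.
      by rewrite -[RHS]e0; exact/esym/th0.
    have [||p qp] := cI0 q (- h1 q - al (Posz 0) a) y.
    - by rewrite E1 cdB cdN dal subr0 opprK.
    - rewrite -e linearB linearN [RHS]addrC -addrA addNKr.
      by rewrite [RHS]addrAC [X in X + _]subrr add0r.
    have ey : f (Posz 0) (al (Posz 0) (a + eta p)) = cdiff Y' (Negz 0) (y - f1 p).
      rewrite cdB -e -ch qp coconeE /= !linearN !linearD.
      by rewrite /= opprK [RHS]addrACA [X in _ = _ + X]subrr [RHS]addr0 [RHS]addrACA [X in _ = _ + X]subrr addr0.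
    have [|p0 [x [z [sp0 ex _]]]] := cSm (al (Posz 0) (a + eta p)) (- (y - f1 p)) (dal _).
      by rewrite cdN ey; exact: subrr.
    have h : eta p0 = a + eta p.
      apply: subr0_eq; apply: alI0; exists (x - h2 p0); rewrite cdB linearB -ex.
      have := E2 p0; rewrite sp0 linear0 addr0 => /eqP; rewrite subr_eq => /eqP ->.
      by rewrite opprB [LHS]addrC addrACA [X in _ + X]addNr addr0.
    exists (p - p0); rewrite /= coconeE !linearB sp0 subr0 h qp; congr pair.
    by rewrite /= opprK addrCA addNr addr0.
  - have sp : s1 x = 0 := congr1 snd (etrans (esym (coconeE x)) dx).
    have ep : eta x = 0 by apply: oppr_inj; rewrite oppr0; exact: (congr1 fst (etrans (esym (coconeE x)) dx)).
    exists 0; rewrite linear0; apply: (cIm _ (- h2 x) y sp).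
      rewrite cdN opprK; have := E2 x; rewrite sp ep !linear0 sub0r addr0; exact: oppr_inj.
    rewrite linearN; have e0 : c2m x + f (Negz 0) (h2 x) = cdiff Y' (Negz 1) y.
      by rewrite -[RHS]e; exact/esym/th1.
    by rewrite -e0 [RHS]addrC addrK.
  - have [n1 n2] := int2_neq n; exists 0; by rewrite linear0 (tW.2 _ n1 n2 x).
have oth i (y : Y' (i + 1)) : i + 1 <> Negz 0 -> i + 1 <> Posz 0 -> cdiff Y' (i + 1) y = 0 ->
    exists x z, cdiff (two_term cocone) (i + 1) x = 0 /\ th (i + 1) x + cdiff Y' i z = y.
  move=> n1 n2 dy; have [|q [[x z] [_ e]]] := cS i (0, y).
    by rewrite /= /cone_d_fun /= !linear0 add0r; congr pair.
  have e1 : - cdiff X' (i + 1) x = 0.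
    by apply: etrans (congr1 fst e); rewrite (tT.2 _ n1 n2 q) linear0; exact/esym/add0r.
  have e2 : f (i + 1) x + cdiff Y' i z = y.
    by apply: etrans (congr1 snd e); rewrite (tT.2 _ n1 n2 q) linear0; exact/esym/add0r.
  have [|a' [x' [_ ex]]] := alS i x; first by apply: oppr_inj; rewrite oppr0.
  exists 0, (f i x' + z); split; first exact: linear0.
  rewrite linear0 [LHS]add0r cdD -e2 -ex linearD (tS.2 _ n1 n2 a') !linear0 cfunP.
  by congr (_ + _); rewrite [RHS]add0r.
case=> [n|[|[|n]]] y dy.
- by have [n1 n2] := int1_neq n; apply: oth.
- have [q [x [z [h3 h4]]]] := cS0 y dy.
  have [|a [x' e]] := alS0 (x - h1 q); first by rewrite cdB -E1 h3; exact: subrr.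
  exists (a, q), (f (Negz 0) x' + z); split=> //.
  transitivity (f (Posz 0) (al (Posz 0) a) + c2 q + f (Posz 0) (h1 q) + cdiff Y' (Negz 0) (f (Negz 0) x' + z)).
    by congr (_ + _); exact: th0.
  rewrite -h4 -[x](subrK (h1 q)) -e cdD -fd !linearD.
  by rewrite -!addrA [RHS]addrCA; congr (_ + (_ + _)); exact: addrCA.
- have [|p [x [z [sp h3 h4]]]] := cSm 0 y (linear0 _); first by rewrite linear0 add0r.
  have e : al (Posz 0) (eta p) = cdiff X' (Negz 0) (x - h2 p).
    have := E2 p; rewrite sp linear0 addr0 (subr0_eq h3) => /eqP; rewrite subr_eq => /eqP ->.
    by rewrite cdB addrC.
  have ep : eta p = 0 by apply: alI0; exists (x - h2 p).
  have [|x' ex] := alSm (x - h2 p); first by rewrite -e ep linear0.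
  exists p, (f (Negz 1) x' + z); split; first by rewrite [LHS]coconeE ep sp oppr0.
  transitivity (c2m p + f (Negz 0) (h2 p) + cdiff Y' (Negz 1) (f (Negz 1) x' + z)).
    by congr (_ + _); exact: th1.
  rewrite -h4 cdD -fd1 -ex linearB.
  by rewrite -!addrA; congr (_ + _); rewrite [LHS]addrCA addNKr.
- by have [n1 n2] := int2_neq n; apply: oth.
Qed.
End Theta.
End Resolution.

Section AddTwoTerm.
Variables (R : pzRingType) (P Q T P' Q' : lmodType R) (s : {linear P -> Q}) (w : {linear P' -> Q'}).
Variables (I : choiceType) (k : cmap (two_term w) (ccop I (two_term s))) (r : cmap (ccop I (two_term s)) (two_term w)).
Hypotheses (rk : homotopic (ccomp r k) (cid (two_term w))) (pP : projective P') (pQ : projective Q').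

Lemma Add_homotopy : exists h : {linear Q' -> P'},
  (forall p, r (Negz 0) (k (Negz 0) p) - p = h (w p)) /\
  (forall y, r (Posz 0) (k (Posz 0) y) - y = w (h y)).
Proof.
have [h2 [h1 [e2 e1]]] := tt_homotopicP (two_term_tt w pP pQ) rk.
exists h1; split=> [p|y]; last exact: (e1 y).
apply: etrans (e2 p) _; exact: add0r.
Qed.

(** D-classes pass to summands up to homotopy: the extension obtained through copies of s is off by
    the homotopy, which f h corrects. *)
Lemma Add_D X : Dclass s X -> Dclass w X.
Proof.
move=> DX f; have [h [e2 e1]] := Add_homotopy.
have [g hg] := @D_cop _ _ _ s I _ DX (f \o r (Negz 0)).
exists ((g \o k (Posz 0)) \- (f \o h)) => p.
have e : k (Posz 0) (w p) = cop_map s (k (Negz 0) p) := @cfunP _ _ _ k (Negz 0) p.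
by rewrite /= e -e2 linearB opprB [g _]hg /= addrC subrK.
Qed.

Lemma Add_Gen (p : {linear Q -> T}) (C : lmodType R) (c : {linear Q' -> C}) :
  projective_presentation s p -> exact w c -> onto c -> Gen T C.
Proof.
move=> ps wc co; have [h [e2 e1]] := Add_homotopy.
have [_ _ ep po] := cop_pres ps I.
have [|g hg] := @fact_quo _ _ _ _ (cop_map p) (c \o r (Posz 0)) po.
  move=> x /ep [y <-]; apply/wc; exists (r (Negz 0) y).
  exact/esym/(@cfunP _ _ _ r (Negz 0) y).
exists I, g => x; have [y <-] := co x; exists (cop_map p (k (Posz 0) y)).
rewrite hg; apply: subr0_eq; transitivity (c (r (Posz 0) (k (Posz 0) y) - y)); first by rewrite linearB.
by apply/wc; exists (h y); exact/esym/e1.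
Qed.
End AddTwoTerm.

Section MinimalData.
Variable R : pzRingType.
Implicit Types (X Y Z V W : cpx R) (M N P Q : lmodType R).
Let S : cpx R := stalk R^o.

(** The data fix s0 and phi only up to isomorphism of the derived category; this gives a chain-level
    model, in which phi is the inclusion of R into P1 -> R + Q1. *)
Lemma data_resolution P1 Q1 (s1 : {linear P1 -> Q1}) (s0 : cpx R)
    (phi : dhom S s0) (psi : dhom s0 (two_term s1)) (omega : dhom (two_term s1) (shift S)) :
  projective P1 -> projective Q1 -> distinguished phi psi omega ->
  exists (e : {linear P1 -> R^o}) (w : {linear P1 -> (R^o * Q1)%type})
    (th : cmap (two_term w) s0) (ph : cmap S (two_term w)),
  [/\ forall p, w p = (- e p, s1 p), qis th, (forall a : R^o, ph (Posz 0) a = (a, 0)) &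
      act phi (cid S) (ccomp th ph)].
Proof.
move=> pP pQ [X' [Y' [f [a [b [c [[ia ib ic] [[H [bH aH]] _ _]]]]]]]].
have tT := two_term_tt s1 pP pQ; have kT := tt_Kproj tT.
have tS : proj_two_term S := stalk_tt R; have kS := tt_Kproj tS.
have [al aal] := act_ex kS a (cid S).
have [ch ach] := act_ex kT c (cid (two_term s1)).
have qal := d_iso_act_qis ia aal (@qis_id _ _).
have qch := d_iso_act_qis ic ach (@qis_id _ _).
have [om hom] := (kT _ _ _ (qis_shift qal)).1 (ccomp (cone_out f) ch).
have [th' [qth' e']] := theta_ex pP pQ qal qch hom.
have tW : proj_two_term (two_term (cocone om)).
  by apply: two_term_tt => //; apply: proj_pair => //; exact: proj_reg.
have kW := tt_Kproj tW.
have [b' [b'b bb']] := ib.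
have [th ath] := act_ex kW b' th'.
have ib' := (d_iso_sym b'b bb').2.
have qth := d_iso_act_qis ib' ath qth'.
have [|x|ph [_ ph0]] := @tt_cmap _ S (two_term (cocone om)) (zero_map _ _) (linl R^o Q1) tS.
- move=> x; rewrite (zero_mod0 x) !linear0 //.
- by [].
have ph1 (x : R^o) : ph (Posz 0) x = (x, 0) by rewrite ph0 linlE.
exists (eta om), (cocone om), th, ph; split=> //; first exact: coconeE.
have [fc aphi] := act_ex kS phi (cid S).
have a1 := act_comp kS aH aal (act_dmap f al).
have [bf abf] := act_ex kS b fc.
have a2 := act_comp kS bH aphi abf.
have e3 := act_uniq kS a2 a1 (homotopic_refl _).
have a3 : act b fc (ccomp f al) by apply: act_homot abf (homotopic_refl _) e3.
have a4 := act_inv kS b'b a3.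
have a5 := act_pre ph ath.
apply: act_homot aphi (homotopic_refl _) _.
apply: (act_uniq kS a4 a5).
apply: homotopic_sym; apply: (@tt_homotopic _ _ _ _ _ (zero_map _ _) (zero_map _ _) tS) => x.
  by rewrite (zero_mod0 x) !linear0 ?addr0 ?subr0.
rewrite linear0 /= ph1 e'; exact: subrr.
Qed.

(** With T0 = Coker w, T1 = Coker s1 and x0 the class of (1, 0), the form of w makes T1 the cokernel
    of R -> T0 and lets x0 reach every element of a module in D_{s1}. This gives D_{s1} = Gen T, and
    [afrak_perp] applies. *)
Lemma data_afrak T P1 Q1 (s1 : {linear P1 -> Q1}) :
  minimal_silting_data T s1 -> Xclass s1 = afrak (Gen T).
Proof.
move=> [P [Q [s [s0 [phi [psi [omega [[[[t ps] sG] pP pQ] [A0 A1 ds la lm]]]]]]]]].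
have [e [w [th [ph [wE qth phE aphi]]]]] := data_resolution pP pQ ds.
have [psP psQ es so] := ps.
have tG : tors (Gen T) by apply: (Gen_tors ps) => X; rewrite sG.
have tS : proj_two_term S := stalk_tt R; have kS := tt_Kproj tS.
have ts := two_term_tt s psP psQ.
have pW : projective (R^o * Q1)%type by apply: proj_pair => //; exact: proj_reg.
have tW := two_term_tt w pP pW; have kW := tt_Kproj tW.
have t1 := two_term_tt s1 pP pQ.
have [I0 [r0 c0]] := Add_cover A0 ts; have [be rbe] := c0 _ kW th.
have [r0' hr0] := (tt_Kproj (ccop_tt ts I0) qth).1 r0.
have rk0 : homotopic (ccomp r0' be) (cid (two_term w)).
  apply: (kW _ _ _ qth).2; apply: (@homotopic_trans _ _ _ _ (ccomp r0 be)).
    apply: (@homotopic_trans _ _ _ _ (ccomp (ccomp th r0') be)); first exact: homotopic_eq.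
    exact: homotopic_compr.
  apply: homotopic_trans rbe _; exact: homotopic_eq.
have [I1 [r1 c1]] := Add_cover A1 ts; have [k1 rk1] := c1 _ (tt_Kproj t1) (cid _).
have D1 (X : lmodType R) : Gen T X -> Dclass s1 X by rewrite -sG; apply: (Add_D rk1).
have [T0 [pi [pio piE]]] := quo_ex (im_submod w).
have wpi : exact w pi by exact: piE.
have [T1 [q1 [q1o q1E]]] := quo_ex (im_submod s1).
have p1 : projective_presentation s1 q1 by split.
pose x0 := pi (1, 0).
have [|c hc] := @fact_quo _ _ _ _ pi (q1 \o lsnd R^o Q1) pio.
  by move=> u /wpi [p <-]; rewrite wE /=; apply/q1E; exists p.
have piR (a : R^o) : pi (a, 0) = (a : R) *: x0.
  rewrite /x0 -linearZ; congr (pi _); congr pair; first by rewrite /= -[LHS]mulr1.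
  by rewrite /= scaler0.
have G0 : Gen T T0 := Add_Gen rk0 pP pW ps wpi pio.
have co : onto c.
  by move=> y; have [q <-] := q1o y; exists (pi (0, q)); rewrite hc.
have ce : exact (elt x0) c.
  move=> z; split=> [|[a <-]]; last first.
    by rewrite mklE -piR hc /= linear0.
  have [[a q] <-] := pio z; rewrite hc /= => /q1E [p hp].
  exists (a + e p); rewrite mklE -piR; apply: subr0_eq; rewrite -linearB; apply/wpi.
  exists (- p); rewrite wE !linearN opprK hp; congr pair; last by rewrite /= sub0r.
  by rewrite /= [RHS]addrC addKr.
have ap (X : lmodType R) : Dclass s1 X -> forall x : X, exists g : {linear T0 -> X}, g x0 = x.
  move=> DX x; have [g hg] := DX (elt x \o e).
  have [|g' hg'] := @fact_quo _ _ _ _ pi (lcopair (elt x) g) pio.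
    by move=> u /wpi [p <-]; rewrite wE lcopairE /= linearN hg /= addNr.
  by exists g'; rewrite hg' lcopairE /= elt1 linear0 addr0.
have GD : Dclass s1 = Gen T.
  apply/funext => X; apply/propext; split=> [DX|]; last exact: D1.
  apply/GenP => x; have [g <-] := ap X DX x; apply: tr_map; exact: ((GenP T T0).1 G0).
apply/funext => X; apply/propext.
apply: (iff_trans (Xclass_perp X p1)); rewrite GD; apply: iff_sym.
apply: (afrak_perp tG G0 co ce) => [Y GY|ee ex].
  by apply: ap; rewrite GD.
(* Minimality of phi has to yield that of x0. An endomorphism ee of T0 fixing x0 lifts to a chain
   map ep with ep ph homotopic to ph, hence to h on s0 with h phi = phi; so ep is a
   quasi-isomorphism, and ee is onto. *)
have [ep0 hep0] := pW _ _ pi (ee \o pi) pio.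
have [|ep1 hep1] := @proj_exact_lift _ _ _ _ _ w pi (ep0 \o w) pP wpi.
  by move=> x; rewrite /= hep0 /= (_ : pi (w x) = 0) ?linear0 //; apply/wpi; exists x.
have [|//|ep [_ hep]] := @tt_cmap _ (two_term w) (two_term w) ep1 ep0 tW; first by move=> x; rewrite /= hep1.
have [p hp] : exists p, w p = ep0 (1, 0) - (1, 0).
  by apply/wpi; rewrite linearB hep0 /= ex; exact: subrr.
have eph : homotopic (ccomp ep ph) ph.
  apply: (@tt_homotopic _ S (two_term w) _ _ (zero_map _ _) (elt p : {linear R^o -> P1}) tS) => x.
    by rewrite (zero_mod0 x) !linear0 ?addr0 ?subr0.
  rewrite /= !phE hep -[RHS]/(w (elt p x)) mklE linearZ hp.
  have -> : (x, 0) = (x : R) *: ((1, 0) : (R^o * Q1)%type).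
    by congr pair; rewrite /= ?scaler0 // -[LHS]mulr1.
  by rewrite linearZ; exact/esym/scalerBr.
pose h := Roof qth (ccomp th ep).
have ah : act h th (ccomp th ep) by exists (cid _); split; apply: homotopic_eq.
have hh : dcomp h phi phi.
  apply: (act_dcomp aphi _ aphi); apply: act_homot (act_pre ph ah) (homotopic_refl _) _.
  apply: homotopic_trans (homotopic_compl th eph); exact: homotopic_eq.
have qh := d_iso_qis (lm h hh).
have /qisP[_ sep] := qis_compK qth qh.
move=> y; have [u <-] := pio y; have [x [z [_ xz]]] := sep (Negz 0) u erefl.
exists (pi x); have -> : ee (pi x) = pi (ep0 x) by rewrite hep0.
apply: subr0_eq; rewrite -linearB; apply/wpi; exists (- z).
rewrite linearN -xz hep; apply/esym; rewrite opprD addrA.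
by rewrite [X in X - _ = _]subrr [LHS]sub0r.
Qed.
End MinimalData.

(** * Existence of minimal silting data *)

Section Existence.
Variable R : pzRingType.
Implicit Types (X Y Z V W : cpx R) (M N P Q : lmodType R).
Let S : cpx R := stalk R^o.

Lemma two_term_Add P Q (T : lmodType R) (s : {linear P -> Q}) (p : {linear Q -> T})
    (P' Q' C : lmodType R) (t : {linear P' -> Q'}) (c : {linear Q' -> C}) :
  projective_presentation s p -> Dclass s = Gen T -> projective_presentation t c ->
  Gen T C -> (forall X : lmodType R, Gen T X -> Dclass t X) -> Add (two_term s) (two_term t).
Proof.
move=> ps sG pt GC GD; have [psP psQ _ _] := ps; have [ptP ptQ _ _] := pt.
have [I [w [i0 [r1 [r0 [h [e1 e2 e3 e4]]]]]]] := D_add ps sG pt GC GD.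
have tt1 := two_term_tt t ptP ptQ.
have tt2 := ccop_tt (two_term_tt s psP psQ) I.
have [|//|k [k1 k0]] := @tt_cmap _ (two_term t) (ccop I (two_term s)) w i0 tt1.
- by move=> x; rewrite -[LHS]e1.
- by move=> x; apply/copowerP.
have [||r [rE1 rE0]] := @tt_cmap _ (ccop I (two_term s)) (two_term t) r1 r0 tt2.
- by move=> x; apply: e2.
- by [].
apply: (@retract_Add _ _ _ I k r).
apply: (@tt_homotopic _ (two_term t) (two_term t) _ _ (zero_map _ _) (\- h : {linear Q' -> P'}) tt1) => x.
  rewrite linear0 /= k1 rE1; apply: oppr_inj; rewrite opprB -[LHS]/(x - r1 (w x)) e3.
  by rewrite [X in - X]add0r opprK.
by rewrite /= k0 rE0 linearN; apply: oppr_inj; rewrite opprB opprK; exact: e4.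
Qed.

Section Cone.
Variables (P1 P0 : lmodType R) (d : {linear P1 -> P0}) (y0 : P0).
Hypotheses (pP1 : projective P1) (pP0 : projective P0).
Let s1 : {linear (P1 * R^o)%type -> P0} := lcopair d (elt y0).

Lemma ptmap_ex : exists f : cmap S (two_term d), forall a, f (Posz 0) a = (a : R) *: y0.
Proof.
have [|//|f [_ fE]] := @tt_cmap _ S (two_term d) (zero_map _ _) (elt y0) (stalk_tt R).
  by move=> x; rewrite (zero_mod0 x) !linear0.
by exists f => a; rewrite fE mklE.
Qed.

Lemma cone_distinguished (f : cmap S (two_term d)) : (forall a, f (Posz 0) a = (a : R) *: y0) ->
  exists (psi : dhom (two_term d) (two_term s1)) (omega : dhom (two_term s1) (shift S)),
    distinguished (dmap f) psi omega.
Proof.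
move=> fE.
have t1 : proj_two_term (two_term s1) by apply: two_term_tt => //; apply: proj_pair => //; exact: proj_reg.
have tC : proj_two_term (cone f).
  split=> [i|i n1 n2 [u v]].
    by apply: proj_pair; [exact: (stalk_tt R).1|exact: (two_term_tt d pP1 pP0).1].
  congr pair; last exact: (two_term_tt d pP1 pP0).2.
  by case: i n1 n2 u v => [[|n]|[|[|n]]] //= _ _ u v; apply: zero_mod0.
(* The cone lists R before P1, whence the exchange of factors. *)
have [|x|c [c1 c0]] := @tt_cmap _ (two_term s1) (cone f)
    (lpair (lsnd _ _) (lfst _ _)) (linr _ _) t1.
- move=> [p a]; rewrite !lpairE; congr pair; rewrite /= ?oppr0 //.
  by rewrite /s1 lcopairE /= mklE fE addrC.
- by rewrite linrE; congr pair; rewrite /= ?linear0 ?oppr0 // add0r.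
have [||c' [c1' c0']] := @tt_cmap _ (cone f) (two_term s1)
    (lpair (lsnd _ _) (lfst _ _)) (lsnd _ _) tC.
- by move=> [a p]; rewrite lpairE /= /s1 lcopairE /= mklE fE addrC.
- by [].
have cc' : homotopic (ccomp c c') (cid _).
  apply: (@tt_homotopic _ (cone f) (cone f) _ _ (zero_map _ _) (zero_map _ _) tC) => [[a p]|[z y]].
    rewrite [X in _ = _ X + _]/= linear0.
    by rewrite /= c1' c1 !lpairE /= subrr addr0.
  by rewrite linear0 /= c0' c0 linrE (zero_mod0 z) /= subrr.
have c'c : homotopic (ccomp c' c) (cid _).
  apply: (@tt_homotopic _ (two_term s1) (two_term s1) _ _ (zero_map _ _) (zero_map _ _) t1) => [[a p]|y].
    by rewrite /= c1 c1' !lpairE /= subrr addr0.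
  by rewrite linear0 /= c0 c0' linrE /= subrr.
exists (dmap (ccomp c' (cone_in f))), (dmap (ccomp (cone_out f) c)).
have did (Z : cpx R) : d_iso (dmap (cid Z)).
  by apply: d_iso_dmap; apply: homotopic_eq.
exists S, (two_term d), f, (dmap (cid _)), (dmap (cid _)), (dmap c); split; split=> //.
- exact: d_iso_dmap c'c cc'.
- exists (dmap f); split; apply: dcomp_dmap; exact: homotopic_eq.
- exists (dmap (cone_in f)); split; apply: dcomp_dmap; last exact: homotopic_eq.
  by apply: homotopic_trans (homotopic_compr (cone_in f) cc') _; apply: homotopic_eq.
exists (dmap (ccomp (cone_out f) c)); split; last by apply: dcomp_dmap; exact: homotopic_eq.
exists (two_term s1), (cid _), (ccomp (cone_out f) c), (cid _).
by split; [exact: qis_id| | |]; apply: homotopic_eq.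
Qed.

(** A morphism R -> Z with Z in Add(s) lifts to copies of s, where it is an element of Q^(I). Its
    class in T^(I) is g (q y0) for some g : T0 -> T^(I), which lifts to a chain map on d; both agree
    on R up to homotopy. *)
Lemma ptmap_approx P Q (T T0 : lmodType R) (s : {linear P -> Q}) (t : {linear Q -> T}) (q : {linear P0 -> T0})
    (f : cmap S (two_term d)) : (forall a, f (Posz 0) a = (a : R) *: y0) ->
  projective_presentation s t -> (forall x, q (d x) = 0) ->
  (forall X : lmodType R, Gen T X -> forall x : X, exists g : {linear T0 -> X}, g (q y0) = x) ->
  Add (two_term s) (two_term d) -> left_approximation (Add (two_term s)) (dmap f).
Proof.
move=> fE ps qd ap A0; split=> // Z psi AZ; have [psP psQ _ _] := ps.
have tS : proj_two_term S := stalk_tt R; have kS := tt_Kproj tS.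
have t0 := two_term_tt d pP1 pP0.
have [I [r cov]] := Add_cover AZ (two_term_tt s psP psQ).
have [a apsi] := act_ex kS psi (cid S).
have [b rb] := cov _ kS a.
have [cP cQ ce co] := cop_pres ps I.
pose b1 : copower I Q := b (Posz 0) (1 : R).
have [|g gx] := ap (copower I T) _ (cop_map t b1).
  by apply/GenP; apply: gen_copower.
have [g0 hg0] := pP0 (g \o q) co.
have [|g1 hg1] := @proj_exact_lift _ _ _ _ _ (cop_map s) (cop_map t) (g0 \o d) pP1 ce.
  by move=> x; rewrite [LHS]hg0 /= qd linear0.
have [||G [_ G0]] := @tt_cmap _ (two_term d) (ccop I (two_term s)) g1 g0 t0.
- by move=> x; rewrite -[LHS]/(g0 (d x)) -[LHS]hg1.
- by move=> x; apply/copowerP.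
exists (dmap (ccomp r G)).
have a1 : act (dmap f) (cid S) f.
  apply: act_homot (act_dmap f (cid S)) (homotopic_refl _) _; exact: homotopic_eq.
apply: (act_dcomp a1 _ apsi); apply: act_homot (act_dmap _ f) (homotopic_refl _) _.
apply: homotopic_trans rb.
apply: (@homotopic_trans _ _ _ _ (ccomp r (ccomp G f))); first exact: homotopic_eq.
apply: homotopic_compl.
have [|u hu] := (ce (g0 y0 - b1)).1.
  apply: etrans (linearB (cop_map t) _ _) _; apply/eqP; rewrite subr_eq0; apply/eqP.
  by apply: etrans (hg0 y0) _; rewrite /= gx.
apply: (@tt_homotopic _ S (ccop I (two_term s)) _ _ (zero_map _ _) (elt u : {linear R^o -> copower I P}) tS) => x.
  by rewrite (zero_mod0 x) !linear0 ?addr0 ?subr0.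
rewrite /= fE G0 -[RHS]/(cop_map s (elt u x)) mklE.
transitivity ((x : R) *: cop_map s u); last exact/esym/linearZ.
rewrite hu scalerBr; congr (_ - _); first exact: linearZ.
exact: (@eltE _ _ (b (Posz 0))).
Qed.
End Cone.
End Existence.

Section MinimalDataEx.
Variables (K : closedFieldType) (A : falgType K).
Implicit Types M N P Q T : lmodType A^c.
Local Notation S := (stalk (A^c)^o).

Lemma homotopy_iso (W : cpx A^c) (h : dhom W W) (e : cmap W W) :
  act h (cid W) e -> qis e -> d_iso h.
Proof.
move=> [u [u1 u2]] qe; exists (Roof qe (cid W)); split.
  exists W, u, (cid W), (cid W); split; first exact: qis_id.
  - exact: u1.
  - exact: homotopic_trans u2 (homotopic_eq _).
  - exact: homotopic_eq.
exists W, (cid W), u, e; split; first exact: qe.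
- exact: homotopic_eq.
- by apply: homotopic_sym; exact: homotopic_trans u1 (homotopic_eq _).
- exact: homotopic_trans u2 (homotopic_eq _).
Qed.

(** Over an isomorphism of T0, e0 is onto since P0 is a projective cover, and then e1 is onto for
    the same reason over the kernel; finite dimension makes both injective. *)
Lemma minimal_endo P1 P0 T0 (d : {linear P1 -> P0}) (q : {linear P0 -> T0})
    (e1 : {linear P1 -> P1}) (e0 : {linear P0 -> P0}) (e : {linear T0 -> T0}) :
  minimal_projective_presentation d q -> fin_dim P1 -> fin_dim P0 -> isob e ->
  (forall x, q (e0 x) = e (q x)) -> (forall x, d (e1 x) = e0 (d x)) -> isob e1 /\ isob e0.
Proof.
move=> [[pP0 qo cq] [N [k [q1 [[ki kq] [pP1 q1o cq1] dE]]]]] f1 f0 [ei eo] qe de.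
have o0 : onto e0.
  apply: cq => y; have [z <-] := eo y; have [x <-] := qo z; exists x; exact: qe.
have i0 := hopf f0 o0.
have o1 : onto e1.
  apply: cq1 => n; have [z hz] := o0 (k n).
  have /kq [n' hn] : q z = 0.
    apply: ei; rewrite linear0 -qe hz; apply/kq; by exists n.
  have [p hp] := q1o n'; exists p; apply: ki.
  by rewrite /= -dE de dE hp hn hz.
by split; split=> //; apply: hopf.
Qed.

(** Represent h by a chain map e. From h f = f the map induced on T0 fixes q y0, so it is an
    isomorphism, and [minimal_endo] makes e bijective in each degree. *)
Lemma ptmap_minimal P1 P0 T0 (d : {linear P1 -> P0}) (q : {linear P0 -> T0}) (y0 : P0)
    (f : cmap S (two_term d)) : (forall a, f (Posz 0) a = (a : A^c) *: y0) ->
  minimal_projective_presentation d q -> fin_dim P1 -> fin_dim P0 ->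
  (forall e : {linear T0 -> T0}, e (q y0) = q y0 -> isob e) -> left_minimal (dmap f).
Proof.
move=> fE md f1 f0 mi h hff.
have [pP1 pP0 dq qo] := minpres_exact md.
have t0 := two_term_tt d pP1 pP0; have k0 := tt_Kproj t0.
have tS : proj_two_term S := stalk_tt A^c; have kS := tt_Kproj tS.
have [e ae] := act_ex k0 h (cid _).
apply: (homotopy_iso ae).
have af : act (dmap f) (cid S) f.
  apply: act_homot (act_dmap f (cid S)) (homotopic_refl _) _; exact: homotopic_eq.
have ahf : act h f (ccomp e f).
  by apply: act_homot (act_pre f ae) _ (homotopic_refl _); exact: homotopic_eq.
have ef := act_uniq kS (act_comp kS hff af ahf) af (homotopic_refl _).
have [h2 [h1 [_ e0]]] := tt_homotopicP tS ef.
have [|eb heb] := @fact_quo _ _ _ _ q (q \o (e (Posz 0) : {linear P0 -> P0})) qo.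
  move=> x /dq [p <-]; apply/dq; exists (e (Negz 0) p).
  exact/esym/(@cfunP _ _ _ e (Negz 0) p).
have [|||b1 b0] := @minimal_endo _ _ _ d q (e (Negz 0)) (e (Posz 0)) eb md f1 f0.
- apply: mi; rewrite heb; apply: subr0_eq; transitivity (q (e (Posz 0) y0 - y0)); first by rewrite linearB.
  apply/dq; exists (h1 1).
  by have := e0 1; rewrite /= fE scale1r => ->.
- by move=> x; rewrite heb.
- by move=> p; exact/esym/(@cfunP _ _ _ e (Negz 0) p).
apply: qis_bij; case=> [[|n]|[|n]] //; split=> [x y _|y]; rewrite ?(zero_mod0 x) ?(zero_mod0 y) //.
- by exists 0; apply: zero_mod0.
- by exists 0; apply: zero_mod0.
Qed.

Lemma minimal_data_ex T : fd_silting T -> exists (P1 Q1 : lmodType A^c) (s1 : {linear P1 -> Q1}),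
  [/\ minimal_silting_data T s1, projective P1 /\ projective Q1, fin_gen P1 & fin_gen Q1].
Proof.
move=> [fT [P [Q [s [[t ps] sG]]]]].
have [T0 [P1 [P0 [T1 [x0 [y0 [d [q [c [[f0 a0 f1 f2] [md qy co ce] ap mi [pc cG]]]]]]]]]]] :=
  min_silting_ex ps sG fT.
have [pP1 pP0 dq qo] := minpres_exact md.
have pC : projective (P1 * (A^c)^o : lmodType A^c)%type by apply: proj_pair => //; exact: proj_reg.
exists (P1 * (A^c)^o)%type, P0, (cone_pres d y0).
split=> //; last 2 first.
- apply: fin_gen_fd; apply: fd_pair => //; exact: fd_reg.
- exact: fin_gen_fd.
have [f fE] := ptmap_ex d y0.
have [psi [omega ds]] := cone_distinguished pP1 pP0 fE.
have A0 : Add (two_term s) (two_term d).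
  apply: (two_term_Add ps sG (minpres_exact md) (inAdd_gen a0)) => X GX.
  by apply: (inAdd_D ps a0 md f1 f2); rewrite sG.
have T1G : Gen T T1.
  by apply/GenP; apply: gen_onto co _; apply/GenP; exact: inAdd_gen a0.
have A1 : Add (two_term s) (two_term (cone_pres d y0)).
  by apply: (two_term_Add ps sG pc T1G) => X; rewrite cG.
exists P, Q, s, (two_term d), (dmap f), psi, omega; split; first by split=> //; split=> //; exists t.
split=> //.
  apply: (ptmap_approx pP1 pP0 fE ps _ _ A0) => [x|X GX x].
    by apply/dq; exists x.
  rewrite qy; exact: ap.
by apply: (ptmap_minimal fE md f1 f2); rewrite qy.
Qed.
End MinimalDataEx.

(** * The three bijections *)

Section Bireflective.
Variable R : pzRingType.
Implicit Types (C : subcat R) (M N X Y Z P Q L : lmodType R).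

(** The embedding k extends to g : L N -> X, and f g vanishes since it does so on N. So g factors
    through N, and the resulting map inverts the unit. *)
Lemma reflective_ker C X Y N (f : {linear X -> Y}) (k : {linear N -> X}) :
  replete C -> reflective C -> is_kernel k f -> C X -> C Y -> C N.
Proof.
move=> rC [L [eta [CL uni]]] [ki kf] CX CY.
have [g [gk _]] := uni _ _ k CX.
have f0 x : f (g x) = 0.
  have [z [_ zu]] := uni _ _ (zero_map N Y) CY.
  have e : f \o g =1 z by apply: zu => n /=; rewrite gk; apply/kf; exists n.
  by rewrite [LHS]e -(zu (zero_map _ _)).
have [|g' hg'] := @fact_sub _ _ _ _ k g ki; first by move=> x; apply/kf.
have ge n : g' (eta N n) = n by apply: ki; rewrite hg' gk.
have [z [_ zu]] := uni _ _ (eta N) (CL N).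
have eg x : eta N (g' x) = x.
  have e : eta N \o g' =1 z by apply: zu => n /=; rewrite ge.
  by rewrite [LHS]e -(zu idfun).
by apply: (rC (L N)) (CL N); exists g', (eta N).
Qed.

Lemma coreflective_split C X (L : lmodType R) (eps : {linear L -> X}) (g : {linear X -> L}) :
  replete C -> C L -> (forall g' : {linear L -> L}, (forall y, eps (g' y) = eps y) -> g' =1 id) ->
  (forall x, eps (g x) = x) -> C X.
Proof.
move=> rC CL uni eg; apply: rC CL; exists eps, g => // x.
by apply: (uni (g \o eps)) => y /=; rewrite eg.
Qed.

Lemma coreflective_ex C X : coreflective C -> exists L (eps : {linear L -> X}),
  [/\ C L, (forall Y (f : {linear Y -> X}), C Y -> exists g : {linear Y -> L}, forall y, eps (g y) = f y) &
  forall Y (g g' : {linear Y -> L}), C Y -> (forall y, eps (g y) = eps (g' y)) -> g =1 g'].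
Proof.
move=> [L [eps [CL uni]]]; exists (L X), (eps X); split=> // [Y f CY|Y g g' CY e].
  by have [g [gE _]] := uni X Y f CY; exists g.
have [z [_ zu]] := uni X Y (eps X \o g') CY.
by move=> y; rewrite (zu g) ?(zu g').
Qed.

(** The lift of p to the coreflection of Q kills the image of f, so it descends to a section of the
    counit, which is then invertible. *)
Lemma coreflective_coker C X Y Q (f : {linear X -> Y}) (p : {linear Y -> Q}) :
  replete C -> coreflective C -> onto p -> exact f p -> C X -> C Y -> C Q.
Proof.
move=> rC cC po fp CX CY; have [L [eps [CL lift uni]]] := coreflective_ex Q cC.
have [g gE] := lift _ p CY.
have [|g' hg'] := @fact_quo _ _ _ _ p g po.
  move=> y /fp [x <-]; apply: (uni _ (g \o f) (zero_map _ _) CX) => {}x /=.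
  by rewrite gE linear0; apply/fp; exists x.
apply: (coreflective_split (eps := eps) (g := g') rC CL) => [h e|x].
  by apply: (uni _ h idfun CL).
by have [y <-] := po x; rewrite hg' gE.
Qed.

Lemma coreflective_cop C (I : choiceType) X : replete C -> coreflective C -> C X -> C (copower I X).
Proof.
move=> rC cC CX; have [L [eps [CL lift uni]]] := coreflective_ex (copower I X) cC.
have /choice [g gE] : forall i, exists g : {linear X -> L}, forall x, eps (g x) = cop_in X i x.
  by move=> i; apply: lift.
apply: (coreflective_split (eps := eps) (g := cop_elim g) rC CL) => [h e|x].
  by apply: (uni _ h idfun CL).
apply: (@cop_ext _ _ _ _ (eps \o cop_elim g) idfun) => i y /=.
by rewrite cop_elimE gE.
Qed.

Lemma reflective_gen C : reflective C -> exists L (x0 : L), C L /\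
  forall X, C X -> forall x : X, exists g : {linear L -> X}, g x0 = x /\
    forall g' : {linear L -> X}, g' x0 = x -> g' =1 g.
Proof.
move=> [L [eta [CL uni]]]; exists (L R^o), (eta R^o 1); split=> // X CX x.
have [g [gE gu]] := uni _ _ (elt x) CX; exists g; split=> [|g' g'x].
  by rewrite gE elt1.
apply: gu => r; rewrite -[LHS]/((g' \o eta _) r); apply: reg_ext.
by rewrite /= g'x elt1.
Qed.

Lemma bireflective_wide C : bireflective_ext_closed C -> wide C.
Proof.
move=> [rC [refl corefl] extC]; split=> //.
- by move=> X Y N f k; apply: reflective_ker.
- by move=> X Y Q f p; apply: coreflective_coker.
- by move=> I X; apply: coreflective_cop.
Qed.

Lemma bireflective_afrak C : bireflective_ext_closed C -> afrak (tgen C) = C.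
Proof.
move=> bC; have [_ [refl _] _] := bC; have [L [x0 [CL uni]]] := reflective_gen refl.
apply: (afrak_tgen (bireflective_wide bC) CL) => V CV x.
by have [g [<- _]] := uni V CV x; apply: tr_in.
Qed.
End Bireflective.

Section Epis.
Variable A : pzRingType.
Implicit Types (C : subcat A^c) (f : ring_from A).

Lemma epi_bireflective f : tor_ring_epi f -> bireflective_ext_closed (Xring f).
Proof.
move=> [ef tf]; split; [exact: Xring_repl| |exact: tor_ext_closed].
by split; [exact: Xring_reflective|exact: Xring_coreflective].
Qed.

Lemma localising_epi C (L : lmodType A^c) (x0 : L) : replete C -> extension_closed C ->
  (forall (X Y Q : lmodType A^c) (f : {linear X -> Y}) (p : {linear Y -> Q}),
    onto p -> exact f p -> C X -> C Y -> C Q) ->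
  (forall (I : choiceType) X, C X -> C (copower I X)) -> C L ->
  (forall X, C X -> forall x : X, exists g : {linear L -> X}, g x0 = x /\
    forall g' : {linear L -> X}, g' x0 = x -> g' =1 g) ->
  exists2 f, tor_ring_epi f & Xring f = C.
Proof.
move=> rC eC cC pC CL uni; pose d := LocData CL uni.
have ef : ring_epi (loc_ring d) := @loc_epi _ d rC cC pC.
have XE : Xring (loc_ring d) = C := @loc_Xring _ d rC cC pC.
exists (loc_ring d) => //; split=> //.
by apply: ext_closed_tor ef _; rewrite XE.
Qed.
End Epis.

Section TauTiltingFinite.
Variables (K : closedFieldType) (A : falgType K).
Implicit Types (T X : lmodType A^c) (f : ring_from A).

Lemma silting_tors T : fd_silting T -> tors (Gen T).
Proof. by move=> [_ [P [Q [s [[t ps] sG]]]]]; apply: silt_tors ps sG. Qed.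

Lemma Gen_afrak_inj T T' : fd_silting T -> fd_silting T' ->
  afrak (Gen T) = afrak (Gen T') -> Gen T = Gen T'.
Proof.
move=> [fT [P [Q [s [[t ps] sG]]]]] [fT' [P' [Q' [s' [[t' ps'] sG']]]]] e.
by rewrite (Gen_afrak ps sG fT) e -(Gen_afrak ps' sG' fT').
Qed.

Lemma afrak_generator T : fd_silting T -> exists (L : lmodType A^c) (x0 : L), [/\ fin_dim L, afrak (Gen T) L,
  forall (I : choiceType) X, afrak (Gen T) X -> afrak (Gen T) (copower I X) &
  forall X, afrak (Gen T) X -> forall x : X, exists g : {linear L -> X}, g x0 = x /\
    forall g' : {linear L -> X}, g' x0 = x -> g' =1 g].
Proof.
move=> sT; have tG := silting_tors sT; have [fT [P [Q [s [[t ps] sG]]]]] := sT.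
have [T0 [P1 [P0 [T1 [x0 [y0 [d [q [c [[f0 a0 f1 f2] [md qy co ce] ap mi [pc cG]]]]]]]]]]] :=
  min_silting_ex ps sG fT.
have G0 := inAdd_gen a0.
have aE X : afrak (Gen T) X <-> Gen T X /\ perp T1 X.
  by apply: (afrak_perp tG G0 co ce ap) => e ex; have [] := mi e ex.
have [|L [l [lo [GL pL] uni]]] := perp_reflection tG G0 co ce ap pc.
  by move=> X; rewrite cG.
exists L, (l x0); split; [exact: fd_onto lo f0|exact/aE| |].
  move=> I X /aE[GX pX]; apply/aE; split.
    by apply: tG.1; apply: gen_copower.
  by move=> g y; apply/copowerP => i; have := pX (cop_at X i \o g) y; rewrite /= cop_atE.
by move=> X /aE[GX pX]; apply: uni.
Qed.

Lemma afrak_epi T : fd_silting T -> exists2 f, tor_ring_epi f & Xring f = afrak (Gen T).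
Proof.
move=> sT; have tG := silting_tors sT; have [L [x0 [fL aL cop uni]]] := afrak_generator sT.
apply: localising_epi (afrak_repl tG) (afrak_ext tG) _ cop aL uni.
move=> X Y C g p po gp aX aY; have [I [e [j [eo ji je]]]] := im_ex g.
apply: (afrak_quo tG (k := j) (p := p) _ _ aY); last exact: tors_onto tG eo aX.1.
split=> // y; split=> [/gp [x <-]|[i <-]]; first by exists (e x).
by have [x <-] := eo i; apply/gp; exists x.
Qed.

(** B is a quotient of L: the maps L -> B and B -> L matching x0 with 1 compose to the identity of
    B. *)
Lemma afrak_fin_dim T f : fd_silting T -> ring_epi f -> Xring f = afrak (Gen T) ->
  fin_dim (rightreg f).
Proof.
move=> sT ef XE; have [L [x0 [fL aL _ uni]]] := afrak_generator sT.
have Xr : Xring f (rightreg f) by exact: Xring_rs.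
have aR : afrak (Gen T) (rightreg f) by rewrite -XE.
have [g [gx _]] := uni _ aR 1.
have [|h [hx _]] := @rightreg_ext _ f _ x0 ef; first by rewrite XE.
apply: fd_onto fL; last by move=> b; exists (h b); apply: (rightreg_uniq (g := g \o h) (g' := idfun) ef Xr); rewrite /= hx.
Qed.

Lemma silting_epi_afrak T f : silting_ring_epi T f -> Xring f = afrak (Gen T).
Proof. by move=> [_ [P1 [Q1 [s1 [/data_afrak <- ->]]]]]. Qed.

Lemma silting_epi_ex T f : fd_silting T -> ring_epi f -> Xring f = afrak (Gen T) ->
  silting_ring_epi T f.
Proof.
move=> sT ef XE; split=> //; have [P1 [Q1 [s1 [ds _ _ _]]]] := minimal_data_ex sT.
by exists P1, Q1, s1; rewrite (data_afrak ds).
Qed.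

Lemma bireflective_silting (C : subcat A^c) : tau_tilting_finite A ->
  bireflective_ext_closed C -> exists T, fd_silting T /\ C = afrak (Gen T).
Proof.
move=> tf bC; have [T [sT TE]] := tors_silting tf (tgen_tors C).
by exists T; rewrite -TE bireflective_afrak.
Qed.

Lemma epi_silting f : tau_tilting_finite A -> tor_ring_epi f ->
  exists T, fd_silting T /\ Xring f = afrak (Gen T).
Proof. by move=> tf /epi_bireflective; apply: bireflective_silting. Qed.
End TauTiltingFinite.

Theorem theorem4p7 (K : closedFieldType) (A : falgType K)
    (tau_fin : tau_tilting_finite A) :
  [/\ class_bijection (@fd_silting K A) (@silting_equiv K A)
        (@tor_ring_epi A) (@same_epiclass A) (@silting_ring_epi A),
      class_bijection (@tor_ring_epi A) (@same_epiclass A)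
        (@bireflective_ext_closed A^c) eq (fun f W => W = Xring f),
      class_bijection (@fd_silting K A) (@silting_equiv K A)
        (@bireflective_ext_closed A^c) eq (fun T W => W = afrak (Gen T)),
      (forall (T : lmodType A^c) (f : ring_from A), fd_silting T ->
         silting_ring_epi T f -> Xring f = afrak (Gen T)) &
      (forall f : ring_from A, tor_ring_epi f ->
         universal_localisation f /\ fin_dim (rightreg f))].
Proof.
split.
- split=> [T f sT sf|T sT|T T' f f' sT sT' sf sf' TT'|T T' f f' sT sT' sf sf' ff'|f tf].
  + split; first exact: sf.1.
    apply: ext_closed_tor sf.1 _; rewrite (silting_epi_afrak sf).
    exact: afrak_ext (silting_tors sT).
  + have [f [ef _] XE] := afrak_epi sT; exists f; exact: silting_epi_ex.
  + apply: Xring_same_epiclass sf.1 sf'.1 _.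
    by rewrite (silting_epi_afrak sf) (silting_epi_afrak sf') TT'.
  + apply: Gen_afrak_inj => //.
    by rewrite -(silting_epi_afrak sf) -(silting_epi_afrak sf') (same_epiclass_Xring ff').
  + have [T [sT XE]] := epi_silting tau_fin tf; have [ef _] := tf.
    exists T, f; split=> //; first exact: silting_epi_ex.
    exact: Xring_same_epiclass.
- split=> [f W tf ->|f tf|f f' W W' tf tf' -> -> ff'|f f' W W' tf tf' -> -> e|W bW].
  + exact: epi_bireflective.
  + by exists (Xring f).
  + exact: same_epiclass_Xring.
  + exact: Xring_same_epiclass tf.1 tf'.1 e.
  + have [T [sT ->]] := bireflective_silting tau_fin bW.
    by have [f tf XE] := afrak_epi sT; exists f, (Xring f).
- split=> [T W sT ->|T sT|T T' W W' _ _ -> -> ->|T T' W W' sT sT' -> ->|W bW].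
  + by have [f tf <-] := afrak_epi sT; apply: epi_bireflective.
  + by exists (afrak (Gen T)).
  + by [].
  + exact: Gen_afrak_inj.
  + have [T [sT WE]] := bireflective_silting tau_fin bW.
    by exists T, (afrak (Gen T)).
- by move=> T f _; apply: silting_epi_afrak.
move=> f tf; have [T [sT XE]] := epi_silting tau_fin tf; have [ef _] := tf.
split; last exact: afrak_fin_dim sT ef XE.
have [P1 [Q1 [s1 [ds [pP pQ] fP fQ]]]] := minimal_data_ex sT.
by apply: (univ_loc ef pP pQ fP fQ (s := s1)); rewrite XE (data_afrak ds).
Qed.
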